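(* Let $f(z)=z+a_2z^2+a_3z^3+\cdots\in\mathcal{C}_{\arcsin}$ and let $\gamma_1,\gamma_2$ be the first two logarithmic coefficients of $f$. Then $$-\frac{1}{2\pi}\left(1-\frac{1}{6\pi}\right)\le |\gamma_2|-|\gamma_1|\le \frac{1}{6\pi}.$$ Both inequalities are sharp, i.e. for each of them there is a function in $\mathcal{C}_{\arcsin}$ for which equality holds.
   Context: Let $\Omega=\{z\in\mathbb{C}:|z|<1\}$. Let $\mathcal{A}$ be the family of analytic functions $f$ in $\Omega$ normalized by $f(z)=z+\sum_{n=2}^{\infty}a_nz^n$, and let $\mathcal{S}\subset\mathcal{A}$ be the subclass of univalent functions. A Schwarz function is an analytic $\omega:\Omega\to\mathbb{C}$ with $\omega(0)=0$ and $|\omega(z)|\le 1$ on $\Omega$. For analytic $g,h$ in $\Omega$, $g\prec h$ (subordination) means that there is a Schwarz function $\omega$ with $g(z)=h(\omega(z))$ for all $z\in\Omega$. With $\arcsin$ the principal branch ($\arcsin 0=0$), define $$\mathcal{C}_{\arcsin}=\left\{f\in\mathcal{S}:\ 1+\frac{zf''(z)}{f'(z)}\prec 1+\frac{2}{\pi}\arcsin z \text{ in } \Omega\right\}.$$ The logarithmic coefficients $\gamma_n$ of $f\in\mathcal{S}$ are defined by $\log\left(\frac{f(z)}{z}\right)=2\sum_{n=1}^{\infty}\gamma_nz^n$ with $\log 1=0$. Thus $\gamma_1=\frac12a_2$ and $\gamma_2=\frac12\left(a_3-\frac12a_2^2\right)$. *)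

(* Defs.v *)
From Stdlib Require Import Reals.
From Coquelicot Require Import Coquelicot.

Open Scope R_scope.
Open Scope C_scope.

Definition Omega (z : C) : Prop := Cmod z < 1.

Definition analytic (f : C -> C) : Prop :=
  forall z : C, Omega z -> @ex_derive C_AbsRing C_NormedModule f z.

Definition power_series_at (a : nat -> C) (z s : C) : Prop :=
  @is_pseries C_AbsRing C_NormedModule a z s.

Definition univalent (f : C -> C) : Prop :=
  forall z w : C, Omega z -> Omega w -> f z = f w -> z = w.

Definition class_A (f : C -> C) : Prop :=
  analytic f /\
  exists a : nat -> C,
    a 0%nat = 0 /\ a 1%nat = 1 /\
    forall z : C, Omega z -> power_series_at a z (f z).

Definition class_S (f : C -> C) : Prop := class_A f /\ univalent f.

Definition Schwarz_function (w : C -> C) : Prop :=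
  analytic w /\ w 0 = 0 /\ forall z : C, Omega z -> (Cmod (w z) <= 1)%R.

Definition subordinate (g h : C -> C) : Prop :=
  exists w : C -> C,
    Schwarz_function w /\ forall z : C, Omega z -> g z = h (w z).

Definition Cexp (z : C) : C :=
  ((exp (Re z) * cos (Im z))%R, (exp (Re z) * sin (Im z))%R).

(** Values in (-PI, PI]; [Carg 0] is a junk value. *)
Definition Carg (z : C) : R :=
  if Rle_dec 0 (Im z) then acos (Re z / Cmod z) else (- acos (Re z / Cmod z))%R.

Definition Clog (z : C) : C := (ln (Cmod z), Carg z).

Definition Csqrt (z : C) : C :=
  if Ceq_dec z 0 then 0 else Cexp (Clog z / 2).

(** The standard closed form of the principal branch,
    [arcsin z = -i Log (i z + sqrt (1 - z^2))]: the inverse of [sin] on the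
    strip [|Re w| < PI/2], analytic off the real rays [|x| >= 1]. *)
Definition Carcsin (z : C) : C :=
  - (Ci * Clog (Ci * z + Csqrt (1 - z * z))).

Definition class_C_arcsin (f : C -> C) : Prop :=
  class_S f /\
  subordinate (fun z => 1 + z * C_derive (C_derive f) z / C_derive f z)
              (fun z => 1 + RtoC (2 / PI) * Carcsin z).

(** [L] is the analytic branch of [log (f z / z)] on [Omega] with [log 1 = 0];
    [f z / z] takes the value 1 at [z = 0], hence [L 0 = 0].  The coefficients
    are indexed from 1, so [gamma 0] is unused. *)
Definition logarithmic_coefficients (f : C -> C) (gamma : nat -> C) : Prop :=
  exists L : C -> C,
    analytic L /\ L 0 = 0 /\
    (forall z : C, Omega z -> z <> 0 -> Cexp (L z) = f z / z) /\
    forall z : C, Omega z ->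
      power_series_at (fun n => match n with O => 0 | S _ => 2 * gamma n end)
        z (L z).

(* Main.v *)
(** Writing the subordination as [z f''/f' = (2/pi) arcsin w] with
    [w z = c1 z + c2 z^2 + ...] gives [gamma_1 = c1 / (2 pi)] and
    [gamma_2 = (c2 + c1^2 / (2 pi)) / (6 pi)], so both inequalities follow from
    [|c2| <= 1 - |c1|^2].  A Schwarz function is only assumed complex
    differentiable here; but [w = sin ((pi/2) z f''/f')], and since [arcsin w] is
    bounded, a Gronwall argument along rays shows that [f'] has no zero, so that
    [w] is continuously differentiable.  Then circle means of [w (p + q/z)^2] do
    not depend on the radius, and a good choice of [p] and [q] yields the
    coefficient bound.

    Equality holds for [w = z] (lower bound) and [w = z^2] (upper bound).  In these
    cases the series [P] of [z f'/f] solves [P' = P (B' - L')], where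
    [z B' = (2/pi) arcsin w] and [z L' = P - 1]; its coefficients are bounded by 1,
    so [L = log (f/z)] and [f = z e^L] are power series on the whole disk, and
    [f' = e^B] has positive real part because [|B| <= 4/pi < pi/2]. *)
Require Import Defs.
From Stdlib Require Import Reals Ranalysis5 Wf_nat Lra Lia Psatz.
From Coquelicot Require Import Coquelicot.

Open Scope R_scope.

(** * Limits and derivatives *)

(** Regularity shapes the proof. Differentiating a circle mean under the integral sign takes a
    continuous derivative, and a Schwarz function comes without a power series; only [f] has one. So
    smoothness is carried over from [f''/f'], which must first be known to have no pole. The mean of
    [Re G] over a circle of radius [r] is constant because, by Cauchy-Riemann in polar form, [r]
    times its radial derivative is the angular derivative of [Im G], whose integral over a period is
    zero.

    The kernel is a square so that its modulus on the unit circle is [|p + q conj z|^2], with mean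
    [|p|^2 + |q|^2]; the coefficient inequality is then a completed square in [p].

    For sharpness, prescribing [f'] gives [f] at once, but a logarithm of [f(z)/z] would require
    that this quotient has no zero. Starting from [P] makes the logarithm part of the construction:
    the equation for [P] amounts to [P = e^(B - L)]. The Taylor coefficients of the arcsine sum to
    [pi/2]; the cruder bound 2 is what produces [4/pi]. *)

Definition nbhs (z : C) : (C -> Prop) -> Prop :=
  @locally (AbsRing_UniformSpace C_AbsRing) z.

Lemma nbhs_iff (z : C) (P : C -> Prop) :
  nbhs z P <-> exists d : R, 0 < d /\ forall y, Cmod (y - z) < d -> P y.
Proof.
split.
- intros [d Hd]; exists d; split; [apply cond_pos | exact Hd].
- intros [d [Hd H]]; exists (mkposreal d Hd); exact H.
Qed.

(** The filter is arbitrary so that the same rules serve limits in [C], along a real parameter, and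
    in the two parameters (radius, angle) of a circle. *)
Definition Clim {T : Type} (F : (T -> Prop) -> Prop) (f : T -> C) (l : C) : Prop :=
  forall eps, 0 < eps -> F (fun x => Cmod (f x - l) < eps).

Definition Ccont (f : C -> C) (z : C) : Prop := Clim (nbhs z) f (f z).

Lemma C_ext (x y : C) : Re x = Re y -> Im x = Im y -> x = y.
Proof. destruct x, y; unfold Re, Im; simpl; intros -> ->; reflexivity. Qed.

Lemma Cmod_sub_comm (x y : C) : Cmod (x - y) = Cmod (y - x).
Proof. rewrite <- Cmod_opp; f_equal; ring. Qed.

Lemma Cmod_minus_triangle (x y : C) : Cmod (x - y) <= Cmod x + Cmod y.
Proof. unfold Cminus. rewrite <- (Cmod_opp y). apply Cmod_triangle. Qed.

Lemma Cmod_reverse_triangle (x y : C) : Cmod x - Cmod y <= Cmod (x - y).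
Proof.
generalize (Cmod_triangle (x - y) y); replace (x - y + y)%C with x by ring; lra.
Qed.

Section Limits.

Context {T : Type} {F : (T -> Prop) -> Prop} {FF : Filter F}.

Lemma Clim_ext_loc (f g : T -> C) (l : C) :
  F (fun x => f x = g x) -> Clim F f l -> Clim F g l.
Proof.
intros E H eps He.
generalize (filter_and _ _ E (H eps He)); apply filter_imp.
intros x [-> Hx]; exact Hx.
Qed.

Lemma Clim_const (c : C) : Clim F (fun _ => c) c.
Proof.
intros eps He; apply filter_forall; intros _.
replace (c - c)%C with (RtoC 0) by ring; rewrite Cmod_0; exact He.
Qed.

Lemma Clim_plus (f g : T -> C) (l m : C) :
  Clim F f l -> Clim F g m -> Clim F (fun x => f x + g x)%C (l + m)%C.
Proof.
intros Hf Hg eps He.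
assert (He2 : 0 < eps / 2) by lra.
generalize (filter_and _ _ (Hf _ He2) (Hg _ He2)).
apply filter_imp; intros x [H1 H2].
replace (f x + g x - (l + m))%C with ((f x - l) + (g x - m))%C by ring.
generalize (Cmod_triangle (f x - l) (g x - m)); lra.
Qed.

Lemma Clim_mult (f g : T -> C) (l m : C) :
  Clim F f l -> Clim F g m -> Clim F (fun x => f x * g x)%C (l * m)%C.
Proof.
intros Hf Hg eps He.
pose (K := Cmod l + Cmod m + 1).
assert (HK : 0 < K) by (generalize (Cmod_ge_0 l) (Cmod_ge_0 m); unfold K; lra).
pose (e := Rmin 1 (eps / (2 * K))).
assert (He' : 0 < e) by (apply Rmin_pos; [lra | apply Rdiv_lt_0_compat; lra]).
assert (H1 : e <= 1) by apply Rmin_l.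
assert (H2 : e * K < eps).
{ apply Rle_lt_trans with (eps / (2 * K) * K).
  - apply Rmult_le_compat_r; [lra | apply Rmin_r].
  - replace (eps / (2 * K) * K) with (eps / 2) by (field; lra); lra. }
generalize (filter_and _ _ (Hf e He') (Hg e He')).
apply filter_imp; intros x [Hfx Hgx].
replace (f x * g x - l * m)%C
  with ((f x - l) * m + (l * (g x - m) + (f x - l) * (g x - m)))%C by ring.
generalize (Cmod_triangle ((f x - l) * m) (l * (g x - m) + (f x - l) * (g x - m))).
generalize (Cmod_triangle (l * (g x - m)) ((f x - l) * (g x - m))).
rewrite !Cmod_mult.
generalize (Cmod_ge_0 l) (Cmod_ge_0 m) (Cmod_ge_0 (f x - l)) (Cmod_ge_0 (g x - m)).
unfold K in *; intros; nra.
Qed.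

Lemma Clim_inv (f : T -> C) (l : C) :
  l <> 0 -> Clim F f l -> Clim F (fun x => / f x)%C (/ l)%C.
Proof.
intros Hl Hf eps He.
assert (Hm : 0 < Cmod l) by (apply Cmod_gt_0; exact Hl).
pose (e := Rmin (Cmod l / 2) (eps * (Cmod l * Cmod l / 2))).
assert (Hm2 : 0 < Cmod l * Cmod l) by (apply Rmult_lt_0_compat; exact Hm).
assert (He' : 0 < e).
{ apply Rmin_pos; [lra | apply Rmult_lt_0_compat; lra]. }
assert (H1 : e <= Cmod l / 2) by apply Rmin_l.
assert (H2 : e <= eps * (Cmod l * Cmod l / 2)) by apply Rmin_r.
generalize (Hf e He'); apply filter_imp; intros x Hx.
assert (Hfx : Cmod l / 2 < Cmod (f x)).
{ generalize (Cmod_reverse_triangle l (f x)); rewrite Cmod_sub_comm; lra. }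
assert (Hn : f x <> 0) by (apply Cmod_gt_0; lra).
replace (/ f x - / l)%C with ((l - f x) * / (f x * l))%C
  by (field; split; assumption).
rewrite Cmod_mult, Cmod_inv, Cmod_mult, Cmod_sub_comm
  by (apply Cmult_neq_0; assumption).
apply Rmult_lt_reg_r with (Cmod (f x) * Cmod l); [nra |].
rewrite Rmult_assoc, Rinv_l by nra.
generalize (Cmod_ge_0 (f x - l)); intros; nra.
Qed.

Lemma Clim_comp (f : T -> C) (g : C -> C) (l m : C) :
  Clim F f l -> Clim (nbhs l) g m -> Clim F (fun x => g (f x)) m.
Proof.
intros Hf Hg eps He.
destruct (proj1 (nbhs_iff _ _) (Hg eps He)) as [d [Hd H]].
generalize (Hf d Hd); apply filter_imp; intros x; apply H.
Qed.

Lemma Clim_Re_Im (f : T -> C) (l : C) :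
  filterlim (fun x => Re (f x)) F (locally (Re l)) ->
  filterlim (fun x => Im (f x)) F (locally (Im l)) -> Clim F f l.
Proof.
intros H1 H2 eps He.
assert (He2 : 0 < eps / 2) by lra.
generalize (filter_and _ _
  (proj1 (filterlim_locally _ _) H1 (mkposreal _ He2))
  (proj1 (filterlim_locally _ _) H2 (mkposreal _ He2))).
apply filter_imp; intros x [B1 B2].
change (Rabs (Re (f x) - Re l) < eps / 2) in B1.
change (Rabs (Im (f x) - Im l) < eps / 2) in B2.
replace (f x - l)%C with (RtoC (Re (f x) - Re l) + Ci * RtoC (Im (f x) - Im l))%C.
- eapply Rle_lt_trans; [apply Cmod_triangle |].
  rewrite Cmod_mult, Cmod_Ci, !Cmod_R; lra.
- apply C_ext; unfold Re, Im, Cminus, Cplus, Cmult, Copp, RtoC, Ci; simpl; ring.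
Qed.

Lemma Clim_Re (f : T -> C) (l : C) :
  Clim F f l -> filterlim (fun x => Re (f x)) F (locally (Re l)).
Proof.
intros H; apply filterlim_locally; intros eps.
generalize (H eps (cond_pos eps)); apply filter_imp; intros x Hx.
change (Rabs (Re (f x) - Re l) < eps).
replace (Re (f x) - Re l) with (Re (f x - l)) by (unfold Re, Cminus, Cplus, Copp; simpl; ring).
eapply Rle_lt_trans; [apply re_le_Cmod | exact Hx].
Qed.

End Limits.

#[export] Instance nbhs_filter (z : C) : ProperFilter (nbhs z).
Proof. exact (@locally_filter (AbsRing_UniformSpace C_AbsRing) z). Qed.

Lemma Clim_id (z : C) : Clim (nbhs z) (fun y => y) z.
Proof. intros eps He; apply nbhs_iff; exists eps; split; auto. Qed.

(* Caratheodory's form of differentiability: the algebraic rules follow from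
   those for limits. *)
Definition Cder (f : C -> C) (z l : C) : Prop :=
  exists phi : C -> C, Clim (nbhs z) phi l /\ phi z = l /\
    forall y, f y = (f z + phi y * (y - z))%C.

Lemma Cder_cont (f : C -> C) (z l : C) : Cder f z l -> Ccont f z.
Proof.
intros [phi [H1 [H2 H3]]]; unfold Ccont.
assert (E : f z = (f z + l * (z - z))%C) by ring.
rewrite E; clear E.
apply (Clim_ext_loc (fun y => f z + phi y * (y - z))%C).
- apply filter_forall; intros y; symmetry; apply H3.
- apply Clim_plus; [apply Clim_const |].
  apply Clim_mult; [exact H1 |].
  apply Clim_plus; [apply Clim_id | apply Clim_const].
Qed.

Lemma Cder_const (c z : C) : Cder (fun _ => c) z 0.
Proof.
exists (fun _ => RtoC 0); split; [apply Clim_const | split; [reflexivity | intros; ring]].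
Qed.

Lemma Cder_id (z : C) : Cder (fun y => y) z 1.
Proof.
exists (fun _ => RtoC 1); split; [apply Clim_const | split; [reflexivity | intros; ring]].
Qed.

Lemma Cder_plus (f g : C -> C) (z l m : C) :
  Cder f z l -> Cder g z m -> Cder (fun y => f y + g y)%C z (l + m)%C.
Proof.
intros [p [P1 [P2 P3]]] [q [Q1 [Q2 Q3]]].
exists (fun y => p y + q y)%C; split; [| split].
- apply Clim_plus; assumption.
- rewrite P2, Q2; reflexivity.
- intros y; rewrite (P3 y), (Q3 y); ring.
Qed.

Lemma Cder_mult (f g : C -> C) (z l m : C) :
  Cder f z l -> Cder g z m ->
  Cder (fun y => f y * g y)%C z (l * g z + f z * m)%C.
Proof.
intros Hf Hg.
pose proof (Cder_cont _ _ _ Hg) as Cg.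
destruct Hf as [p [P1 [P2 P3]]], Hg as [q [Q1 [Q2 Q3]]].
exists (fun y => p y * g y + f z * q y)%C; split; [| split].
- apply Clim_plus; apply Clim_mult; try assumption; apply Clim_const.
- rewrite P2, Q2; reflexivity.
- intros y; rewrite (P3 y), (Q3 y); ring.
Qed.

Lemma Cder_comp (f g : C -> C) (z l m : C) :
  Cder f (g z) l -> Cder g z m -> Cder (fun y => f (g y)) z (l * m)%C.
Proof.
intros [p [P1 [P2 P3]]] Hg.
pose proof (Cder_cont _ _ _ Hg) as Cg.
destruct Hg as [q [Q1 [Q2 Q3]]].
exists (fun y => p (g y) * q y)%C; split; [| split].
- apply Clim_mult; [| exact Q1].
  apply (Clim_comp g p (g z)); assumption.
- rewrite P2, Q2; reflexivity.
- intros y; rewrite (P3 (g y)).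
  replace (g y - g z)%C with (q y * (y - z))%C by (rewrite (Q3 y); ring); ring.
Qed.

(** The slope identity in [Cder] is required for every [y], so a slope of [f] does not serve for [g]
    far from [z]. The difference quotient of [g], completed by [l] at [z], does. *)
Lemma Cder_ext_loc (f g : C -> C) (z l : C) :
  nbhs z (fun y => f y = g y) -> Cder f z l -> Cder g z l.
Proof.
intros E [p [P1 [P2 P3]]].
assert (Ez : f z = g z).
{ apply nbhs_iff in E; destruct E as [d [Hd H]]; apply H.
  replace (z - z)%C with (RtoC 0) by ring; rewrite Cmod_0; exact Hd. }
exists (fun y => if Ceq_dec y z then l else (g y - g z) / (y - z))%C; split; [| split].
- apply (Clim_ext_loc p); [| exact P1].
  revert E; apply filter_imp; intros y Hy.
  destruct (Ceq_dec y z) as [-> | N]; [exact P2 |].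
  rewrite <- Hy, <- Ez, (P3 y); field; apply Cminus_eq_contra, N.
- destruct (Ceq_dec z z); congruence.
- intros y; destruct (Ceq_dec y z) as [-> | N]; [ring |].
  field; apply Cminus_eq_contra, N.
Qed.

Lemma Cder_inv (f : C -> C) (z l : C) :
  f z <> 0 -> Cder f z l -> Cder (fun y => / f y)%C z (- l / (f z * f z))%C.
Proof.
intros N Hf.
assert (H : Cder (fun y => / y)%C (f z) (- / (f z * f z))%C).
{ assert (H0 : nbhs (f z) (fun y => y <> 0)).
  { apply nbhs_iff; exists (Cmod (f z)); split; [apply Cmod_gt_0, N |].
    intros y Hy ->; revert Hy; rewrite Cmod_sub_comm.
    replace (f z - 0)%C with (f z) by ring; lra. }
  (* The slope of the inverse is [- / (f z * y)], which breaks down at [y = 0]. There the inverse is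
     replaced by the value of its tangent, so that the slope identity holds for all [y]. *)
  apply (Cder_ext_loc (fun y => if Ceq_dec y 0 then / f z + (- / (f z * f z)) * (y - f z)
     else / y)%C).
  - revert H0; apply filter_imp; intros y Hy; destruct (Ceq_dec y 0); congruence.
  - exists (fun y => if Ceq_dec y 0 then - / (f z * f z) else - / (f z * y))%C.
    split; [| split].
    + apply (Clim_ext_loc (fun y => - (1) * / (f z * y))%C).
      * revert H0; apply filter_imp; intros y Hy.
        destruct (Ceq_dec y 0); [congruence | ring].
      * replace (- / (f z * f z))%C with (- (1) * / (f z * f z))%C by ring.
        apply Clim_mult; [apply Clim_const |].
        apply Clim_inv; [apply Cmult_neq_0; assumption |].
        apply Clim_mult; [apply Clim_const | apply Clim_id].
    + destruct (Ceq_dec (f z) 0); congruence.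
    + intros y; destruct (Ceq_dec (f z) 0) as [E | _]; [contradiction |].
      destruct (Ceq_dec y 0) as [-> | Ny]; [ring | field; auto]. }
replace (- l / (f z * f z))%C with (- / (f z * f z) * l)%C by (field; exact N).
apply (Cder_comp (fun y => / y)%C f); assumption.
Qed.

(** The entry point for the functions that are not built by the algebraic rules: the exponential and
    power series, both of which have explicit second-order remainders. *)
Lemma Cder_of_quadratic (f : C -> C) (z l : C) (K d : R) :
  0 < d ->
  (forall y, Cmod (y - z) < d ->
     Cmod (f y - f z - l * (y - z)) <= K * (Cmod (y - z) * Cmod (y - z))) ->
  Cder f z l.
Proof.
intros Hd H.
exists (fun y => if Ceq_dec y z then l else (f y - f z) / (y - z))%C; split; [| split].
- intros eps He; apply nbhs_iff.
  (* [K] may be zero or negative, and a positive number is needed to divide [eps]. *)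
  pose (K' := Rmax K 1).
  assert (HK : 0 < K') by (generalize (Rmax_r K 1); unfold K'; lra).
  exists (Rmin d (eps / K')); split.
  { apply Rmin_pos; [exact Hd | apply Rdiv_lt_0_compat; lra]. }
  intros y Hy; destruct (Ceq_dec y z) as [-> | N].
  { replace (l - l)%C with (RtoC 0) by ring; rewrite Cmod_0; exact He. }
  assert (Hyz : (y - z)%C <> 0) by (apply Cminus_eq_contra, N).
  assert (P : 0 < Cmod (y - z)) by (apply Cmod_gt_0, Hyz).
  replace ((f y - f z) / (y - z) - l)%C
    with ((f y - f z - l * (y - z)) / (y - z))%C by (field; exact Hyz).
  rewrite Cmod_div by exact Hyz.
  apply Rmult_lt_reg_r with (Cmod (y - z)); [exact P |].
  unfold Rdiv; rewrite Rmult_assoc, Rinv_l by lra; rewrite Rmult_1_r.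
  eapply Rle_lt_trans; [apply H; generalize (Rmin_l d (eps / K')); lra |].
  rewrite <- Rmult_assoc; apply Rmult_lt_compat_r; [exact P |].
  apply Rle_lt_trans with (K' * Cmod (y - z)).
  { apply Rmult_le_compat_r; [lra | apply Rmax_l]. }
  assert (Hy2 : Cmod (y - z) < eps / K') by (generalize (Rmin_r d (eps / K')); lra).
  apply Rmult_lt_compat_l with (r := K') in Hy2; [| exact HK].
  replace (K' * (eps / K')) with eps in Hy2 by (field; lra); exact Hy2.
- destruct (Ceq_dec z z); congruence.
- intros y; destruct (Ceq_dec y z) as [-> | N]; [ring |].
  field; apply Cminus_eq_contra, N.
Qed.

Lemma Cder_is_derive (f : C -> C) (z l : C) :
  Cder f z l <-> @is_derive C_AbsRing C_NormedModule f z l.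
Proof.
split.
- intros [p [P1 [P2 P3]]]; split.
  { apply (is_linear_scal_l (K := C_AbsRing) (V := C_NormedModule)). }
  intros x Hx eps.
  assert (E : z = x).
  { apply (is_filter_lim_locally_unique (K := C_AbsRing)
      (V := AbsRing_NormedModule C_AbsRing)); exact Hx. }
  subst x.
  generalize (P1 eps (cond_pos eps)); apply filter_imp; intros y Hy.
  change (Cmod (f y - f z - (y - z) * l) <= eps * Cmod (y - z))%R.
  rewrite (P3 y).
  replace (f z + p y * (y - z) - f z - (y - z) * l)%C with ((p y - l) * (y - z))%C by ring.
  rewrite Cmod_mult; apply Rmult_le_compat_r; [apply Cmod_ge_0 | lra].
- intros [_ H].
  specialize (H z (fun P HP => HP)).
  exists (fun y => if Ceq_dec y z then l else (f y - f z) / (y - z))%C; split; [| split].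
  + intros eps He.
    assert (He2 : 0 < eps / 2) by lra.
    generalize (H (mkposreal _ He2)); apply filter_imp; intros y Hy.
    change (Cmod (f y - f z - (y - z) * l) <= eps / 2 * Cmod (y - z))%R in Hy.
    destruct (Ceq_dec y z) as [-> | N].
    { replace (l - l)%C with (RtoC 0) by ring; rewrite Cmod_0; exact He. }
    assert (Hyz : (y - z)%C <> 0) by (apply Cminus_eq_contra, N).
    assert (P : 0 < Cmod (y - z)) by (apply Cmod_gt_0, Hyz).
    replace ((f y - f z) / (y - z) - l)%C
      with ((f y - f z - (y - z) * l) / (y - z))%C by (field; exact Hyz).
    rewrite Cmod_div by exact Hyz.
    apply Rle_lt_trans with (eps / 2); [| lra].
    apply Rmult_le_reg_r with (Cmod (y - z)); [exact P |].
    unfold Rdiv at 1; rewrite Rmult_assoc, Rinv_l by lra; lra.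
  + destruct (Ceq_dec z z); congruence.
  + intros y; destruct (Ceq_dec y z) as [-> | N]; [ring |].
    field; apply Cminus_eq_contra, N.
Qed.

Lemma Clim_Im {T : Type} {F : (T -> Prop) -> Prop} {FF : Filter F} (f : T -> C) (l : C) :
  Clim F f l -> filterlim (fun x => Im (f x)) F (locally (Im l)).
Proof.
intros H.
assert (H1 : Clim F (fun x => - Ci * f x)%C (- Ci * l)%C)
  by (apply Clim_mult; [apply Clim_const | exact H]).
apply Clim_Re in H1.
replace (Im l) with (Re (- Ci * l)) by (unfold Re, Im; simpl; ring).
revert H1; apply filterlim_ext; intros x; unfold Re, Im; simpl; ring.
Qed.

(** * Complex functions along real curves and the mean value inequality *)

Lemma is_derive_caratheodory (g p : R -> R) (t l : R) :
  filterlim p (locally t) (locally l) -> (forall s, g s = g t + p s * (s - t)) ->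
  is_derive g t l.
Proof.
intros Hp Hg; split; [apply @is_linear_scal_l |].
intros x Hx eps.
assert (E : t = x) by (apply (is_filter_lim_locally_unique (V := R_NormedModule)); exact Hx).
subst x.
generalize (proj1 (filterlim_locally _ _) Hp eps); apply filter_imp; intros s Hs.
change (Rabs (p s - l) < eps) in Hs.
change (Rabs (g s - g t - (s - t) * l) <= eps * Rabs (s - t)).
rewrite (Hg s); replace (g t + p s * (s - t) - g t - (s - t) * l) with ((p s - l) * (s - t)) by ring.
rewrite Rabs_mult; apply Rmult_le_compat_r; [apply Rabs_pos | lra].
Qed.

Lemma caratheodory_is_derive (g : R -> R) (t l : R) :
  is_derive g t l ->
  filterlim (fun s => if Req_EM_T s t then l else (g s - g t) / (s - t))
    (locally t) (locally l).
Proof.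
intros [_ H]; specialize (H t (fun P HP => HP)).
apply filterlim_locally; intros eps.
assert (He : 0 < eps / 2) by (generalize (cond_pos eps); lra).
generalize (H (mkposreal _ He)); apply filter_imp; intros s Hs.
change (Rabs (g s - g t - (s - t) * l) <= eps / 2 * Rabs (s - t)) in Hs.
change (Rabs ((if Req_EM_T s t then l else (g s - g t) / (s - t)) - l) < eps).
destruct (Req_EM_T s t) as [-> | N].
- replace (l - l) with 0 by ring; rewrite Rabs_R0; apply cond_pos.
- assert (P : 0 < Rabs (s - t)) by (apply Rabs_pos_lt; lra).
  replace ((g s - g t) / (s - t) - l) with ((g s - g t - (s - t) * l) / (s - t)) by (field; lra).
  unfold Rdiv; rewrite Rabs_mult, Rabs_inv.
  apply Rle_lt_trans with (eps / 2); [| lra].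
  apply Rmult_le_reg_r with (Rabs (s - t)); [exact P |].
  rewrite Rmult_assoc, Rinv_l by lra; lra.
Qed.

Definition curve_der (g : R -> C) (t : R) (v : C) : Prop :=
  is_derive (fun s => Re (g s)) t (Re v) /\ is_derive (fun s => Im (g s)) t (Im v).

(** The slope of the composite is the slope of [f] at [g s] times the difference quotient of [g];
    its real and imaginary parts are slopes for the two real functions. *)
Lemma Cder_curve (f : C -> C) (g : R -> C) (t : R) (l v : C) :
  Cder f (g t) l -> curve_der g t v -> curve_der (fun s => f (g s)) t (l * v)%C.
Proof.
intros [p [P1 [P2 P3]]] [H1 H2].
pose (q := fun s => if Req_EM_T s t then v else ((g s - g t) / RtoC (s - t))%C).
assert (Hq : Clim (locally t) q v).
{ apply Clim_Re_Im.
  - generalize (caratheodory_is_derive _ _ _ H1); apply filterlim_ext; intros s.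
    unfold q; destruct (Req_EM_T s t); [reflexivity |].
    unfold Re, Im, Cdiv, Cinv; simpl; field; nra.
  - generalize (caratheodory_is_derive _ _ _ H2); apply filterlim_ext; intros s.
    unfold q; destruct (Req_EM_T s t); [reflexivity |].
    unfold Re, Im, Cdiv, Cinv; simpl; field; nra. }
assert (Eq : forall s, g s = (g t + q s * RtoC (s - t))%C).
{ intros s; unfold q; destruct (Req_EM_T s t) as [-> | N].
  - replace (t - t) with 0 by ring; ring.
  - field; intros E; apply RtoC_inj in E; lra. }
assert (Hg : Clim (locally t) g (g t)).
{ assert (E : g t = (g t + v * RtoC 0)%C) by ring.
  rewrite E; clear E.
  apply (Clim_ext_loc (fun s => g t + q s * RtoC (s - t))%C).
  { apply filter_forall; intros s; symmetry; apply Eq. }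
  apply Clim_plus; [apply Clim_const |].
  apply Clim_mult; [exact Hq |].
  intros eps He; exists (mkposreal eps He); intros s Hs.
  replace (RtoC (s - t) - RtoC 0)%C with (RtoC (s - t)) by ring.
  rewrite Cmod_R; exact Hs. }
assert (Hpq : Clim (locally t) (fun s => p (g s) * q s)%C (l * v)%C).
{ apply Clim_mult; [| exact Hq]; apply (Clim_comp g p (g t)); assumption. }
assert (E : forall s, f (g s) = (f (g t) + p (g s) * q s * RtoC (s - t))%C).
{ intros s.
  assert (D : (g s - g t)%C = (q s * RtoC (s - t))%C) by (rewrite (Eq s) at 1; ring).
  rewrite (P3 (g s)), D; ring. }
split.
- apply (is_derive_caratheodory _ (fun s => Re (p (g s) * q s))).
  + apply Clim_Re; exact Hpq.
  + intros s; rewrite (E s), re_plus, re_scal_r; reflexivity.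
- apply (is_derive_caratheodory _ (fun s => Im (p (g s) * q s))).
  + apply Clim_Im; exact Hpq.
  + intros s; rewrite (E s), im_plus, im_scal_r; reflexivity.
Qed.

Definition segment (a b : C) (t : R) : C := (a + RtoC t * (b - a))%C.

Lemma segment_0 (a b : C) : segment a b 0 = a.
Proof. unfold segment; ring. Qed.

Lemma segment_1 (a b : C) : segment a b 1 = b.
Proof. unfold segment; ring. Qed.

Lemma segment_der (a b : C) (t : R) : curve_der (segment a b) t (b - a)%C.
Proof.
split; unfold segment, Re, Im; simpl; auto_derive; auto; ring.
Qed.

Lemma segment_Cmod (a b : C) (r t : R) :
  0 <= t <= 1 -> Cmod a <= r -> Cmod b <= r -> Cmod (segment a b t) <= r.
Proof.
intros Ht Ha Hb; unfold segment.
replace (a + RtoC t * (b - a))%C with (RtoC (1 - t) * a + RtoC t * b)%C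
  by (rewrite RtoC_minus; ring).
eapply Rle_trans; [apply Cmod_triangle |].
rewrite !Cmod_mult, !Cmod_R, !Rabs_right by lra; nra.
Qed.

Lemma segment_Omega (a b : C) (t : R) :
  Omega a -> Omega b -> 0 <= t <= 1 -> Omega (segment a b t).
Proof.
unfold Omega; intros Ha Hb Ht.
apply Rle_lt_trans with (Rmax (Cmod a) (Cmod b)).
- apply segment_Cmod; [exact Ht | apply Rmax_l | apply Rmax_r].
- apply Rmax_lub_lt; assumption.
Qed.

Lemma is_derive_continuity (g : R -> R) (t l : R) : is_derive g t l -> continuity_pt g t.
Proof.
intros H; apply continuity_pt_filterlim; apply (ex_derive_continuous g).
exists l; exact H.
Qed.

(** Multiplying by the conjugate of the increment and taking real parts reduces this to the real
    mean value theorem. Nothing is lost, since the increment of the projected function is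
    [|f b - f a|^2]. *)
Lemma mean_value_bound (f df : C -> C) (a b : C) (M : R) :
  (forall t, 0 <= t <= 1 ->
     Cder f (segment a b t) (df (segment a b t)) /\ Cmod (df (segment a b t)) <= M) ->
  Cmod (f b - f a) <= M * Cmod (b - a).
Proof.
intros H.
pose (c := Cconj (f b - f a)).
pose (g := fun t => Re (c * f (segment a b t))).
assert (Hg : forall t, 0 <= t <= 1 -> is_derive g t (Re (c * (df (segment a b t) * (b - a))))).
{ intros t Ht; destruct (H t Ht) as [H1 _].
  destruct (Cder_curve _ _ _ _ _ H1 (segment_der a b t)) as [D1 D2].
  apply (is_derive_ext (fun t => Re c * Re (f (segment a b t)) - Im c * Im (f (segment a b t)))).
  { intros s; unfold g, Re, Im; simpl; ring. }
  rewrite re_mult.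
  apply (is_derive_minus (K := R_AbsRing) (V := R_NormedModule));
    apply is_derive_scal; assumption. }
destruct (MVT_gen g 0 1 (fun t => Re (c * (df (segment a b t) * (b - a))))) as [t [Ht E]].
- intros t; rewrite Rmin_left, Rmax_right by lra; intros Ht; apply Hg; lra.
- intros t; rewrite Rmin_left, Rmax_right by lra; intros Ht.
  eapply is_derive_continuity; apply Hg; lra.
- rewrite Rmin_left, Rmax_right in Ht by lra.
  destruct (H t Ht) as [_ HM].
  assert (E1 : g 1 - g 0 = Cmod (f b - f a) * Cmod (f b - f a)).
  { unfold g; rewrite segment_0, segment_1.
    transitivity (Cmod (f b - f a) ^ 2); [| ring].
    rewrite Cmod2_alt; unfold c, Re, Im; simpl; ring. }
  rewrite E1 in E.
  assert (E2 : Re (c * (df (segment a b t) * (b - a)))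
     <= Cmod (f b - f a) * (M * Cmod (b - a))).
  { eapply Rle_trans; [apply Rle_abs |]; eapply Rle_trans; [apply re_le_Cmod |].
    rewrite !Cmod_mult; unfold c; rewrite Cmod_conj.
    apply Rmult_le_compat_l; [apply Cmod_ge_0 |].
    apply Rmult_le_compat_r; [apply Cmod_ge_0 | exact HM]. }
  assert (HM0 : 0 <= M) by (generalize (Cmod_ge_0 (df (segment a b t))); lra).
  generalize (Cmod_ge_0 (f b - f a)) (Cmod_ge_0 (b - a)); intros P1 P2.
  assert (0 <= M * Cmod (b - a)) by (apply Rmult_le_pos; assumption).
  nra.
Qed.

Lemma Omega_0 : Omega 0.
Proof. unfold Omega; rewrite Cmod_0; lra. Qed.

Lemma constant_on_Omega (f : C -> C) :
  (forall z, Omega z -> Cder f z 0) -> forall z, Omega z -> f z = f 0.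
Proof.
intros H z Hz.
apply Ceq_minus, Cmod_eq_0, Rle_antisym; [| apply Cmod_ge_0].
apply Rle_trans with (0 * Cmod (z - 0)); [| lra].
apply (mean_value_bound f (fun _ => RtoC 0)).
intros t Ht; split; [| rewrite Cmod_0; lra].
apply H, segment_Omega; [apply Omega_0 | exact Hz | exact Ht].
Qed.

Lemma Omega_open (z : C) : Omega z -> nbhs z Omega.
Proof.
unfold Omega; intros H; apply nbhs_iff; exists (1 - Cmod z); split; [lra |].
intros y Hy; generalize (Cmod_triangle (y - z) z); replace (y - z + z)%C with y by ring; lra.
Qed.

Lemma Omega_Cmod_lt (z : C) : Omega z ->
  exists r, Cmod z < r < 1 /\ 0 < r.
Proof. unfold Omega; intros H; exists ((Cmod z + 1) / 2); generalize (Cmod_ge_0 z); lra. Qed.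

(** * Complex power series *)

Definition summable (u : nat -> C) : Prop := ex_series (fun n => Cmod (u n)).

Definition CSeries (u : nat -> C) : C :=
  (Series (fun n => Re (u n)), Series (fun n => Im (u n))).

Lemma im_le_Cmod (c : C) : Rabs (Im c) <= Cmod c.
Proof. eapply Rle_trans; [apply Rmax_r | apply Rmax_Cmod]. Qed.

Lemma summable_abs_Re (u : nat -> C) : summable u -> ex_series (fun n => Rabs (Re (u n))).
Proof.
intros H; apply (@ex_series_le R_AbsRing R_CompleteNormedModule _ (fun n => Cmod (u n))); [| exact H].
intros n; change (Rabs (Rabs (Re (u n))) <= Cmod (u n)); rewrite Rabs_Rabsolu; apply re_le_Cmod.
Qed.

Lemma summable_abs_Im (u : nat -> C) : summable u -> ex_series (fun n => Rabs (Im (u n))).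
Proof.
intros H; apply (@ex_series_le R_AbsRing R_CompleteNormedModule _ (fun n => Cmod (u n))); [| exact H].
intros n; change (Rabs (Rabs (Im (u n))) <= Cmod (u n)); rewrite Rabs_Rabsolu; apply im_le_Cmod.
Qed.

Lemma summable_Re (u : nat -> C) : summable u -> ex_series (fun n => Re (u n)).
Proof. intros H; apply ex_series_Rabs, summable_abs_Re, H. Qed.

Lemma summable_Im (u : nat -> C) : summable u -> ex_series (fun n => Im (u n)).
Proof. intros H; apply ex_series_Rabs, summable_abs_Im, H. Qed.

Lemma summable_le (u : nat -> C) (v : nat -> R) :
  (forall n, Cmod (u n) <= v n) -> ex_series v -> summable u.
Proof.
intros H Hv; apply (@ex_series_le R_AbsRing R_CompleteNormedModule _ v); [| exact Hv].
intros n; change (Rabs (Cmod (u n)) <= v n).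
rewrite Rabs_right by (apply Rle_ge, Cmod_ge_0); apply H.
Qed.

Lemma CSeries_ext (u v : nat -> C) : (forall n, u n = v n) -> CSeries u = CSeries v.
Proof. intros H; unfold CSeries; f_equal; apply Series_ext; intros n; rewrite H; reflexivity. Qed.

Lemma CSeries_plus (u v : nat -> C) : summable u -> summable v ->
  CSeries (fun n => u n + v n)%C = (CSeries u + CSeries v)%C.
Proof.
intros Hu Hv; unfold CSeries, Cplus; simpl; f_equal; rewrite <- Series_plus;
  auto using summable_Re, summable_Im.
Qed.

Lemma ex_series_Rscal (c : R) (a : nat -> R) : ex_series a -> ex_series (fun n => c * a n).
Proof. apply (@ex_series_scal R_AbsRing R_NormedModule). Qed.

Lemma CSeries_scal (c : C) (u : nat -> C) : summable u ->
  CSeries (fun n => c * u n)%C = (c * CSeries u)%C.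
Proof.
intros Hu.
pose proof (summable_Re _ Hu) as H1; pose proof (summable_Im _ Hu) as H2.
apply C_ext; [rewrite re_mult | rewrite im_mult]; unfold CSeries at 1; unfold Re at 1, Im at 1;
  cbv [fst snd].
- unfold CSeries, Re at 3, Im at 3; cbv [fst snd].
  rewrite <- !Series_scal_l, <- Series_minus.
  + apply Series_ext; intros n; apply re_mult.
  + apply ex_series_Rscal, H1.
  + apply ex_series_Rscal, H2.
- unfold CSeries, Re at 3, Im at 2; cbv [fst snd].
  rewrite <- !Series_scal_l, <- Series_plus.
  + apply Series_ext; intros n; apply im_mult.
  + apply ex_series_Rscal, H2.
  + apply ex_series_Rscal, H1.
Qed.

Lemma summable_scal (c : C) (u : nat -> C) : summable u -> summable (fun n => c * u n)%C.
Proof.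
intros H; apply (summable_le _ (fun n => Cmod c * Cmod (u n))).
- intros n; rewrite Cmod_mult; lra.
- apply ex_series_Rscal, H.
Qed.

Lemma summable_plus (u v : nat -> C) : summable u -> summable v ->
  summable (fun n => u n + v n)%C.
Proof.
intros Hu Hv; apply (summable_le _ (fun n => Cmod (u n) + Cmod (v n))).
- intros n; apply Cmod_triangle.
- apply (@ex_series_plus R_AbsRing R_NormedModule); assumption.
Qed.

Lemma summable_S (u : nat -> C) : summable u -> summable (fun n => u (S n)).
Proof. intros H; apply (ex_series_incr_1 (fun n => Cmod (u n))), H. Qed.

Lemma CSeries_S (u : nat -> C) : summable u ->
  CSeries u = (u 0%nat + CSeries (fun n => u (S n)))%C.
Proof.
intros H; apply C_ext; rewrite ?re_plus, ?im_plus; unfold CSeries, Re, Im; cbv [fst snd];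
  apply (Series_incr_1 (fun n => _)); [apply summable_Re | apply summable_Im]; exact H.
Qed.

Lemma Series_pos (a : nat -> R) : (forall n, 0 <= a n) -> ex_series a -> 0 <= Series a.
Proof.
intros P H; replace 0 with (Series (fun n => 0 * a n)) by (rewrite Series_scal_l; ring).
apply Series_le; [intros n; rewrite Rmult_0_l; split; [lra | apply P] | exact H].
Qed.

(** As in [mean_value_bound], multiplying by the conjugate of the sum turns the modulus into a real
    series. *)
Lemma CSeries_bound (u : nat -> C) : summable u -> Cmod (CSeries u) <= Series (fun n => Cmod (u n)).
Proof.
intros H.
assert (P : 0 <= Series (fun n => Cmod (u n))).
{ apply Series_pos; [intros n; apply Cmod_ge_0 | exact H]. }
pose (c := Cconj (CSeries u)).
assert (E : Cmod (CSeries u) * Cmod (CSeries u) = Series (fun n => Re (c * u n))).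
{ transitivity (Re (c * CSeries u)).
  - transitivity (Cmod (CSeries u) ^ 2); [ring |].
    rewrite Cmod2_alt; unfold c, Re, Im; simpl; ring.
  - rewrite <- CSeries_scal by exact H; reflexivity. }
assert (E2 : Series (fun n => Re (c * u n)) <= Cmod (CSeries u) * Series (fun n => Cmod (u n))).
{ rewrite <- Series_scal_l.
  eapply Rle_trans; [apply Rle_abs |].
  eapply Rle_trans; [apply Series_Rabs, summable_abs_Re, summable_scal, H |].
  apply Series_le; [| apply ex_series_Rscal, H].
  intros n; split; [apply Rabs_pos |].
  eapply Rle_trans; [apply re_le_Cmod |].
  rewrite Cmod_mult; unfold c; rewrite Cmod_conj; lra. }
generalize (Cmod_ge_0 (CSeries u)); intros; nra.
Qed.

Lemma re_sum_n (n : nat) (u : nat -> C) :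
  Re (@sum_n C_AbelianMonoid u n) = sum_n (fun n => Re (u n)) n.
Proof.
induction n as [| n IH].
- rewrite !sum_O; reflexivity.
- rewrite !sum_Sn, <- IH; apply re_plus.
Qed.

Lemma im_sum_n (n : nat) (u : nat -> C) :
  Im (@sum_n C_AbelianMonoid u n) = sum_n (fun n => Im (u n)) n.
Proof.
induction n as [| n IH].
- rewrite !sum_O; reflexivity.
- rewrite !sum_Sn, <- IH; apply im_plus.
Qed.

(** The uniform structure of [C_NormedModule] is that of a product, with squares as balls, so the
    two components of a ball give the two real limits. *)
Lemma is_Cseries_iff (u : nat -> C) (s : C) :
  @is_series C_AbsRing C_NormedModule u s <->
  is_series (fun n => Re (u n)) (Re s) /\ is_series (fun n => Im (u n)) (Im s).
Proof.
pose proof (fun n => re_sum_n n u) as E1; pose proof (fun n => im_sum_n n u) as E2.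
unfold is_series; split.
- intros H; split.
  + apply (filterlim_ext (fun n => Re (@sum_n C_AbelianMonoid u n))); [exact E1 |].
    apply filterlim_locally; intros eps.
    generalize (proj1 (filterlim_locally _ _) H eps); apply filter_imp; intros n [Hn _]; exact Hn.
  + apply (filterlim_ext (fun n => Im (@sum_n C_AbelianMonoid u n))); [exact E2 |].
    apply filterlim_locally; intros eps.
    generalize (proj1 (filterlim_locally _ _) H eps); apply filter_imp; intros n [_ Hn]; exact Hn.
- intros [H1 H2]; apply filterlim_locally; intros eps.
  generalize (filter_and _ _ (proj1 (filterlim_locally _ _) H1 eps)
    (proj1 (filterlim_locally _ _) H2 eps)).
  apply filter_imp; intros n [A B]; rewrite <- E1 in A; rewrite <- E2 in B; split; assumption.
Qed.

Lemma sum_n_Rminus (a b : nat -> R) (n : nat) :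
  sum_n (fun k => a k - b k) n = sum_n a n - sum_n b n.
Proof.
induction n as [| n IH]; [rewrite !sum_O; reflexivity |].
rewrite !sum_Sn, IH; unfold plus; simpl; ring.
Qed.

Lemma CSeries_mult (u v : nat -> C) : summable u -> summable v ->
  (CSeries u * CSeries v)%C =
  CSeries (fun n => @sum_n C_AbelianMonoid (fun k => u k * v (n - k)%nat)%C n).
Proof.
intros Hu Hv.
assert (M : forall (a b : nat -> R), ex_series (fun n => Rabs (a n)) ->
   ex_series (fun n => Rabs (b n)) ->
   is_series (fun n => sum_n (fun k => a k * b (n - k)%nat) n) (Series a * Series b)).
{ intros a b Ha Hb.
  apply (is_series_ext (fun n => sum_f_R0 (fun k => a k * b (n - k)%nat) n)).
  - intros n; symmetry; apply sum_n_Reals.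
  - apply is_series_mult; auto; apply Series_correct, ex_series_Rabs; assumption. }
pose proof (summable_abs_Re _ Hu) as U1; pose proof (summable_abs_Im _ Hu) as U2.
pose proof (summable_abs_Re _ Hv) as V1; pose proof (summable_abs_Im _ Hv) as V2.
apply C_ext.
- rewrite re_mult; symmetry; apply is_series_unique.
  generalize (is_series_minus _ _ _ _ (M _ _ U1 V1) (M _ _ U2 V2)).
  apply is_series_ext; intros n; rewrite re_sum_n.
  symmetry; etransitivity; [| apply sum_n_Rminus].
  apply sum_n_ext; intros k; apply re_mult.
- rewrite im_mult; symmetry; apply is_series_unique.
  generalize (is_series_plus _ _ _ _ (M _ _ U1 V2) (M _ _ U2 V1)).
  apply is_series_ext; intros n; rewrite im_sum_n.
  symmetry; etransitivity; [| apply sum_n_plus].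
  apply sum_n_ext; intros k; apply im_mult.
Qed.

(** Says that the radius of convergence is at least 1, as absolute convergence of real series, which
    is stable under comparison. *)
Definition disk_summable (a : nat -> C) : Prop :=
  forall r, 0 <= r < 1 -> ex_series (fun n => Cmod (a n) * r ^ n).

Definition CPSeries (a : nat -> C) (z : C) : C := CSeries (fun n => a n * z ^ n)%C.

Definition CPS_derive (a : nat -> C) (n : nat) : C := (RtoC (INR (S n)) * a (S n))%C.

Lemma disk_summable_at (a : nat -> C) (z : C) (r : R) :
  disk_summable a -> Cmod z <= r < 1 -> summable (fun n => a n * z ^ n)%C.
Proof.
intros H Hz; pose proof (Cmod_ge_0 z) as P.
apply (summable_le _ (fun n => Cmod (a n) * r ^ n)).
- intros n; rewrite Cmod_mult, Cmod_pow; apply Rmult_le_compat_l; [apply Cmod_ge_0 |].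
  apply pow_incr; lra.
- apply H; lra.
Qed.

Lemma disk_summable_Omega (a : nat -> C) (z : C) :
  disk_summable a -> Omega z -> summable (fun n => a n * z ^ n)%C.
Proof. intros H Hz; apply (disk_summable_at a z (Cmod z)); [exact H | unfold Omega in Hz; lra]. Qed.

Lemma bounded_disk_summable (a : nat -> C) (M : R) :
  (forall n, Cmod (a n) <= M) -> disk_summable a.
Proof.
intros H r Hr.
apply (@ex_series_le R_AbsRing R_CompleteNormedModule _ (fun n => M * r ^ n)).
- intros n; change (Rabs (Cmod (a n) * r ^ n) <= M * r ^ n).
  assert (0 <= r ^ n) by (apply pow_le; lra).
  rewrite Rabs_right by (apply Rle_ge, Rmult_le_pos; [apply Cmod_ge_0 | assumption]).
  apply Rmult_le_compat_r; [assumption | apply H].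
- apply ex_series_Rscal, ex_series_geom; rewrite Rabs_right; lra.
Qed.

Lemma disk_summable_radius (a : nat -> C) (r : R) : disk_summable a -> 0 <= r < 1 ->
  Rbar_lt r (CV_radius (fun n => Cmod (a n))).
Proof.
(* A point strictly between [r] and 1 makes the inequality strict. *)
intros H Hr; apply Rbar_lt_le_trans with ((1 + r) / 2); [simpl; lra |].
apply (proj1 (Lub_Rbar_correct (CV_disk (fun n => Cmod (a n))))).
apply (ex_series_ext (fun n => Cmod (a n) * ((1 + r) / 2) ^ n)).
- intros n; rewrite Rabs_right; [reflexivity |].
  apply Rle_ge, Rmult_le_pos; [apply Cmod_ge_0 | apply pow_le; lra].
- apply H; lra.
Qed.

(** Only moduli occur, so the invariance of the radius of convergence under differentiation of real
    power series applies to the sequence [Cmod (a n)]. *)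
Lemma disk_summable_derive (a : nat -> C) : disk_summable a -> disk_summable (CPS_derive a).
Proof.
intros H r Hr.
assert (E : Rbar_lt (Rabs r) (CV_radius (PS_derive (fun n => Cmod (a n))))).
{ rewrite CV_radius_derive, Rabs_right by lra; apply disk_summable_radius; assumption. }
generalize (CV_disk_inside _ _ E); apply ex_series_ext; intros n.
unfold PS_derive, CPS_derive.
pose proof (pos_INR (S n)) as P.
rewrite Cmod_mult, Cmod_R, (Rabs_right (INR (S n))) by lra.
apply Rabs_right, Rle_ge, Rmult_le_pos; [| apply pow_le; lra].
apply Rmult_le_pos; [exact P | apply Cmod_ge_0].
Qed.

Lemma pow_n_Cpow (z : C) (n : nat) : @pow_n C_AbsRing z n = (z ^ n)%C.
Proof. induction n as [| n IH]; [reflexivity | simpl; rewrite IH; reflexivity]. Qed.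

Lemma is_power_series_iff (a : nat -> C) (z s : C) :
  power_series_at a z s <->
  is_series (fun n => Re (a n * z ^ n)) (Re s) /\ is_series (fun n => Im (a n * z ^ n)) (Im s).
Proof.
rewrite <- is_Cseries_iff; unfold power_series_at, is_pseries.
assert (E : forall n, @scal C_AbsRing C_NormedModule (@pow_n C_AbsRing z n) (a n) = (a n * z ^ n)%C).
{ intros n; rewrite pow_n_Cpow; apply Cmult_comm. }
split; apply is_series_ext; intros n; [| symmetry]; apply E.
Qed.

Lemma power_series_CPSeries (a : nat -> C) (z s : C) : power_series_at a z s -> s = CPSeries a z.
Proof.
intros H; apply is_power_series_iff in H; destruct H as [H1 H2].
apply C_ext; symmetry; apply is_series_unique; assumption.
Qed.

Lemma CPSeries_power_series (a : nat -> C) (z : C) : disk_summable a -> Omega z ->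
  power_series_at a z (CPSeries a z).
Proof.
intros H Hz; apply is_power_series_iff.
pose proof (disk_summable_Omega a z H Hz) as S.
split; apply Series_correct; [apply (summable_Re _ S) | apply (summable_Im _ S)].
Qed.

(** Abel's lemma: convergence at a point [s] with [r < s < 1] bounds the terms there, and the series
    at [r] is dominated by a geometric one of ratio [r / s]. *)
Lemma convergent_disk_summable (a : nat -> C) (f : C -> C) :
  (forall z, Omega z -> power_series_at a z (f z)) -> disk_summable a.
Proof.
intros H r Hr.
pose (s := (1 + r) / 2).
assert (Hs : Omega (RtoC s)) by (unfold Omega; rewrite Cmod_R, Rabs_right; unfold s; lra).
destruct (proj1 (is_power_series_iff _ _ _) (H _ Hs)) as [H1 H2].
assert (B : exists M, forall n, Cmod (a n * RtoC s ^ n) <= M).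
{ assert (B1 : forall u : nat -> R, ex_series u -> exists M, forall n, Rabs (u n) <= M).
  { intros u Hu; apply ex_series_lim_0 in Hu.
    destruct (@filterlim_bounded R_AbsRing R_NormedModule u) as [M HM]; [exists 0; exact Hu |].
    exists M; exact HM. }
  destruct (B1 _ (ex_intro _ _ H1)) as [M1 HM1], (B1 _ (ex_intro _ _ H2)) as [M2 HM2].
  exists (M1 + M2); intros n.
  specialize (HM1 n); specialize (HM2 n).
  set (w := (a n * RtoC s ^ n)%C) in *.
  replace w with (RtoC (Re w) + Ci * RtoC (Im w))%C.
  - eapply Rle_trans; [apply Cmod_triangle |].
    rewrite Cmod_mult, Cmod_Ci, !Cmod_R; lra.
  - apply C_ext; unfold Re, Im; simpl; ring. }
destruct B as [M HM].
apply (@ex_series_le R_AbsRing R_CompleteNormedModule _ (fun n => M * (r / s) ^ n)).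
- intros n; change (Rabs (Cmod (a n) * r ^ n) <= M * (r / s) ^ n).
  assert (P : 0 <= r ^ n) by (apply pow_le; lra).
  rewrite Rabs_right by (apply Rle_ge, Rmult_le_pos; [apply Cmod_ge_0 | assumption]).
  specialize (HM n); rewrite Cmod_mult, Cmod_pow, Cmod_R, Rabs_right in HM by (unfold s; lra).
  assert (Ps : 0 < s ^ n) by (apply pow_lt; unfold s; lra).
  unfold Rdiv; rewrite Rpow_mult_distr, pow_inv.
  apply Rmult_le_reg_r with (s ^ n); [exact Ps |].
  replace (M * (r ^ n * / s ^ n) * s ^ n) with (M * r ^ n) by (field; lra).
  replace (Cmod (a n) * r ^ n * s ^ n) with (Cmod (a n) * s ^ n * r ^ n) by ring.
  apply Rmult_le_compat_r; assumption.
- apply ex_series_Rscal, ex_series_geom.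
  assert (0 < s) by (unfold s; lra).
  rewrite Rabs_right.
  + apply Rmult_lt_reg_r with s; [assumption |].
    unfold Rdiv; rewrite Rmult_assoc, Rinv_l by lra; unfold s; lra.
  + apply Rle_ge, Rmult_le_pos; [lra | left; apply Rinv_0_lt_compat; assumption].
Qed.

Lemma CPSeries_0 (a : nat -> C) : disk_summable a -> CPSeries a 0 = a 0%nat.
Proof.
intros H; unfold CPSeries.
rewrite CSeries_S by (apply (disk_summable_Omega a 0 H Omega_0)).
rewrite (CSeries_ext _ (fun n => 0 * (a (S n) * 0 ^ S n))%C) by (intros n; simpl; ring).
rewrite CSeries_scal; [simpl; ring |].
apply (summable_S (fun n => a n * 0 ^ n)%C), (disk_summable_Omega a 0 H Omega_0).
Qed.

Lemma CPSeries_ext (a b : nat -> C) (z : C) : (forall n, a n = b n) -> CPSeries a z = CPSeries b z.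
Proof. intros H; apply CSeries_ext; intros n; rewrite H; reflexivity. Qed.

Definition pow_remainder (y z : C) (n : nat) : C :=
  (y ^ S n - z ^ S n - RtoC (INR (S n)) * z ^ n * (y - z))%C.

Lemma pow_remainder_S (y z : C) (n : nat) :
  pow_remainder y z (S n) =
  (y * pow_remainder y z n + RtoC (INR (S n)) * z ^ n * ((y - z) * (y - z)))%C.
Proof. unfold pow_remainder; rewrite (S_INR (S n)), RtoC_plus; simpl; ring. Qed.

(** The factor [(n + 1) (n + 2)] is twice what is optimal, but it is exactly the one of the twice
    derived series. Hence the remainder of a power series is bounded by [|y - z|^2] times that
    series, taken with moduli at [r]. *)
Lemma pow_remainder_bound (y z : C) (r : R) (n : nat) :
  0 <= r -> Cmod y <= r -> Cmod z <= r ->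
  Cmod (pow_remainder y z (S n)) <=
    INR (S n) * INR (S (S n)) * r ^ n * (Cmod (y - z) * Cmod (y - z)).
Proof.
intros Hr Hy Hz.
assert (Hd : 0 <= Cmod (y - z) * Cmod (y - z)) by (apply Rmult_le_pos; apply Cmod_ge_0).
assert (B : forall k, Cmod (RtoC (INR (S k)) * z ^ k * ((y - z) * (y - z)))
   <= INR (S k) * r ^ k * (Cmod (y - z) * Cmod (y - z))).
{ intros k; rewrite !Cmod_mult, Cmod_pow, Cmod_R, Rabs_right by (apply Rle_ge, pos_INR).
  apply Rmult_le_compat_r; [exact Hd |].
  apply Rmult_le_compat_l; [apply pos_INR |].
  apply pow_incr; split; [apply Cmod_ge_0 | exact Hz]. }
induction n as [| n IH].
- rewrite pow_remainder_S.
  replace (pow_remainder y z 0) with (RtoC 0) by (unfold pow_remainder; simpl; ring).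
  replace (y * 0 + RtoC (INR 1) * z ^ 0 * ((y - z) * (y - z)))%C
    with (RtoC (INR 1) * z ^ 0 * ((y - z) * (y - z)))%C by ring.
  eapply Rle_trans; [apply B |]; simpl; nra.
- rewrite pow_remainder_S.
  eapply Rle_trans; [apply Cmod_triangle |].
  eapply Rle_trans; [apply Rplus_le_compat; [| apply B] |].
  { rewrite Cmod_mult; apply Rmult_le_compat; [apply Cmod_ge_0 | apply Cmod_ge_0 | exact Hy | exact IH]. }
  replace (r ^ S n) with (r * r ^ n) by reflexivity.
  assert (0 <= r * r ^ n) by (apply Rmult_le_pos; [exact Hr | apply pow_le, Hr]).
  assert (0 <= r * r ^ n * (Cmod (y - z) * Cmod (y - z))) by (apply Rmult_le_pos; assumption).
  rewrite !S_INR; pose proof (pos_INR n); nra.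
Qed.

Lemma Cder_CPSeries (a : nat -> C) (z : C) : disk_summable a -> Omega z ->
  Cder (CPSeries a) z (CPSeries (CPS_derive a) z).
Proof.
intros H Hz; destruct (Omega_Cmod_lt z Hz) as [r [Hr Pr]].
assert (H1 := disk_summable_derive a H).
assert (H2 := disk_summable_derive _ H1).
assert (S2 : ex_series (fun n => Cmod (CPS_derive (CPS_derive a) n) * r ^ n))
  by (apply H2; lra).
apply (Cder_of_quadratic _ _ _
  (Series (fun n => Cmod (CPS_derive (CPS_derive a) n) * r ^ n)) (r - Cmod z)); [lra |].
intros y Hy.
assert (Hyr : Cmod y <= r).
{ generalize (Cmod_triangle (y - z) z); replace (y - z + z)%C with y by ring; lra. }
assert (Sy : summable (fun n => a n * y ^ n)%C) by (apply (disk_summable_at a y r H); lra).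
assert (Sz : summable (fun n => a n * z ^ n)%C) by (apply (disk_summable_at a z r H); lra).
assert (Sd : summable (fun n => CPS_derive a n * z ^ n)%C)
  by (apply (disk_summable_at _ z r H1); lra).
assert (Sy1 := summable_S _ Sy); assert (Sz1 := summable_S _ Sz).
assert (E : (CPSeries a y - CPSeries a z - CPSeries (CPS_derive a) z * (y - z))%C
   = CSeries (fun n => a (S n) * pow_remainder y z n)%C).
{ unfold CPSeries; rewrite (CSeries_S _ Sy), (CSeries_S _ Sz).
  transitivity (CSeries (fun n => a (S n) * y ^ S n) + (- (1) * CSeries (fun n => a (S n) * z ^ S n)
    + - (y - z) * CSeries (fun n => CPS_derive a n * z ^ n)))%C; [simpl; ring |].
  rewrite <- !CSeries_scal, <- !CSeries_plus;
    try assumption; try (apply summable_scal; assumption);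
    try (apply summable_plus; apply summable_scal; assumption).
  apply CSeries_ext; intros n; unfold CPS_derive, pow_remainder; ring. }
assert (B : forall n, Cmod (a (S (S n)) * pow_remainder y z (S n)) <=
   Cmod (y - z) * Cmod (y - z) * (Cmod (CPS_derive (CPS_derive a) n) * r ^ n)).
{ intros n; rewrite Cmod_mult; unfold CPS_derive.
  rewrite !Cmod_mult, !Cmod_R, !Rabs_right by (apply Rle_ge, pos_INR).
  generalize (pow_remainder_bound y z r n ltac:(lra) Hyr ltac:(lra)); intros B.
  apply Rmult_le_compat_l with (r := Cmod (a (S (S n)))) in B; [| apply Cmod_ge_0].
  eapply Rle_trans; [exact B |]; right; ring. }
assert (S3 : ex_series (fun n => Cmod (y - z) * Cmod (y - z) *
   (Cmod (CPS_derive (CPS_derive a) n) * r ^ n))) by (apply ex_series_Rscal, S2).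
assert (Sr1 : summable (fun n => a (S (S n)) * pow_remainder y z (S n))%C)
  by (apply (summable_le _ _ B S3)).
assert (Sr : summable (fun n => a (S n) * pow_remainder y z n)%C).
{ apply (ex_series_incr_1 (fun n => Cmod (a (S n) * pow_remainder y z n))), Sr1. }
rewrite E, (CSeries_S _ Sr).
replace (pow_remainder y z 0) with (RtoC 0) by (unfold pow_remainder; simpl; ring).
rewrite Cmult_0_r, Cplus_0_l.
eapply Rle_trans; [apply CSeries_bound, Sr1 |].
rewrite Rmult_comm, <- Series_scal_l.
apply Series_le; [| exact S3].
intros n; split; [apply Cmod_ge_0 | apply B].
Qed.

Lemma CPSeries_mult (a b : nat -> C) (z : C) : disk_summable a -> disk_summable b -> Omega z ->
  (CPSeries a z * CPSeries b z)%C =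
  CPSeries (fun n => @sum_n C_AbelianMonoid (fun k => a k * b (n - k)%nat)%C n) z.
Proof.
intros Ha Hb Hz; unfold CPSeries.
rewrite CSeries_mult by (apply disk_summable_Omega; assumption).
apply CSeries_ext; intros n.
rewrite (sum_n_ext_loc _ (fun k => @mult C_AbsRing (a k * b (n - k)%nat)%C (z ^ n)%C)).
- apply (@sum_n_mult_r C_AbsRing).
- intros k Hk; change (a k * z ^ k * (b (n - k)%nat * z ^ (n - k)) = a k * b (n - k)%nat * z ^ n)%C.
  assert (E : (z ^ n = z ^ k * z ^ (n - k))%C) by (rewrite <- Cpow_add_r; f_equal; lia).
  rewrite E; ring.
Qed.

(** * The complex exponential *)

Lemma Cexp_plus (z w : C) : Cexp (z + w) = (Cexp z * Cexp w)%C.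
Proof.
apply C_ext; unfold Cexp, Re, Im; simpl; rewrite exp_plus, ?cos_plus, ?sin_plus; ring.
Qed.

Lemma Cexp_0 : Cexp 0 = 1.
Proof. apply C_ext; unfold Cexp, Re, Im; simpl; rewrite exp_0, ?cos_0, ?sin_0; ring. Qed.

Lemma Cexp_opp_r (z : C) : (Cexp z * Cexp (- z))%C = 1.
Proof. rewrite <- Cexp_plus; replace (z + - z)%C with (RtoC 0) by ring; apply Cexp_0. Qed.

Lemma Cexp_neq_0 (z : C) : Cexp z <> 0.
Proof.
intros E; apply C1_nz; rewrite <- (Cexp_opp_r z), E; ring.
Qed.

Lemma Cexp_opp (z : C) : Cexp (- z) = (/ Cexp z)%C.
Proof.
generalize (Cexp_opp_r z) (Cexp_neq_0 z); intros E N.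
replace (Cexp (- z)) with (/ Cexp z * (Cexp z * Cexp (- z)))%C by (field; exact N).
rewrite E; ring.
Qed.

Lemma Cmod_Cexp (z : C) : Cmod (Cexp z) = exp (Re z).
Proof.
assert (H : Cmod (Cexp z) ^ 2 = exp (Re z) ^ 2).
{ rewrite Cmod2_alt; unfold Cexp, Re, Im; simpl.
  generalize (sin2_cos2 (snd z)); unfold Rsqr; intros E; nra. }
generalize (Cmod_ge_0 (Cexp z)) (exp_pos (Re z)); intros; nra.
Qed.

Lemma exp_nondecreasing (x y : R) : x <= y -> exp x <= exp y.
Proof. intros [H | ->]; [left; apply exp_increasing, H | lra]. Qed.

Lemma exp_sub_1_bound (x : R) : Rabs x <= 1 -> Rabs (exp x - 1) <= 3 * Rabs x.
Proof.
intros Hx; rewrite <- exp_0.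
replace (Rabs x) with (Rabs (x - 0)) by (f_equal; ring).
apply (bounded_variation exp exp); intros t Ht.
replace (t - 0) with t in Ht by ring; replace (x - 0) with x in Ht by ring.
split; [apply is_derive_Reals, derivable_pt_lim_exp |].
rewrite Rabs_right by (left; apply exp_pos).
apply Rle_trans with (exp 1); [| apply exp_le_3].
apply exp_nondecreasing; generalize (Rle_abs t); lra.
Qed.

Lemma exp_taylor1_bound (x : R) : Rabs x <= 1 -> Rabs (exp x - 1 - x) <= 3 * (Rabs x * Rabs x).
Proof.
intros Hx.
replace (exp x - 1 - x) with ((exp x - 1 - x) - (exp 0 - 1 - 0)) by (rewrite exp_0; ring).
replace (3 * (Rabs x * Rabs x)) with ((3 * Rabs x) * Rabs (x - 0))
  by (replace (x - 0) with x by ring; ring).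
apply (bounded_variation (fun t => exp t - 1 - t) (fun t => exp t - 1)); intros t Ht.
replace (t - 0) with t in Ht by ring; replace (x - 0) with x in Ht by ring.
split; [auto_derive; auto; ring |].
eapply Rle_trans; [apply exp_sub_1_bound; lra | lra].
Qed.

Lemma sin_abs_bound (x : R) : Rabs (sin x) <= Rabs x.
Proof.
replace (sin x) with (sin x - sin 0) by (rewrite sin_0; ring).
replace (Rabs x) with (1 * Rabs (x - 0)) by (replace (x - 0) with x by ring; ring).
apply (bounded_variation sin cos); intros t _.
split; [apply is_derive_Reals, derivable_pt_lim_sin |].
apply Rabs_le, COS_bound.
Qed.

Lemma cos_sub_1_bound (x : R) : Rabs (cos x - 1) <= Rabs x * Rabs x.
Proof.
rewrite <- cos_0; replace (Rabs x * Rabs x) with (Rabs x * Rabs (x - 0))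
  by (replace (x - 0) with x by ring; ring).
apply (bounded_variation cos (fun t => - sin t)); intros t Ht.
replace (t - 0) with t in Ht by ring; replace (x - 0) with x in Ht by ring.
split; [apply is_derive_Reals, derivable_pt_lim_cos |].
rewrite Rabs_Ropp; eapply Rle_trans; [apply sin_abs_bound | exact Ht].
Qed.

Lemma sin_taylor1_bound (x : R) : Rabs x <= 1 -> Rabs (sin x - x) <= Rabs x * Rabs x.
Proof.
intros Hx.
replace (sin x - x) with ((sin x - x) - (sin 0 - 0)) by (rewrite sin_0; ring).
replace (Rabs x * Rabs x) with (Rabs x * Rabs (x - 0))
  by (replace (x - 0) with x by ring; ring).
apply (bounded_variation (fun t => sin t - t) (fun t => cos t - 1)); intros t Ht.
replace (t - 0) with t in Ht by ring; replace (x - 0) with x in Ht by ring.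
split; [auto_derive; auto; ring |].
eapply Rle_trans; [apply cos_sub_1_bound |]; generalize (Rabs_pos t); nra.
Qed.

Lemma Cmod_le_Re_Im (z : C) : Cmod z <= Rabs (Re z) + Rabs (Im z).
Proof.
replace z with (RtoC (Re z) + Ci * RtoC (Im z))%C at 1.
- eapply Rle_trans; [apply Cmod_triangle |]; rewrite Cmod_mult, Cmod_Ci, !Cmod_R; lra.
- apply C_ext; unfold Re, Im; simpl; ring.
Qed.

(** Each of the four real error terms is at most [3 |h|^2], with 3 bounding [exp 1]; the constant 13
    leaves a little room. *)
Lemma Cexp_taylor1_bound (h : C) :
  Cmod h <= 1 -> Cmod (Cexp h - 1 - h) <= 13 * (Cmod h * Cmod h).
Proof.
intros Hh; destruct h as [x y].
pose proof (re_le_Cmod (x, y)) as Hx; pose proof (im_le_Cmod (x, y)) as Hy.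
set (m := Cmod (x, y)) in *; unfold Re, Im in Hx, Hy; simpl in Hx, Hy.
eapply Rle_trans; [apply Cmod_le_Re_Im |].
replace (Re (Cexp (x, y) - 1 - (x, y))) with ((exp x - 1 - x) + exp x * (cos y - 1))
  by (unfold Cexp, Re, Im; simpl; ring).
replace (Im (Cexp (x, y) - 1 - (x, y))) with (exp x * (sin y - y) + (exp x - 1) * y)
  by (unfold Cexp, Re, Im; simpl; ring).
assert (E3 : exp x <= 3).
{ apply Rle_trans with (exp 1); [apply exp_nondecreasing; generalize (Rle_abs x); lra | apply exp_le_3]. }
pose proof (exp_pos x) as Pe.
eapply Rle_trans; [apply Rplus_le_compat; apply Rabs_triang |].
rewrite !Rabs_mult, (Rabs_right (exp x)) by lra.
generalize (exp_taylor1_bound x ltac:(lra)) (cos_sub_1_bound y)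
  (sin_taylor1_bound y ltac:(lra)) (exp_sub_1_bound x ltac:(lra)); intros B1 B2 B3 B4.
pose proof (Rabs_pos x) as Px; pose proof (Rabs_pos y) as Py.
assert (Qx : Rabs x * Rabs x <= m * m) by (apply Rmult_le_compat; assumption).
assert (Qy : Rabs y * Rabs y <= m * m) by (apply Rmult_le_compat; assumption).
assert (Qxy : Rabs x * Rabs y <= m * m) by (apply Rmult_le_compat; assumption).
assert (T1 : exp x * Rabs (cos y - 1) <= 3 * (m * m)).
{ apply Rmult_le_compat; [lra | apply Rabs_pos | exact E3 | lra]. }
assert (T2 : exp x * Rabs (sin y - y) <= 3 * (m * m)).
{ apply Rmult_le_compat; [lra | apply Rabs_pos | exact E3 | lra]. }
assert (T3 : Rabs (exp x - 1) * Rabs y <= 3 * (m * m)).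
{ apply Rle_trans with (3 * Rabs x * Rabs y); [apply Rmult_le_compat_r; assumption | lra]. }
assert (0 <= m * m) by (apply Rle_trans with (Rabs x * Rabs x); [apply Rmult_le_pos |]; assumption).
lra.
Qed.

Lemma Cder_Cexp (z : C) : Cder Cexp z (Cexp z).
Proof.
apply (Cder_of_quadratic _ _ _ (Cmod (Cexp z) * 13) 1); [lra |].
intros y Hy.
replace (Cexp y) with (Cexp z * Cexp (y - z))%C
  by (rewrite <- Cexp_plus; f_equal; ring).
replace (Cexp z * Cexp (y - z) - Cexp z - Cexp z * (y - z))%C
  with (Cexp z * (Cexp (y - z) - 1 - (y - z)))%C by ring.
rewrite Cmod_mult, Rmult_assoc.
apply Rmult_le_compat_l; [apply Cmod_ge_0 | apply Cexp_taylor1_bound; lra].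
Qed.

Lemma Cder_Cexp_comp (g : C -> C) (z l : C) : Cder g z l ->
  Cder (fun y => Cexp (g y)) z (l * Cexp (g z))%C.
Proof. rewrite Cmult_comm; apply Cder_comp, Cder_Cexp. Qed.

Lemma Cder_scal (c : C) (g : C -> C) (z l : C) : Cder g z l -> Cder (fun y => c * g y)%C z (c * l)%C.
Proof.
intros H; replace (c * l)%C with (0 * g z + c * l)%C by ring.
apply (Cder_mult (fun _ => c) g); [apply Cder_const | exact H].
Qed.

Lemma Cder_eq (f : C -> C) (z l m : C) : Cder f z l -> l = m -> Cder f z m.
Proof. intros H <-; exact H. Qed.

(** The derivative of this remainder is the first-order remainder, so the mean value inequality
    gains one power of [|h|]. The second order is needed to see that the sine agrees with its
    argument up to a cubic error. *)
Lemma Cexp_taylor2_bound (h : C) :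
  Cmod h <= 1 -> Cmod (Cexp h - 1 - h - h * h / 2) <= 13 * (Cmod h * Cmod h * Cmod h).
Proof.
intros Hh.
pose (F := fun u => (Cexp u + (- (1) + (- (1) * u + - (1) / 2 * (u * u))))%C).
replace (Cexp h - 1 - h - h * h / 2)%C with (F h - F 0)%C
  by (unfold F; rewrite Cexp_0; field; intros E; injection E; lra).
replace (13 * (Cmod h * Cmod h * Cmod h)) with (13 * (Cmod h * Cmod h) * Cmod (h - 0))
  by (replace (h - 0)%C with h by ring; ring).
apply (mean_value_bound F (fun u => Cexp u - 1 - u)%C).
intros t Ht; set (u := segment 0 h t).
assert (Hu : Cmod u <= Cmod h).
{ apply segment_Cmod; [exact Ht | rewrite Cmod_0; apply Cmod_ge_0 | lra]. }
split.
- eapply Cder_eq.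
  + apply Cder_plus; [apply Cder_Cexp |].
    apply Cder_plus; [apply Cder_const |].
    apply Cder_plus; apply Cder_scal; [apply Cder_id |].
    apply Cder_mult; apply Cder_id.
  + cbv beta; field; intros E; injection E; lra.
- eapply Rle_trans; [apply Cexp_taylor1_bound; lra |].
  apply Rmult_le_compat_l; [lra |].
  apply Rmult_le_compat; auto using Cmod_ge_0.
Qed.

(** * The principal branches *)

Lemma Carg_bound (v : C) : Rabs (Carg v) <= PI.
Proof.
unfold Carg; pose proof (acos_bound (Re v / Cmod v)).
destruct (Rle_dec 0 (Im v)); rewrite ?Rabs_Ropp, Rabs_right; lra.
Qed.

Lemma Re_div_Cmod_bound (v : C) : v <> 0 -> -1 <= Re v / Cmod v <= 1.
Proof.
intros N; apply Cmod_gt_0 in N.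
generalize (re_le_Cmod v); intros H; apply Rabs_le_between in H.
split; [apply Rmult_le_reg_r with (Cmod v) | apply Rmult_le_reg_r with (Cmod v)];
  try exact N; unfold Rdiv; rewrite Rmult_assoc, Rinv_l; lra.
Qed.

Lemma Cexp_Clog (v : C) : v <> 0 -> Cexp (Clog v) = v.
Proof.
intros N; pose proof (proj1 (Cmod_gt_0 v) N) as P.
pose proof (Re_div_Cmod_bound v N) as B.
assert (Hc : cos (Carg v) = Re v / Cmod v).
{ unfold Carg; destruct (Rle_dec 0 (Im v)); rewrite ?cos_neg; apply cos_acos, B. }
assert (Hs0 : sin (acos (Re v / Cmod v)) = Rabs (Im v) / Cmod v).
{ rewrite sin_acos by exact B; unfold Rsqr.
  replace (1 - Re v / Cmod v * (Re v / Cmod v)) with ((Rabs (Im v) / Cmod v) ^ 2).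
  - apply sqrt_pow2, Rmult_le_pos; [apply Rabs_pos | left; apply Rinv_0_lt_compat, P].
  - pose proof (Cmod2_alt v) as E.
    replace ((Rabs (Im v) / Cmod v) ^ 2) with (Im v ^ 2 / Cmod v ^ 2)
      by (rewrite <- (pow2_abs (Im v)); field; lra).
    replace (Im v ^ 2) with (Cmod v ^ 2 - Re v ^ 2) by lra; field; lra. }
assert (Hs : sin (Carg v) = Im v / Cmod v).
{ unfold Carg; destruct (Rle_dec 0 (Im v)); rewrite ?sin_neg, Hs0.
  - rewrite Rabs_right by lra; reflexivity.
  - rewrite Rabs_left by lra; field; lra. }
apply C_ext.
- change (exp (ln (Cmod v)) * cos (Carg v) = Re v).
  rewrite exp_ln, Hc by exact P; field; lra.
- change (exp (ln (Cmod v)) * sin (Carg v) = Im v).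
  rewrite exp_ln, Hs by exact P; field; lra.
Qed.

Lemma Clog_Cexp (u : C) : - (PI / 2) < Im u < PI / 2 -> Clog (Cexp u) = u.
Proof.
intros H.
assert (E : Re (Cexp u) / Cmod (Cexp u) = cos (Im u)).
{ rewrite Cmod_Cexp; unfold Cexp, Re at 1; simpl; field; apply Rgt_not_eq, exp_pos. }
assert (Ei : Im (Cexp u) = exp (Re u) * sin (Im u)) by reflexivity.
apply C_ext.
- change (ln (Cmod (Cexp u)) = Re u); rewrite Cmod_Cexp; apply ln_exp.
- change (Carg (Cexp u) = Im u); unfold Carg; rewrite E, Ei; pose proof (exp_pos (Re u)) as P.
  destruct (Rle_dec 0 (exp (Re u) * sin (Im u))) as [H0 | H0].
  + apply acos_cos; split; [| lra].
    destruct (Rle_lt_dec 0 (Im u)) as [L | L]; [exact L | exfalso].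
    assert (sin (Im u) < 0) by (apply sin_lt_0_var; lra); nra.
  + rewrite <- cos_neg, acos_cos; [ring | split; [| lra]].
    destruct (Rle_lt_dec (Im u) 0) as [L | L]; [lra | exfalso].
    assert (0 < sin (Im u)) by (apply sin_gt_0; lra); nra.
Qed.

Lemma Cmult_eq_0 (x y : C) : (x * y)%C = 0 -> x = 0 \/ y = 0.
Proof.
intros E; destruct (Ceq_dec x 0) as [| N]; [left; assumption | right].
destruct (Ceq_dec y 0) as [| N']; [assumption | exfalso].
exact (Cmult_neq_0 _ _ N N' E).
Qed.

Lemma Csqrt_sqr (s : C) : (Csqrt s * Csqrt s)%C = s.
Proof.
unfold Csqrt; destruct (Ceq_dec s 0) as [-> | N]; [ring |].
rewrite <- Cexp_plus; replace (Clog s / 2 + Clog s / 2)%C with (Clog s)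
  by (field; intros E; injection E; lra).
apply Cexp_Clog, N.
Qed.

Lemma Re_Csqrt_nonneg (s : C) : 0 <= Re (Csqrt s).
Proof.
unfold Csqrt; destruct (Ceq_dec s 0) as [-> | N]; [unfold Re; simpl; lra |].
change (0 <= exp (Re (Clog s / 2)) * cos (Im (Clog s / 2))).
apply Rmult_le_pos; [left; apply exp_pos |].
assert (E : Im (Clog s / 2) = Carg s / 2).
{ unfold Cdiv; replace (/ 2)%C with (RtoC (/ 2)) by (apply RtoC_inv; lra).
  rewrite im_scal_r; reflexivity. }
rewrite E; pose proof (Carg_bound s) as B; apply Rabs_le_between in B.
apply cos_ge_0; lra.
Qed.

Lemma Csqrt_unique (s w : C) : (w * w)%C = s -> 0 < Re w -> Csqrt s = w.
Proof.
intros E P.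
assert (H : ((Csqrt s - w) * (Csqrt s + w))%C = 0).
{ replace ((Csqrt s - w) * (Csqrt s + w))%C with (Csqrt s * Csqrt s - w * w)%C by ring.
  rewrite Csqrt_sqr, E; ring. }
apply Cmult_eq_0 in H; destruct H as [H | H].
- apply Ceq_minus; exact H.
- exfalso; pose proof (Re_Csqrt_nonneg s) as Q.
  apply (f_equal Re) in H; rewrite re_plus in H; unfold Re at 3 in H; simpl in H; lra.
Qed.

(** The second factor is the inverse of the argument of the logarithm in [Carcsin]. So that argument
    never vanishes, and an upper bound for both factors is also a lower bound for each. *)
Lemma arcsin_argument_mult (u : C) :
  ((Ci * u + Csqrt (1 - u * u)) * (Csqrt (1 - u * u) - Ci * u))%C = 1.
Proof.
transitivity (Csqrt (1 - u * u) * Csqrt (1 - u * u) - (Ci * Ci) * (u * u))%C; [ring |].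
rewrite Csqrt_sqr; replace (Ci * Ci)%C with (- (1))%C; [ring |].
apply C_ext; unfold Ci, Re, Im; simpl; ring.
Qed.

Lemma Cexp_i_Carcsin (u : C) :
  Cexp (Ci * Carcsin u) = (Ci * u + Csqrt (1 - u * u))%C.
Proof.
unfold Carcsin.
replace (Ci * - (Ci * Clog (Ci * u + Csqrt (1 - u * u))))%C
  with (- (Ci * Ci) * Clog (Ci * u + Csqrt (1 - u * u)))%C by ring.
replace (- (Ci * Ci))%C with (RtoC 1) by (apply C_ext; unfold Ci, Re, Im; simpl; ring).
rewrite Cmult_1_l; apply Cexp_Clog.
intros E; apply C1_nz; rewrite <- (arcsin_argument_mult u), E; ring.
Qed.

(* This is [sin (Carcsin u) = u], with the sine written out. *)
Lemma sin_Carcsin (u : C) :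
  (Cexp (Ci * Carcsin u) - Cexp (- (Ci * Carcsin u)))%C = (2 * Ci * u)%C.
Proof.
rewrite Cexp_opp, Cexp_i_Carcsin.
pose proof (arcsin_argument_mult u) as E.
set (p := (Ci * u + Csqrt (1 - u * u))%C) in *; set (q := (Csqrt (1 - u * u) - Ci * u)%C) in *.
assert (N : p <> 0) by (intros Ep; apply C1_nz; rewrite <- E, Ep; ring).
replace (/ p)%C with (/ p * (p * q))%C by (rewrite E; ring).
replace (/ p * (p * q))%C with q by (field; exact N).
unfold p, q; ring.
Qed.

(** The argument of the logarithm has modulus between [1/3] and 3, because it and its inverse are
    each a sum of terms of modulus at most 1 and 2. Boundedness up to the unit circle is what the
    Gronwall argument feeds on. *)
Lemma Carcsin_bound (u : C) : Cmod u <= 1 -> Cmod (Carcsin u) <= ln 3 + PI.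
Proof.
intros Hu; unfold Carcsin.
rewrite Cmod_opp, Cmod_mult, Cmod_Ci, Rmult_1_l.
pose proof (arcsin_argument_mult u) as E.
assert (Hs : Cmod (Csqrt (1 - u * u)) <= 2).
{ pose proof (f_equal Cmod (Csqrt_sqr (1 - u * u))) as Es; rewrite Cmod_mult in Es.
  pose proof (Cmod_minus_triangle 1 (u * u)) as T; rewrite Cmod_1, Cmod_mult in T.
  pose proof (Cmod_ge_0 (Csqrt (1 - u * u))); pose proof (Cmod_ge_0 u); nra. }
assert (Hp : Cmod (Ci * u + Csqrt (1 - u * u)) <= 3).
{ eapply Rle_trans; [apply Cmod_triangle |]; rewrite Cmod_mult, Cmod_Ci; lra. }
assert (Hq : Cmod (Csqrt (1 - u * u) - Ci * u) <= 3).
{ eapply Rle_trans; [apply Cmod_minus_triangle |]; rewrite Cmod_mult, Cmod_Ci; lra. }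
apply (f_equal Cmod) in E; rewrite Cmod_mult, Cmod_1 in E.
set (p := (Ci * u + Csqrt (1 - u * u))%C) in *; set (q := (Csqrt (1 - u * u) - Ci * u)%C) in *.
pose proof (Cmod_ge_0 p); pose proof (Cmod_ge_0 q).
assert (Pp : 0 < Cmod p) by nra.
assert (Lp : / 3 <= Cmod p).
{ apply Rmult_le_reg_r with 3; [lra |]; rewrite Rinv_l by lra; nra. }
eapply Rle_trans; [apply Cmod_le_Re_Im |].
unfold Clog, Re, Im; simpl; apply Rplus_le_compat; [| apply Carg_bound].
apply Rabs_le; split.
- rewrite <- ln_Rinv by lra; apply ln_le; lra.
- apply ln_le; lra.
Qed.

(** * Means over circles *)

Definition unit_circle (t : R) : C := (cos t, sin t).

Definition circle (r t : R) : C := (RtoC r * unit_circle t)%C.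

Lemma Cmod_unit_circle (t : R) : Cmod (unit_circle t) = 1.
Proof.
unfold Cmod, unit_circle; simpl.
replace (cos t * (cos t * 1) + sin t * (sin t * 1)) with 1; [apply sqrt_1 |].
generalize (sin2_cos2 t); unfold Rsqr; lra.
Qed.

Lemma Cmod_circle (r t : R) : 0 <= r -> Cmod (circle r t) = r.
Proof.
intros H; unfold circle; rewrite Cmod_mult, Cmod_unit_circle, Cmod_R, Rabs_right; lra.
Qed.

Lemma circle_der_radius (r t : R) : curve_der (fun s => circle s t) r (unit_circle t).
Proof. split; unfold circle, unit_circle, Re, Im; simpl; auto_derive; auto; ring. Qed.

Lemma circle_der_angle (r t : R) : curve_der (circle r) t (Ci * circle r t)%C.
Proof. split; unfold circle, unit_circle, Re, Im; simpl; auto_derive; auto; ring. Qed.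

Lemma continuity_2d_trig (g : R -> R) (x y : R) : continuity_pt g y ->
  continuity_2d_pt (fun _ v => g v) x y.
Proof.
intros H; apply (continuity_1d_2d_pt_comp g (fun _ v => v)); [exact H | apply continuity_2d_pt_id2].
Qed.

Lemma Clim_unit_circle (x y : R) :
  Clim (locally (x, y)) (fun u : R * R => unit_circle (snd u)) (unit_circle y).
Proof.
apply Clim_Re_Im.
- apply (proj1 (continuity_2d_pt_filterlim (fun _ v => cos v) x y)).
  apply continuity_2d_trig, continuity_cos.
- apply (proj1 (continuity_2d_pt_filterlim (fun _ v => sin v) x y)).
  apply continuity_2d_trig, continuity_sin.
Qed.

Lemma Clim_circle (x y : R) :
  Clim (locally (x, y)) (fun u : R * R => circle (fst u) (snd u)) (circle x y).
Proof.
apply Clim_mult; [| apply Clim_unit_circle].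
apply Clim_Re_Im.
- apply (proj1 (continuity_2d_pt_filterlim (fun u _ => u) x y)), continuity_2d_pt_id1.
- apply (proj1 (continuity_2d_pt_filterlim (fun _ _ => 0) x y)), continuity_2d_pt_const.
Qed.

Lemma continuity_2d_pt_section (f : R -> R -> R) (x y : R) :
  continuity_2d_pt f x y -> continuous (fun t => f x t) y.
Proof.
intros H; apply filterlim_locally; intros eps.
destruct (H eps) as [d Hd]; exists d; intros t Ht.
apply Hd; [replace (x - x) with 0 by ring; rewrite Rabs_R0; apply cond_pos | exact Ht].
Qed.

Lemma Rinv_mult_cancel (r x : R) : r <> 0 -> / r * (r * x) = x.
Proof. intros H; field; exact H. Qed.

Section CircleMean.

Context (G dG : C -> C).
Hypothesis G_der : forall z, 0 < Cmod z < 1 -> Cder G z (dG z).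
Hypothesis dG_cont : forall z, 0 < Cmod z < 1 -> Ccont dG z.

Let circle_in (r t : R) : 0 < r < 1 -> 0 < Cmod (circle r t) < 1.
Proof. intros H; rewrite Cmod_circle; lra. Qed.

Let radial (r t : R) : R := Re (dG (circle r t) * unit_circle t).

Let radial_der (r t : R) : 0 < r < 1 -> is_derive (fun s => Re (G (circle s t))) r (radial r t).
Proof.
intros H; apply (Cder_curve G (fun s => circle s t) r _ _
  (G_der _ (circle_in r t H)) (circle_der_radius r t)).
Qed.

(** One of the Cauchy-Riemann equations in polar coordinates. *)
Let angle_der (r t : R) : 0 < r < 1 ->
  is_derive (fun s => Im (G (circle r s))) t (r * radial r t).
Proof.
intros H.
destruct (Cder_curve G (circle r) t _ _ (G_der _ (circle_in r t H)) (circle_der_angle r t))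
  as [_ D].
replace (r * radial r t) with (Im (dG (circle r t) * (Ci * circle r t))); [exact D |].
unfold radial, circle, Re, Im; simpl; ring.
Qed.

Let radial_cont (r t : R) : 0 < r < 1 -> continuity_2d_pt radial r t.
Proof.
intros H; apply continuity_2d_pt_filterlim.
apply (Clim_Re (fun u : R * R => dG (circle (fst u) (snd u)) * unit_circle (snd u))%C).
apply Clim_mult; [| apply Clim_unit_circle].
apply (Clim_comp _ dG (circle r t)); [apply Clim_circle |].
apply dG_cont, circle_in, H.
Qed.

Lemma circle_integrable (r : R) : 0 < r < 1 ->
  ex_RInt (fun t => Re (G (circle r t))) 0 (2 * PI).
Proof.
intros H; apply (ex_RInt_continuous (V := R_CompleteNormedModule)); intros t _.
apply (continuity_2d_pt_section (fun r t => Re (G (circle r t)))).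
apply continuity_2d_pt_filterlim.
apply (Clim_Re (fun u : R * R => G (circle (fst u) (snd u)))).
apply (Clim_comp _ G (circle r t)); [apply Clim_circle |].
eapply Cder_cont, G_der, circle_in, H.
Qed.

Let locally_radius (r : R) : 0 < r < 1 -> locally r (fun s => 0 < s < 1).
Proof.
intros H; apply (open_and (fun s => 0 < s) (fun s => s < 1)); [apply open_gt | apply open_lt | exact H].
Qed.

(** Differentiation under the integral sign gives the mean of [radial], which is [/ r] times the
    increment of [Im G] around the circle, hence zero. The centre is excluded from the hypotheses on
    [G] because the functions to which this is applied have a pole there. *)
Let mean_derive (r : R) : 0 < r < 1 ->
  is_derive (fun s => RInt (fun t => Re (G (circle s t))) 0 (2 * PI)) r 0.
Proof.
intros H.
assert (D : forall s t, 0 < s < 1 -> Derive (fun u => Re (G (circle u t))) s = radial s t).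
{ intros s t Hs; apply is_derive_unique, radial_der, Hs. }
assert (E : RInt (fun t => Derive (fun u => Re (G (circle u t))) r) 0 (2 * PI) = 0).
{ apply is_RInt_unique.
  apply (is_RInt_ext (fun t => / r * (r * radial r t))).
  { intros t _; rewrite D by exact H; apply (Rinv_mult_cancel r); lra. }
  assert (E0 : / r * (Im (G (circle r (2 * PI))) - Im (G (circle r 0))) = 0).
  { replace (circle r (2 * PI)) with (circle r 0); [ring |].
    unfold circle, unit_circle; rewrite cos_0, sin_0, cos_2PI, sin_2PI; reflexivity. }
  assert (I0 : is_RInt (fun t => r * radial r t) 0 (2 * PI)
      (Im (G (circle r (2 * PI))) - Im (G (circle r 0)))).
  { apply (is_RInt_derive (V := R_CompleteNormedModule) (fun s => Im (G (circle r s)))).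
    - intros t _; apply angle_der, H.
    - intros t _; apply (continuous_scal_r (V := R_NormedModule) r (radial r)).
      apply continuity_2d_pt_section, radial_cont, H. }
  apply (is_RInt_scal _ _ _ (/ r)) in I0.
  change (is_RInt (fun t => / r * (r * radial r t)) 0 (2 * PI)
    (/ r * (Im (G (circle r (2 * PI))) - Im (G (circle r 0))))) in I0.
  rewrite E0 in I0; exact I0. }
assert (M : is_derive (fun s => RInt (fun t => Re (G (circle s t))) 0 (2 * PI)) r
   (RInt (fun t => Derive (fun u => Re (G (circle u t))) r) 0 (2 * PI)));
  [| rewrite E in M; exact M].
apply (is_derive_RInt_param (fun r t => Re (G (circle r t)))).
- generalize (locally_radius r H); apply filter_imp; intros s Hs t _.
  exists (radial s t); apply radial_der, Hs.
- intros t _; apply (continuity_2d_pt_ext_loc radial); [| apply radial_cont, H].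
  destruct (locally_radius r H) as [d Hd]; exists d; intros u v Hu _.
  symmetry; apply D, Hd, Hu.
- generalize (locally_radius r H); apply filter_imp; intros s Hs; apply circle_integrable, Hs.
Qed.

Lemma circle_mean_constant (r s : R) : 0 < r -> r < s -> s < 1 ->
  RInt (fun t => Re (G (circle r t))) 0 (2 * PI) = RInt (fun t => Re (G (circle s t))) 0 (2 * PI).
Proof.
intros Hr Hrs Hs.
apply (eq_is_derive (fun s => RInt (fun t => Re (G (circle s t))) 0 (2 * PI))); [| exact Hrs].
intros t Ht; apply mean_derive; lra.
Qed.

End CircleMean.

(** * The inequality for the first two coefficients of a Schwarz function *)

Lemma is_RInt_trig (a b c : R) :
  is_RInt (fun t => a + b * cos t + c * sin t) 0 (2 * PI) (2 * PI * a).
Proof.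
pose (F := fun t => a * t + b * sin t - c * cos t).
replace (2 * PI * a) with (F (2 * PI) - F 0).
- apply (is_RInt_derive (V := R_CompleteNormedModule) F).
  + intros t _; unfold F; auto_derive; auto; ring.
  + intros t _; apply (ex_derive_continuous (fun t => a + b * cos t + c * sin t)).
    auto_derive; auto.
- unfold F; rewrite cos_2PI, sin_2PI, cos_0, sin_0; ring.
Qed.

Section SchwarzCoefficients.

Context (w dw eta : C -> C) (c1 c2 : C).
Hypothesis w_der : forall z, Omega z -> Cder w z (dw z).
Hypothesis dw_cont : forall z, Omega z -> Ccont dw z.
Hypothesis w_le_1 : forall z, Omega z -> Cmod (w z) <= 1.
(** A Peano expansion of second order: near the origin nothing more than this is asked of [w]. The
    factor [eta] absorbs the error at every [z], so the identity is exact. *)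
Hypothesis w_taylor : forall z, w z = (c1 * z + (c2 + eta z) * (z * z))%C.
Hypothesis eta_0 : Clim (nbhs 0) eta 0.

(* Pairing [w] with the square of [p + q / z] gives a kernel whose modulus is
   again a trigonometric polynomial, so that its mean is explicit. *)
Lemma schwarz_functional_bound (p q : C) (r : R) : 0 < r < 1 ->
  Re (2 * p * q * RtoC r * c1 + q * q * RtoC r * RtoC r * c2)
    <= Cmod p * Cmod p + Cmod q * Cmod q.
Proof.
intros Hr.
(* On the circle of radius [r], [k / z] is [q] times the conjugate of the unit vector, so [r] leaves
   the bound on the kernel and enters the coefficients instead. *)
pose (k := (q * RtoC r)%C).
pose (G := fun z => (w z * ((p + k * / z) * (p + k * / z)))%C).
pose (dG := fun z => (dw z * ((p + k * / z) * (p + k * / z)) +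
   w z * (- (2) * k * / (z * z) * (p + k * / z)))%C).
assert (nz : forall z, 0 < Cmod z < 1 -> z <> 0) by (intros z Hz; apply Cmod_gt_0; lra).
assert (in_O : forall z, 0 < Cmod z < 1 -> Omega z) by (unfold Omega; intros; lra).
assert (der_k : forall z, 0 < Cmod z < 1 ->
   Cder (fun z => p + k * / z)%C z (- (1) * k * / (z * z))%C).
{ intros z Hz; eapply Cder_eq.
  - apply Cder_plus; [apply Cder_const |]; apply Cder_scal.
    apply (Cder_inv (fun z => z)); [apply nz, Hz | apply Cder_id].
  - field; apply nz, Hz. }
assert (G_der : forall z, 0 < Cmod z < 1 -> Cder G z (dG z)).
{ intros z Hz; eapply Cder_eq.
  - apply Cder_mult; [apply w_der, in_O, Hz |].
    apply (Cder_mult _ _ _ _ _ (der_k z Hz) (der_k z Hz)).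
  - unfold dG; ring. }
assert (inv_cont : forall z, 0 < Cmod z < 1 -> Clim (nbhs z) (fun z => / (z * z))%C (/ (z * z))%C).
{ intros z Hz; apply Clim_inv; [apply Cmult_neq_0; apply nz, Hz |].
  apply Clim_mult; apply Clim_id. }
assert (dG_cont : forall z, 0 < Cmod z < 1 -> Ccont dG z).
{ intros z Hz.
  assert (Ck : Ccont (fun z => p + k * / z)%C z) by (eapply Cder_cont, der_k, Hz).
  assert (Cw : Ccont w z) by (eapply Cder_cont, w_der, in_O, Hz).
  assert (Cd : Ccont dw z) by (apply dw_cont, in_O, Hz).
  unfold Ccont, dG; apply Clim_plus; apply Clim_mult; try assumption.
  - apply Clim_mult; assumption.
  - apply Clim_mult; [| assumption]; apply Clim_mult; [apply Clim_const | apply inv_cont, Hz]. }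
(* Laurent expansion of [G] at the origin: constant term [A], pole [B / z], and a remainder [Rm]
   tending to 0. There is no term in [1 / z^2] because [w] vanishes at 0. *)
pose (A := (2 * p * k * c1 + k * k * c2)%C).
pose (B := (k * k * c1)%C).
pose (Rm := fun z => (p * p * (c1 * z + (c2 + eta z) * (z * z)) + 2 * p * k * ((c2 + eta z) * z)
   + k * k * eta z)%C).
assert (HG : forall z : C, z <> 0 -> G z = (A + B * / z + Rm z)%C).
{ intros z Nz; unfold G, A, B, Rm; rewrite w_taylor; field; exact Nz. }
assert (HR : Clim (nbhs 0) Rm 0).
{ replace (Clim (nbhs 0) Rm 0) with (Clim (nbhs 0) Rm (p * p * (c1 * 0 + (c2 + 0) * (0 * 0))
   + 2 * p * k * ((c2 + 0) * 0) + k * k * 0)%C) by (f_equal; ring).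
  assert (I := Clim_id 0).
  assert (CE : Clim (nbhs 0) (fun z => c2 + eta z)%C (c2 + 0)%C)
    by (apply Clim_plus; [apply Clim_const | exact eta_0]).
  unfold Rm.
  repeat first [exact I | exact CE | exact eta_0 | apply Clim_const | apply Clim_plus | apply Clim_mult]. }
(* Upper estimate on the circle of radius [r]: replace [w] by its bound 1. The squared modulus left
   over is a trigonometric polynomial [a + b cos t + c sin t]. *)
assert (U : RInt (fun t => Re (G (circle r t))) 0 (2 * PI)
   <= 2 * PI * (Cmod p * Cmod p + Cmod q * Cmod q)).
{ pose (b := 2 * (Re p * Re q + Im p * Im q)).
  pose (c := 2 * (Re p * Im q - Im p * Re q)).
  pose (a := Cmod p * Cmod p + Cmod q * Cmod q).
  assert (Sq : forall z : C, Cmod z * Cmod z = Re z * Re z + Im z * Im z).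
  { intros z; generalize (Cmod2_alt z); lra. }
  fold a; rewrite <- (is_RInt_unique _ _ _ _ (is_RInt_trig a b c)).
  apply RInt_le.
  - generalize PI_RGT_0; lra.
  - apply (circle_integrable G dG G_der r Hr).
  - exists (2 * PI * a); apply is_RInt_trig.
  - intros t _.
    assert (Hc : 0 < Cmod (circle r t) < 1) by (rewrite Cmod_circle; lra).
    eapply Rle_trans; [apply Rle_abs |]; eapply Rle_trans; [apply re_le_Cmod |].
    unfold G; rewrite Cmod_mult.
    eapply Rle_trans; [apply Rmult_le_compat_r; [apply Cmod_ge_0 | apply w_le_1, in_O, Hc] |].
    rewrite Rmult_1_l, Cmod_mult.
    assert (N1 : unit_circle t <> 0) by (apply Cmod_gt_0; rewrite Cmod_unit_circle; lra).
    assert (Nr : RtoC r <> 0) by (intros E; apply RtoC_inj in E; lra).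
    assert (E : (p + k * / circle r t)%C = (p + q * Cconj (unit_circle t))%C).
    { assert (E1 : (unit_circle t * Cconj (unit_circle t))%C = 1).
      { rewrite <- Cmod2_conj, Cmod_unit_circle; f_equal; ring. }
      f_equal; unfold k, circle.
      transitivity (q * / unit_circle t * (unit_circle t * Cconj (unit_circle t)))%C;
        [rewrite E1; field; split; assumption | field; exact N1]. }
    rewrite E, Sq; unfold a, b, c; rewrite !Sq; right.
    unfold unit_circle, Re, Im; simpl.
    generalize (sin2_cos2 t); unfold Rsqr; intros E2.
    replace (cos t * cos t) with (1 - sin t * sin t) by lra.
    assert (E3 : cos t * cos t = 1 - sin t * sin t) by lra.
    ring_simplify; replace (cos t ^ 2) with (1 - sin t ^ 2) by (simpl; lra); ring. }
(* Lower estimate: move to a circle of small radius [s], where the pole has mean zero and the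
   remainder is below [eps]. *)
assert (L : forall eps, 0 < eps ->
   2 * PI * (Re A - eps) <= RInt (fun t => Re (G (circle r t))) 0 (2 * PI)).
{ intros eps He; destruct (proj1 (nbhs_iff _ _) (HR eps He)) as [d [Hd H]].
  pose (s := Rmin (d / 2) (r / 2)).
  assert (Hs : 0 < s) by (apply Rmin_pos; lra).
  assert (Hsr : s < r) by (generalize (Rmin_r (d / 2) (r / 2)); fold s; lra).
  assert (Hsd : s < d) by (generalize (Rmin_l (d / 2) (r / 2)); fold s; lra).
  rewrite <- (circle_mean_constant G dG G_der dG_cont s r Hs Hsr) by lra.
  pose (b := Re B / s); pose (c := Im B / s).
  rewrite <- (is_RInt_unique _ _ _ _ (is_RInt_trig (Re A - eps) b c)).
  apply RInt_le.
  - generalize PI_RGT_0; lra.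
  - exists (2 * PI * (Re A - eps)); apply is_RInt_trig.
  - apply (circle_integrable G dG G_der s); lra.
  - intros t _.
    assert (Hc : Cmod (circle s t) = s) by (apply Cmod_circle; lra).
    assert (Nz : circle s t <> 0) by (apply Cmod_gt_0; lra).
    rewrite (HG _ Nz), !re_plus.
    assert (E : Re (B * / circle s t) = b * cos t + c * sin t).
    { unfold circle, unit_circle, b, c, Re, Im, Cinv; simpl.
      generalize (sin2_cos2 t); unfold Rsqr; intros E2.
      assert (E3 : (s * cos t - 0 * sin t) * ((s * cos t - 0 * sin t) * 1) +
        (s * sin t + 0 * cos t) * ((s * sin t + 0 * cos t) * 1) = s * s).
      { transitivity (s * s * (sin t * sin t + cos t * cos t)); [ring | rewrite E2; ring]. }
      rewrite E3; field; lra. }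
    rewrite E.
    assert (HRm : Rabs (Re (Rm (circle s t))) <= eps).
    { eapply Rle_trans; [apply re_le_Cmod |].
      specialize (H (circle s t)).
      replace (circle s t - 0)%C with (circle s t) in H by ring.
      replace (Rm (circle s t) - 0)%C with (Rm (circle s t)) in H by ring.
      left; apply H; lra. }
    apply Rabs_le_between in HRm; lra. }
assert (EA : Re A = Re (2 * p * q * RtoC r * c1 + q * q * RtoC r * RtoC r * c2)).
{ unfold A, k; f_equal; ring. }
rewrite <- EA; apply le_epsilon; intros eps He.
specialize (L eps He); generalize PI_RGT_0; intros HP.
apply Rmult_le_reg_l with (2 * PI); [lra |].
lra.
Qed.

(** Take [q] of modulus 1 rotating [c2] onto [|c2|], and [p = r conj(q c1)], which maximizes
    [2 Re(p q r c1) - |p|^2]. The functional bound becomes [r^2 (|c1|^2 + |c2|) <= 1], and [r] tends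
    to 1. *)
Lemma schwarz_coefficients_bound : Cmod c1 * Cmod c1 + Cmod c2 <= 1.
Proof.
assert (Hq : exists q, Cmod q = 1 /\ (q * q * c2)%C = RtoC (Cmod c2)).
{ destruct (Ceq_dec c2 0) as [-> | N].
  - exists (RtoC 1); rewrite Cmod_1, Cmod_0; split; [reflexivity | ring].
  - pose proof (proj1 (Cmod_gt_0 _) N) as P.
    assert (Nm : RtoC (Cmod c2) <> 0) by (intros E; apply RtoC_inj in E; lra).
    exists (Csqrt (RtoC (Cmod c2) / c2)); rewrite Csqrt_sqr; split; [| field; exact N].
    pose proof (f_equal Cmod (Csqrt_sqr (RtoC (Cmod c2) / c2))) as E.
    rewrite Cmod_mult, Cmod_div, Cmod_R, Rabs_right in E by (exact N || lra).
    replace (Cmod c2 / Cmod c2) with 1 in E by (field; lra).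
    pose proof (Cmod_ge_0 (Csqrt (RtoC (Cmod c2) / c2))); nra. }
destruct Hq as [q [Q1 Q2]].
assert (H : forall r, 0 < r < 1 -> r * r * (Cmod c1 * Cmod c1 + Cmod c2) <= 1).
{ intros r Hr.
  pose proof (schwarz_functional_bound (RtoC r * Cconj (q * c1)) q r Hr) as B.
  replace (2 * (RtoC r * Cconj (q * c1)) * q * RtoC r * c1 + q * q * RtoC r * RtoC r * c2)%C
    with (RtoC (r * r) * (2 * ((q * c1) * Cconj (q * c1)) + q * q * c2))%C in B
    by (rewrite RtoC_mult; ring).
  rewrite Q2, <- Cmod2_conj, Cmod_mult, Q1 in B.
  rewrite Cmod_mult, Cmod_conj, Cmod_mult, Q1, Cmod_R, Rabs_right in B by lra.
  rewrite <- RtoC_mult, <- RtoC_plus, <- RtoC_mult, re_RtoC in B.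
  nra. }
destruct (Rle_lt_dec (Cmod c1 * Cmod c1 + Cmod c2) 1) as [| N]; [assumption | exfalso].
set (S := Cmod c1 * Cmod c1 + Cmod c2) in *.
assert (P : 0 < / S) by (apply Rinv_0_lt_compat; lra).
assert (P1 : / S < 1) by (rewrite <- Rinv_1; apply Rinv_lt_contravar; lra).
assert (E : / S * S = 1) by (field; lra).
(* By the inequality of arithmetic and geometric means, the square of this radius exceeds [/ S]. *)
specialize (H ((1 + / S) / 2) ltac:(lra)).
assert (/ S < (1 + / S) / 2 * ((1 + / S) / 2)) by nra.
nra.
Qed.

End SchwarzCoefficients.

(** * Absence of zeros from a bound on the logarithmic derivative *)

Lemma Re_conj_mult_bound (x y : C) : Rabs (Re x * Re y + Im x * Im y) <= Cmod x * Cmod y.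
Proof.
replace (Re x * Re y + Im x * Im y) with (Re (Cconj x * y)) by (unfold Re, Im; simpl; ring).
eapply Rle_trans; [apply re_le_Cmod |]; rewrite Cmod_mult, Cmod_conj; lra.
Qed.

Lemma Ccont_neq_0 (f : C -> C) (z : C) : Ccont f z -> f z <> 0 -> nbhs z (fun y => f y <> 0).
Proof.
intros H N; generalize (H (Cmod (f z)) (proj1 (Cmod_gt_0 _) N)); apply filter_imp.
intros y Hy E; rewrite E in Hy; replace (0 - f z)%C with (- f z)%C in Hy by ring.
rewrite Cmod_opp in Hy; lra.
Qed.

(* Gronwall along rays: with [N = |h|^2], the hypothesis gives [N' >= - C N]
   away from the origin, and this also holds at the zeros of [h]. *)
Lemma log_derivative_bound_nonvanishing (h dh : C -> C) (K : R) :
  (forall z, Omega z -> Cder h z (dh z)) -> h 0 <> 0 ->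
  (forall z, Omega z -> h z <> 0 -> Cmod (z * dh z) <= K * Cmod (h z)) ->
  forall z, Omega z -> h z <> 0.
Proof.
intros D h0 HK z Hz Ez.
destruct (proj1 (nbhs_iff _ _) (Ccont_neq_0 h 0 (Cder_cont _ _ _ (D 0 Omega_0)) h0))
  as [d [Hd Hnz]].
(* The hypothesis controls [z * dh z], so bounding [dh] costs a division by [t], and the argument
   must start at some [t0 > 0]. Within distance [d] of the origin continuity already gives
   [h <> 0]. *)
pose (t0 := Rmin (1 / 2) d).
assert (Ht0 : 0 < t0) by (apply Rmin_pos; lra).
assert (Ht1 : t0 <= 1 / 2) by apply Rmin_l.
assert (Ht2 : t0 <= d) by apply Rmin_r.
assert (Hin : forall t, t0 <= t <= 1 -> Omega (segment 0 z t)).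
{ intros t Ht; apply segment_Omega; [apply Omega_0 | exact Hz | lra]. }
pose (N := fun t => Re (h (segment 0 z t)) * Re (h (segment 0 z t)) +
   Im (h (segment 0 z t)) * Im (h (segment 0 z t))).
pose (v := fun t => (dh (segment 0 z t) * (z - 0))%C).
pose (dN := fun t => 2 * (Re (h (segment 0 z t)) * Re (v t) + Im (h (segment 0 z t)) * Im (v t))).
assert (NE : forall t, N t = Cmod (h (segment 0 z t)) * Cmod (h (segment 0 z t))).
{ intros t; generalize (Cmod2_alt (h (segment 0 z t))); unfold N; lra. }
assert (DN : forall t, t0 <= t <= 1 -> is_derive N t (dN t)).
{ intros t Ht.
  destruct (Cder_curve h _ t _ _ (D _ (Hin t Ht)) (segment_der 0 z t)) as [D1 D2].
  unfold N, dN, v.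
  replace (2 * _) with
    ((Re (dh (segment 0 z t) * (z - 0)) * Re (h (segment 0 z t)) +
      Re (h (segment 0 z t)) * Re (dh (segment 0 z t) * (z - 0))) +
     (Im (dh (segment 0 z t) * (z - 0)) * Im (h (segment 0 z t)) +
      Im (h (segment 0 z t)) * Im (dh (segment 0 z t) * (z - 0)))) by ring.
  apply (is_derive_plus (K := R_AbsRing) (V := R_NormedModule));
    apply Derive.is_derive_mult; assumption. }
(* From [|N'| <= 2 |h| |v|] and [t |v| <= K |h|] with [t >= t0]. *)
pose (c := 2 * (Rabs K / t0)).
assert (BN : forall t, t0 <= t <= 1 -> - (c * N t) <= dN t).
{ intros t Ht; rewrite NE.
  pose proof (Re_conj_mult_bound (h (segment 0 z t)) (v t)) as B.
  apply Rabs_le_between in B.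
  destruct (Ceq_dec (h (segment 0 z t)) 0) as [E | Nz].
  - unfold dN; rewrite E, Cmod_0 in *; lra.
  - specialize (HK _ (Hin t Ht) Nz).
    assert (E : (segment 0 z t * dh (segment 0 z t))%C = (RtoC t * v t)%C)
      by (unfold v; unfold segment at 1; ring).
    rewrite E, Cmod_mult, Cmod_R, Rabs_right in HK by lra.
    pose proof (Cmod_ge_0 (h (segment 0 z t))) as Ph; pose proof (Cmod_ge_0 (v t)) as Pv.
    assert (Hv : Cmod (v t) <= Rabs K / t0 * Cmod (h (segment 0 z t))).
    { apply Rmult_le_reg_l with t0; [exact Ht0 |].
      replace (t0 * (Rabs K / t0 * Cmod (h (segment 0 z t))))
        with (Rabs K * Cmod (h (segment 0 z t))) by (field; lra).
      apply Rle_trans with (t * Cmod (v t)); [apply Rmult_le_compat_r; lra |].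
      eapply Rle_trans; [exact HK |]; apply Rmult_le_compat_r; [exact Ph | apply Rle_abs]. }
    apply (Rmult_le_compat_l _ _ _ Ph) in Hv.
    unfold dN, c; lra. }
(* [N e^(c t)] does not decrease, so it cannot go from a positive value at [t0] to 0 at a zero of
   [h]. *)
destruct (MVT_gen (fun t => N t * exp (c * t)) t0 1 (fun t => (dN t + c * N t) * exp (c * t)))
  as [t [Ht E]].
- intros t; rewrite Rmin_left, Rmax_right by lra; intros Ht.
  replace ((dN t + c * N t) * exp (c * t)) with (dN t * exp (c * t) + N t * (c * exp (c * t)))
    by ring.
  apply (Derive.is_derive_mult N (fun t => exp (c * t))); [apply DN; lra |].
  auto_derive; auto; ring.
- intros t; rewrite Rmin_left, Rmax_right by lra; intros Ht.
  apply continuity_pt_mult.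
  + eapply is_derive_continuity, DN; lra.
  + apply (is_derive_continuity (fun t => exp (c * t)) t (c * exp (c * t))).
    auto_derive; auto; ring.
- rewrite Rmin_left, Rmax_right in Ht by lra.
  assert (P : 0 <= (dN t + c * N t) * exp (c * t) * (1 - t0)).
  { apply Rmult_le_pos; [| lra]; apply Rmult_le_pos; [| left; apply exp_pos].
    specialize (BN t Ht); lra. }
  rewrite (NE 1), segment_1, Ez, Cmod_0 in E.
  assert (P0 : 0 < N t0 * exp (c * t0)).
  { apply Rmult_lt_0_compat; [| apply exp_pos].
    rewrite NE.
    assert (Hn : h (segment 0 z t0) <> 0).
    { apply Hnz; unfold segment.
      replace (0 + RtoC t0 * (z - 0) - 0)%C with (RtoC t0 * z)%C by ring.
      rewrite Cmod_mult, Cmod_R, Rabs_right by lra.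
      unfold Omega in Hz; pose proof (Cmod_ge_0 z); nra. }
    apply Cmod_gt_0 in Hn; apply Rmult_lt_0_compat; exact Hn. }
  lra.
Qed.

Lemma Cder_C_derive (f g : C -> C) (z : C) : Cder f z (g z) -> C_derive f z = g z.
Proof. intros H; apply is_C_derive_unique, Cder_is_derive, H. Qed.

Lemma Cder_unique (f : C -> C) (z l m : C) : Cder f z l -> Cder f z m -> l = m.
Proof.
intros H1 H2; rewrite <- (is_C_derive_unique f z l), <- (is_C_derive_unique f z m);
  auto; apply Cder_is_derive; assumption.
Qed.

Lemma two_neq_0 : RtoC 2 <> 0.
Proof. intros E; apply RtoC_inj in E; lra. Qed.

Lemma PI_neq_0 : RtoC PI <> 0.
Proof. intros E; apply RtoC_inj in E; generalize PI_RGT_0; lra. Qed.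

(** * From the subordination to the Taylor and logarithmic coefficients *)

Section Coefficients.

Context (f : C -> C) (a : nat -> C).
Hypothesis a_0 : a 0%nat = 0.
Hypothesis a_1 : a 1%nat = 1.
Hypothesis f_series : forall z, Omega z -> power_series_at a z (f z).

Let h := CPSeries (CPS_derive a).
Let h1 := CPSeries (CPS_derive (CPS_derive a)).
Let h2 := CPSeries (CPS_derive (CPS_derive (CPS_derive a))).

Let a_summable : disk_summable a := convergent_disk_summable a f f_series.
Let h_der (z : C) : Omega z -> Cder h z (h1 z) :=
  Cder_CPSeries _ z (disk_summable_derive _ a_summable).
Let h1_der (z : C) : Omega z -> Cder h1 z (h2 z) :=
  Cder_CPSeries _ z (disk_summable_derive _ (disk_summable_derive _ a_summable)).
Let h2_cont (z : C) : Omega z -> Ccont h2 z.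
Proof.
intros Hz; eapply Cder_cont, Cder_CPSeries; [| exact Hz].
do 3 apply disk_summable_derive; exact a_summable.
Qed.

Let f_eq (z : C) : Omega z -> f z = CPSeries a z.
Proof. intros Hz; apply power_series_CPSeries, f_series, Hz. Qed.

Lemma f_derivative (z : C) : Omega z -> C_derive f z = h z.
Proof.
intros Hz; apply Cder_C_derive.
apply (Cder_ext_loc (CPSeries a)); [| apply Cder_CPSeries; assumption].
generalize (Omega_open z Hz); apply filter_imp; intros y Hy; symmetry; apply f_eq, Hy.
Qed.

Lemma f_second_derivative (z : C) : Omega z -> C_derive (C_derive f) z = h1 z.
Proof.
intros Hz; apply Cder_C_derive.
apply (Cder_ext_loc h); [| apply h_der, Hz].
generalize (Omega_open z Hz); apply filter_imp; intros y Hy; symmetry; apply f_derivative, Hy.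
Qed.

Let h_0 : h 0 = 1.
Proof.
unfold h; rewrite CPSeries_0 by (apply disk_summable_derive, a_summable).
unfold CPS_derive; rewrite a_1; simpl; ring.
Qed.

Let h1_0 : h1 0 = (2 * a 2%nat)%C.
Proof.
unfold h1; rewrite CPSeries_0 by (do 2 apply disk_summable_derive; exact a_summable).
unfold CPS_derive; simpl; rewrite RtoC_plus; ring.
Qed.

Let h2_0 : h2 0 = (6 * a 3%nat)%C.
Proof.
unfold h2; rewrite CPSeries_0 by (do 3 apply disk_summable_derive; exact a_summable).
unfold CPS_derive; simpl; replace (RtoC 6) with (RtoC 1 * ((1 + 1) * (1 + 1 + 1)))%C.
- rewrite !RtoC_plus; ring.
- rewrite <- !RtoC_plus, <- !RtoC_mult; f_equal; ring.
Qed.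

(** [c1] and [c2] are read off from [(pi/2) z f''/f' = (pi/2) (2 a_2 z + (6 a_3 - 4 a_2^2) z^2 +
    ...)]; passing to the sine does not change them. *)
Let c1 : C := (RtoC PI * a 2%nat)%C.
Let c2 : C := (RtoC PI / 2 * (6 * a 3%nat - 4 * (a 2%nat * a 2%nat)))%C.

Section Subordination.

Context (w : C -> C).
Hypothesis w_schwarz : Schwarz_function w.
Hypothesis w_eq : forall z, Omega z ->
  (1 + z * C_derive (C_derive f) z / C_derive f z)%C = (1 + RtoC (2 / PI) * Carcsin (w z))%C.

(** With the factor [z] split off, [c1] and [c2] are the value and the first derivative of [V] at
    the origin. *)
Let V (z : C) : C := (RtoC PI / 2 * (h1 z * / h z))%C.
Let T (z : C) : C := (z * V z)%C.

(** This precedes the proof that [h] has no zero. It holds at a zero as well, because both sides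
    then contain the same default value of the inverse. *)
Let Carcsin_w (z : C) : Omega z -> Carcsin (w z) = T z.
Proof.
intros Hz; pose proof (w_eq z Hz) as E.
rewrite (f_second_derivative z Hz), (f_derivative z Hz) in E.
rewrite RtoC_div in E by (generalize PI_RGT_0; lra).
assert (E' : (z * h1 z / h z)%C = (2 / RtoC PI * Carcsin (w z))%C).
{ transitivity (1 + z * h1 z / h z - 1)%C; [ring | rewrite E; ring]. }
unfold T, V; replace (z * (RtoC PI / 2 * (h1 z * / h z)))%C
  with (RtoC PI / 2 * (z * h1 z / h z))%C by (unfold Cdiv; ring).
rewrite E'; field; apply PI_neq_0.
Qed.

Let h_neq_0 (z : C) : Omega z -> h z <> 0.
Proof.
apply (log_derivative_bound_nonvanishing h h1 (2 / PI * (ln 3 + PI))).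
- exact h_der.
- rewrite h_0; apply C1_nz.
- clear z; intros z Hz N.
  pose proof (Carcsin_bound (w z) (proj2 (proj2 w_schwarz) z Hz)) as B.
  rewrite (Carcsin_w z Hz) in B.
  replace (z * h1 z)%C with (RtoC (2 / PI) * T z * h z)%C.
  + rewrite !Cmod_mult, Cmod_R.
    assert (P : 0 < 2 / PI) by (apply Rdiv_lt_0_compat; generalize PI_RGT_0; lra).
    rewrite Rabs_right by lra.
    apply Rmult_le_compat_r; [apply Cmod_ge_0 |].
    apply Rmult_le_compat_l; lra.
  + rewrite RtoC_div by (generalize PI_RGT_0; lra).
    unfold T, V; field; repeat split; auto using two_neq_0, PI_neq_0.
Qed.

Let dV (z : C) : C := (RtoC PI / 2 * (h2 z * / h z + h1 z * (- h1 z / (h z * h z))))%C.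
Let dT (z : C) : C := (V z + z * dV z)%C.

Let V_der (z : C) : Omega z -> Cder V z (dV z).
Proof.
intros Hz; apply (Cder_scal (RtoC PI / 2) (fun z => h1 z * / h z)%C).
apply (Cder_mult h1 (fun z => / h z)%C); [apply h1_der, Hz |].
apply Cder_inv; [apply h_neq_0, Hz | apply h_der, Hz].
Qed.

Let T_der (z : C) : Omega z -> Cder T z (dT z).
Proof.
intros Hz; eapply Cder_eq.
- apply (Cder_mult (fun z => z) V); [apply Cder_id | apply V_der, Hz].
- unfold dT; ring.
Qed.

Let dT_cont (z : C) : Omega z -> Ccont dT z.
Proof.
intros Hz.
assert (Hi : Clim (nbhs z) (fun z => / (h z * h z))%C (/ (h z * h z))%C).
{ assert (Ch : Ccont h z) by (eapply Cder_cont, h_der, Hz).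
  apply Clim_inv; [apply Cmult_neq_0; apply h_neq_0, Hz | apply Clim_mult; exact Ch]. }
assert (Hi1 : Clim (nbhs z) (fun z => / h z)%C (/ h z)%C).
{ apply Clim_inv; [apply h_neq_0, Hz | eapply Cder_cont, h_der, Hz]. }
assert (Ch1 : Ccont h1 z) by (eapply Cder_cont, h1_der, Hz).
assert (Cv : Ccont V z) by (eapply Cder_cont, V_der, Hz).
assert (Ch1' : Clim (nbhs z) (fun z => - h1 z)%C (- h1 z)%C).
{ replace (- h1 z)%C with (- (1) * h1 z)%C by ring.
  apply (Clim_ext_loc (fun z => - (1) * h1 z)%C); [apply filter_forall; intros; ring |].
  apply Clim_mult; [apply Clim_const | exact Ch1]. }
apply Clim_plus; [exact Cv |].
apply Clim_mult; [apply Clim_id |].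
apply Clim_mult; [apply Clim_const |].
apply Clim_plus.
- apply Clim_mult; [apply h2_cont, Hz | exact Hi1].
- apply Clim_mult; [exact Ch1 | apply Clim_mult; [exact Ch1' | exact Hi]].
Qed.

Let w_sin (z : C) : Omega z ->
  w z = (/ (2 * Ci) * (Cexp (Ci * T z) + - (1) * Cexp (- Ci * T z)))%C.
Proof.
intros Hz; pose proof (sin_Carcsin (w z)) as E; rewrite (Carcsin_w z Hz) in E.
replace (- Ci * T z)%C with (- (Ci * T z))%C by ring.
replace (Cexp (Ci * T z) + - (1) * Cexp (- (Ci * T z)))%C
  with (Cexp (Ci * T z) - Cexp (- (Ci * T z)))%C by ring.
rewrite E; field; apply Ci_nz.
Qed.

Let dw (z : C) : C :=
  (/ (2 * Ci) * (Ci * dT z * Cexp (Ci * T z) + - (1) * (- Ci * dT z * Cexp (- Ci * T z))))%C.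

Let w_der (z : C) : Omega z -> Cder w z (dw z).
Proof.
intros Hz.
apply (Cder_ext_loc (fun z => / (2 * Ci) * (Cexp (Ci * T z) + - (1) * Cexp (- Ci * T z)))%C).
- generalize (Omega_open z Hz); apply filter_imp; intros y Hy; symmetry; apply w_sin, Hy.
- apply Cder_scal, Cder_plus; [| apply Cder_scal];
    apply (Cder_Cexp_comp (fun z => _ * T z)%C); apply Cder_scal, T_der, Hz.
Qed.

Let dw_cont (z : C) : Omega z -> Ccont dw z.
Proof.
intros Hz.
assert (Ce : forall c : C, Clim (nbhs z) (fun z => Cexp (c * T z)) (Cexp (c * T z))).
{ intros c; apply (Cder_cont (fun z => Cexp (c * T z)) z (c * dT z * Cexp (c * T z))).
  apply (Cder_Cexp_comp (fun z => c * T z)%C), Cder_scal, T_der, Hz. }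
pose proof (dT_cont z Hz) as Cd.
apply Clim_mult; [apply Clim_const |]; apply Clim_plus.
- apply Clim_mult; [| apply Ce]; apply Clim_mult; [apply Clim_const | exact Cd].
- apply Clim_mult; [apply Clim_const |].
  apply Clim_mult; [| apply Ce]; apply Clim_mult; [apply Clim_const | exact Cd].
Qed.

Let V_0 : V 0 = c1.
Proof.
unfold V, c1; rewrite h_0, h1_0; field.
Qed.

Let dV_0 : dV 0 = c2.
Proof.
unfold dV, c2; rewrite h_0, h1_0, h2_0.
replace (RtoC 4) with (RtoC 2 * RtoC 2)%C by (rewrite <- RtoC_mult; f_equal; ring).
field.
Qed.

(** In the difference of the exponentials of [iT] and [-iT] the constant and quadratic terms cancel
    and the linear ones give [T]; only the two cubic remainders are left. *)
Let w_sub_T_bound (z : C) : Omega z -> Cmod (T z) <= 1 ->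
  Cmod (w z - T z) <= 13 * (Cmod (T z) * Cmod (T z) * Cmod (T z)).
Proof.
intros Hz HT.
pose (E := fun u => (Cexp u - 1 - u - u * u / 2)%C).
assert (HE : (w z - T z)%C = (/ (2 * Ci) * (E (Ci * T z) - E (- Ci * T z)))%C).
{ rewrite (w_sin z Hz); unfold E; field; apply Ci_nz. }
rewrite HE, Cmod_mult, Cmod_inv, Cmod_mult, Cmod_Ci, Cmod_R, Rabs_right
  by first [lra | apply Cmult_neq_0; [apply two_neq_0 | apply Ci_nz]].
assert (M1 : Cmod (Ci * T z) = Cmod (T z)) by (rewrite Cmod_mult, Cmod_Ci; ring).
assert (M2 : Cmod (- Ci * T z) = Cmod (T z)) by (rewrite Cmod_mult, Cmod_opp, Cmod_Ci; ring).
generalize (Cexp_taylor2_bound (Ci * T z)) (Cexp_taylor2_bound (- Ci * T z)).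
rewrite M1, M2; intros B1 B2; specialize (B1 HT); specialize (B2 HT).
change (Cmod (E (Ci * T z)%C) <= 13 * (Cmod (T z) * Cmod (T z) * Cmod (T z))) in B1.
change (Cmod (E (- Ci * T z)%C) <= 13 * (Cmod (T z) * Cmod (T z) * Cmod (T z))) in B2.
generalize (Cmod_minus_triangle (E (Ci * T z)%C) (E (- Ci * T z)%C)); lra.
Qed.

Lemma subordination_coefficients_bound : Cmod c1 * Cmod c1 + Cmod c2 <= 1.
Proof.
assert (w0 : w 0 = 0) by apply w_schwarz.
pose (eta := fun z => if Ceq_dec z 0 then RtoC 0 else ((w z - c1 * z - c2 * (z * z)) / (z * z))%C).
apply (schwarz_coefficients_bound w dw eta); auto.
- intros z Hz; apply w_schwarz, Hz.
- intros z; unfold eta; destruct (Ceq_dec z 0) as [-> | N]; [rewrite w0; ring | field; exact N].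
(* The slope [phi] of [V] at 0 gives the exact formula [T z = c1 z + phi z z^2] with [phi] tending
   to [c2]. *)
- pose proof (V_der 0 Omega_0) as DV; pose proof (Cder_cont _ _ _ DV) as CV.
  destruct DV as [phi [P1 [P2 P3]]]; rewrite dV_0 in P1, P2.
  unfold Ccont in CV; rewrite V_0 in P3, CV.
  intros eps He.
  pose (M := Cmod c1 + 1).
  assert (HM : 1 <= M) by (generalize (Cmod_ge_0 c1); unfold M; lra).
  assert (HM3 : 0 < M * M * M) by (repeat apply Rmult_lt_0_compat; lra).
  (* The three terms keep [z] in the disk, force [|T z| <= 1], and make the cubic error divided by
     [|z|^2] at most [eps / 2]. *)
  pose (d := Rmin (1 / 2) (Rmin (/ M) (eps / (2 * (13 * (M * M * M)))))).
  assert (Hd : 0 < d).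
  { repeat apply Rmin_pos; [lra | apply Rinv_0_lt_compat; lra | apply Rdiv_lt_0_compat; lra]. }
  assert (Hd1 : d <= 1 / 2) by apply Rmin_l.
  assert (Hd2 : d <= / M) by (eapply Rle_trans; [apply Rmin_r | apply Rmin_l]).
  assert (Hd3 : d <= eps / (2 * (13 * (M * M * M)))) by (eapply Rle_trans; [apply Rmin_r | apply Rmin_r]).
  assert (Nd : nbhs 0 (fun y => Cmod (y - 0) < d)) by (apply nbhs_iff; exists d; auto).
  assert (He2 : 0 < eps / 2) by lra.
  generalize (filter_and _ _ Nd (filter_and _ _ (P1 _ He2) (CV 1 Rlt_0_1))).
  apply filter_imp; intros z [Hz [Hphi HV]].
  replace (z - 0)%C with z in Hz by ring.
  replace (eta z - 0)%C with (eta z) by ring.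
  unfold eta; destruct (Ceq_dec z 0) as [_ | N]; [rewrite Cmod_0; exact He |].
  pose proof (proj1 (Cmod_gt_0 z) N) as Pz.
  assert (Oz : Omega z) by (unfold Omega; lra).
  assert (HVM : Cmod (V z) <= M).
  { generalize (Cmod_reverse_triangle (V z) c1); unfold M; lra. }
  assert (HTM : Cmod (T z) <= M * Cmod z).
  { unfold T; rewrite Cmod_mult, Rmult_comm; apply Rmult_le_compat_r; lra. }
  assert (HzM : M * Cmod z <= 1).
  { apply Rle_trans with (M * / M); [apply Rmult_le_compat_l; lra | rewrite Rinv_r; lra]. }
  pose proof (w_sub_T_bound z Oz ltac:(lra)) as B.
  assert (B3 : Cmod (T z) * Cmod (T z) * Cmod (T z) <= (M * Cmod z) * (M * Cmod z) * (M * Cmod z)).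
  { pose proof (Cmod_ge_0 (T z)).
    repeat apply Rmult_le_compat; auto; apply Rmult_le_pos; auto. }
  replace ((w z - c1 * z - c2 * (z * z)) / (z * z))%C
    with ((phi z - c2) + (w z - T z) / (z * z))%C.
  + eapply Rle_lt_trans; [apply Cmod_triangle |].
    rewrite Cmod_div, Cmod_mult by (apply Cmult_neq_0; exact N).
    assert (B4 : Cmod (w z - T z) / (Cmod z * Cmod z) <= eps / 2).
    { apply Rmult_le_reg_r with (Cmod z * Cmod z); [apply Rmult_lt_0_compat; exact Pz |].
      unfold Rdiv at 1; rewrite Rmult_assoc, Rinv_l, Rmult_1_r
        by (apply Rgt_not_eq, Rmult_lt_0_compat; exact Pz).
      apply Rle_trans with (13 * (M * M * M) * Cmod z * (Cmod z * Cmod z)); [lra |].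
      apply Rmult_le_compat_r; [apply Rmult_le_pos; lra |].
      apply Rle_trans with (13 * (M * M * M) * (eps / (2 * (13 * (M * M * M))))).
      - apply Rmult_le_compat_l; lra.
      - right; field; lra. }
    lra.
  + unfold T; rewrite (P3 z); field; exact N.
Qed.

End Subordination.

(** With [b] the series of [f(z)/z] and [g] that of its logarithm, [e^g = b] gives [g' b = b'] and
    [g'' b + g' b' = b'']; both are evaluated at 0. *)
Lemma logarithmic_coefficients_formula (gamma : nat -> C) :
  logarithmic_coefficients f gamma ->
  (2 * gamma 1%nat)%C = a 2%nat /\
  (4 * gamma 2%nat)%C = (2 * a 3%nat - a 2%nat * a 2%nat)%C.
Proof.
intros [L [_ [L0 [HL HLs]]]].
set (g := fun n => match n with O => RtoC 0 | S _ => (2 * gamma n)%C end) in HLs.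
pose proof (convergent_disk_summable g L HLs) as Sg.
pose (b := fun n => a (S n)).
assert (Sb : disk_summable b).
{ intros r Hr.
  destruct (Rle_lt_or_eq_dec 0 r (proj1 Hr)) as [P | <-].
  - apply (ex_series_ext (fun n => / r * (Cmod (a (S n)) * r ^ S n))).
    + intros n; unfold b; simpl; field; lra.
    + apply ex_series_Rscal, (ex_series_incr_1 (fun n => Cmod (a n) * r ^ n)), a_summable, Hr.
  - apply (ex_series_incr_1 (fun n => Cmod (b n) * 0 ^ n)).
    apply (ex_series_ext (fun n => 0 * (1 / 2) ^ n)); [intros n; simpl; ring |].
    apply ex_series_Rscal, ex_series_geom; rewrite Rabs_right; lra. }
assert (fb : forall z, Omega z -> f z = (z * CPSeries b z)%C).
{ intros z Hz; rewrite (f_eq z Hz); unfold CPSeries.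
  rewrite CSeries_S by (apply disk_summable_Omega; assumption).
  rewrite a_0, <- CSeries_scal by (apply (disk_summable_Omega b); assumption).
  rewrite Cmult_0_l, Cplus_0_l; apply CSeries_ext; intros n; unfold b; simpl; ring. }
(* At the origin, where the quotient [f z / z] says nothing, the identity comes from the constant
   terms 0 and 1. *)
assert (E : forall z, Omega z -> Cexp (CPSeries g z) = CPSeries b z).
{ intros z Hz; destruct (Ceq_dec z 0) as [-> | N].
  - rewrite !CPSeries_0 by assumption; unfold b; rewrite a_1; apply Cexp_0.
  - rewrite <- (power_series_CPSeries _ _ _ (HLs z Hz)), (HL z Hz N), (fb z Hz).
    field; exact N. }
assert (E1 : forall z, Omega z ->
   (CPSeries (CPS_derive g) z * CPSeries b z)%C = CPSeries (CPS_derive b) z).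
{ intros z Hz; apply (Cder_unique (CPSeries b) z); [| apply Cder_CPSeries; assumption].
  rewrite <- (E z Hz).
  apply (Cder_ext_loc (fun z => Cexp (CPSeries g z))).
  - generalize (Omega_open z Hz); apply filter_imp; exact E.
  - apply Cder_Cexp_comp, Cder_CPSeries; assumption. }
assert (E2 : (CPSeries (CPS_derive (CPS_derive g)) 0 * CPSeries b 0 +
   CPSeries (CPS_derive g) 0 * CPSeries (CPS_derive b) 0)%C = CPSeries (CPS_derive (CPS_derive b)) 0).
{ apply (Cder_unique (CPSeries (CPS_derive b)) 0);
    [| apply Cder_CPSeries; [apply disk_summable_derive, Sb | apply Omega_0]].
  apply (Cder_ext_loc (fun z => CPSeries (CPS_derive g) z * CPSeries b z)%C).
  - generalize (Omega_open 0 Omega_0); apply filter_imp; exact E1.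
  - apply Cder_mult; apply Cder_CPSeries; auto using disk_summable_derive, Omega_0. }
specialize (E1 0 Omega_0).
rewrite !CPSeries_0 in E1 by (auto using disk_summable_derive).
rewrite !CPSeries_0 in E2 by (auto using disk_summable_derive).
unfold CPS_derive, b, g in E1, E2; simpl in E1, E2; rewrite a_1 in E1, E2.
rewrite !RtoC_plus in E2.
assert (G1 : (2 * gamma 1%nat)%C = a 2%nat).
{ transitivity (1 * (2 * gamma 1%nat) * 1)%C; [ring | rewrite E1; ring]. }
split; [exact G1 |].
rewrite G1 in E2.
replace (RtoC 4) with ((1 + 1) * 2)%C by (rewrite <- RtoC_plus, <- RtoC_mult; f_equal; ring).
replace (RtoC 2 * a 3%nat)%C with (1 * ((1 + 1) * a 3%nat))%C
  by (rewrite <- RtoC_plus, Cmult_1_l; do 2 f_equal; ring).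
rewrite <- E2; ring.
Qed.

End Coefficients.

(** * The two inequalities *)

(** Here [x = |c1|], [y = |c2|], [g = |gamma_2|]. With [s = 1/(2 pi)] and [k = 6 pi g], the
    difference is [(k - 3 x) s / 3], so the claim is [s - 3 <= k - 3 x <= 1]. *)
Lemma real_bounds (x y g : R) :
  0 <= x -> 0 <= y -> x * x + y <= 1 -> 0 <= g ->
  x * x / (2 * PI) - y <= 6 * PI * g <= x * x / (2 * PI) + y ->
  - (1 / (2 * PI)) * (1 - 1 / (6 * PI)) <= g - x / (2 * PI) <= 1 / (6 * PI).
Proof.
intros Hx Hy H Hg [G1 G2].
pose proof PI_RGT_0 as P.
assert (P3 : 3 < PI) by (generalize PI2_3_2; unfold PI2; lra).
pose (s := 1 / (2 * PI)).
assert (Hs : 0 < s) by (apply Rdiv_lt_0_compat; lra).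
assert (Es : s * (2 * PI) = 1) by (unfold s; field; lra).
assert (Hs6 : s < 1 / 6) by nra.
replace (x * x / (2 * PI)) with (x * x * s) in G1, G2 by (unfold s; field; lra).
replace (x / (2 * PI)) with (x * s) by (unfold s; field; lra).
replace (- (1 / (2 * PI)) * (1 - 1 / (6 * PI))) with (- s * (1 - s / 3)) by (unfold s; field; lra).
replace (1 / (6 * PI)) with (s / 3) by (unfold s; field; lra).
assert (Eg : g = 6 * PI * g * (s / 3)) by (transitivity (g * (s * (2 * PI))); [rewrite Es | field]; lra).
set (k := 6 * PI * g) in *.
assert (Hk : 0 <= k) by (unfold k; apply Rmult_le_pos; lra).
assert (Hx1 : x <= 1) by nra.
assert (A1 : k - 3 * x <= 1) by nra.
assert (A2 : s - 3 <= k - 3 * x).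
(* For smaller [x], [k >= 0] is enough. Otherwise [k >= (1 + s) x^2 - 1], and
   [(1 + s) x^2 - 3 x + 2 - s] factors as [(1 - x) (2 - s - (1 + s) x)], nonnegative for [x <= 1]
   and [s < 1/6]. *)
{ destruct (Rle_lt_dec x (1 - s / 3)); [lra | nra]. }
rewrite Eg; split; nra.
Qed.

Lemma logarithmic_coefficients_bounds (f : C -> C) (gamma : nat -> C) :
  class_C_arcsin f -> logarithmic_coefficients f gamma ->
  - (1 / (2 * PI)) * (1 - 1 / (6 * PI))
    <= Cmod (gamma 2%nat) - Cmod (gamma 1%nat)
    <= 1 / (6 * PI).
Proof.
intros [[[_ [a [a0 [a1 Hf]]]] _] [w [Hw Ew]]] Hg.
pose proof (subordination_coefficients_bound f a a1 Hf w Hw Ew) as B.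
destruct (logarithmic_coefficients_formula f a a0 a1 Hf gamma Hg) as [G1 G2].
set (c1 := (RtoC PI * a 2%nat)%C) in *.
set (c2 := (RtoC PI / 2 * (6 * a 3%nat - 4 * (a 2%nat * a 2%nat)))%C) in *.
pose proof PI_RGT_0 as P; pose proof PI_neq_0 as NP; pose proof two_neq_0 as N2.
assert (E1 : (RtoC (2 * PI) * gamma 1%nat)%C = c1).
{ unfold c1; rewrite <- G1, RtoC_mult; ring. }
assert (E2 : (RtoC (6 * PI) * gamma 2%nat)%C = (c2 + c1 * c1 * RtoC (/ (2 * PI)))%C).
{ unfold c1, c2; rewrite RtoC_inv, !RtoC_mult by lra.
  assert (N4 : RtoC 4 <> 0) by (intros E; apply RtoC_inj in E; lra).
  replace (gamma 2%nat) with ((2 * a 3%nat - a 2%nat * a 2%nat) / 4)%C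
    by (rewrite <- G2; field; exact N4).
  replace (RtoC 4) with (2 * 2)%C by (rewrite <- RtoC_mult; f_equal; ring).
  replace (RtoC 6) with (2 * (1 + 2))%C by (rewrite <- RtoC_plus, <- RtoC_mult; f_equal; ring).
  field; assumption. }
apply (f_equal Cmod) in E1; rewrite Cmod_mult, Cmod_R, Rabs_right in E1 by lra.
replace (Cmod (gamma 1%nat)) with (Cmod c1 / (2 * PI)) by (rewrite <- E1; field; lra).
assert (M : Cmod (c1 * c1 * RtoC (/ (2 * PI))) = Cmod c1 * Cmod c1 / (2 * PI)).
{ rewrite !Cmod_mult, Cmod_R, Rabs_right; [reflexivity |].
  left; apply Rinv_0_lt_compat; lra. }
apply (real_bounds (Cmod c1) (Cmod c2)); auto using Cmod_ge_0.
apply (f_equal Cmod) in E2; rewrite Cmod_mult, Cmod_R, Rabs_right in E2 by lra.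
rewrite E2, <- M; split.
- replace (c2 + c1 * c1 * RtoC (/ (2 * PI)))%C
    with (c1 * c1 * RtoC (/ (2 * PI)) - (- c2))%C by ring.
  eapply Rle_trans; [| apply Cmod_reverse_triangle]; rewrite Cmod_opp; lra.
- rewrite Rplus_comm; apply Cmod_triangle.
Qed.

(** * The Taylor series of the arcsine *)

(** Connectedness along rays: a change of sign would force a zero of [Re g]. This is the device that
    pins down the principal branches below. *)
Lemma Re_positive_on_Omega (g dg : C -> C) :
  (forall z, Omega z -> Cder g z (dg z)) -> 0 < Re (g 0) ->
  (forall z, Omega z -> Re (g z) <> 0) -> forall z, Omega z -> 0 < Re (g z).
Proof.
intros D P N z Hz.
destruct (Rlt_le_dec 0 (Re (g z))) as [| L]; [assumption | exfalso].
assert (L' : Re (g z) < 0) by (specialize (N z Hz); lra).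
pose (u := fun t => - Re (g (segment 0 z t))).
assert (Hin : forall t, 0 <= t <= 1 -> Omega (segment 0 z t)).
{ intros t Ht; apply segment_Omega; [apply Omega_0 | exact Hz | exact Ht]. }
destruct (IVT_interv u 0 1) as [t [Ht E]].
- intros t Ht; unfold u; apply continuity_pt_opp.
  apply (is_derive_continuity (fun t => Re (g (segment 0 z t))) t
    (Re (dg (segment 0 z t) * (z - 0)))).
  apply (Cder_curve g (segment 0 z) t _ _ (D _ (Hin t Ht)) (segment_der 0 z t)).
- lra.
- unfold u; rewrite segment_0; lra.
- unfold u; rewrite segment_1; lra.
- apply (N _ (Hin t Ht)); unfold u in E; lra.
Qed.

(* Taylor coefficients of [(1 - z^2)^(-1/2)]. *)
Fixpoint invsqrt_coef (m : nat) : R :=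
  match m with
  | O => 1
  | S O => 0
  | S (S k) => invsqrt_coef k * (INR (S k) / INR (S (S k)))
  end.

Definition arcsin_coef (m : nat) : R :=
  match m with O => 0 | S k => invsqrt_coef k / INR (S k) end.

Lemma invsqrt_coef_SS (k : nat) :
  invsqrt_coef (S (S k)) = invsqrt_coef k * (INR (S k) / INR (S (S k))).
Proof. reflexivity. Qed.

Lemma invsqrt_coef_bound (m : nat) :
  (0 <= invsqrt_coef m <= 1) /\ (0 <= invsqrt_coef (S m) <= 1).
Proof.
induction m as [| m [IH1 IH2]]; [simpl; lra |].
split; [exact IH2 |]; rewrite invsqrt_coef_SS.
pose proof (pos_INR m) as P.
assert (B : 0 <= INR (S m) / INR (S (S m)) <= 1).
{ rewrite !S_INR; split.
  - apply Rmult_le_pos; [lra | left; apply Rinv_0_lt_compat; lra].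
  - apply Rmult_le_reg_r with (INR m + 1 + 1); [lra |].
    unfold Rdiv; rewrite Rmult_assoc, Rinv_l; lra. }
split; [apply Rmult_le_pos | replace 1 with (1 * 1) by ring; apply Rmult_le_compat]; lra.
Qed.

Lemma arcsin_coef_nonneg (m : nat) : 0 <= arcsin_coef m.
Proof.
destruct m as [| m]; [simpl; lra | change (0 <= invsqrt_coef m / INR (S m))].
apply Rmult_le_pos; [apply invsqrt_coef_bound |].
left; apply Rinv_0_lt_compat, lt_0_INR; lia.
Qed.

(* [d_m - d_(m+2) = d_m / (m+2)], so the sum telescopes up to a factor 2. *)
Lemma arcsin_coef_sum (n : nat) : sum_n (fun k => arcsin_coef (S k)) n <= 2.
Proof.
assert (T : forall k, arcsin_coef (S k) <= 2 * (invsqrt_coef k - invsqrt_coef (S (S k)))).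
{ intros k; unfold arcsin_coef; rewrite invsqrt_coef_SS.
  destruct (invsqrt_coef_bound k) as [[B _] _]; pose proof (pos_INR k) as P.
  rewrite (S_INR (S k)); assert (P1 : 0 < INR (S k)) by (apply lt_0_INR; lia).
  replace (2 * (invsqrt_coef k - invsqrt_coef k * (INR (S k) / (INR (S k) + 1))))
    with (invsqrt_coef k * (2 / (INR (S k) + 1))) by (field; lra).
  apply Rmult_le_compat_l; [exact B |].
  apply Rmult_le_reg_r with (INR (S k) * (INR (S k) + 1)); [nra |].
  replace (/ INR (S k) * (INR (S k) * (INR (S k) + 1))) with (INR (S k) + 1) by (field; lra).
  replace (2 / (INR (S k) + 1) * (INR (S k) * (INR (S k) + 1))) with (2 * INR (S k))
    by (field; lra).
  rewrite S_INR; lra. }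
(* Telescoping with step two leaves two initial terms, [d_0 + d_1 = 1], and two final ones. *)
assert (H : sum_n (fun k => arcsin_coef (S k)) n
   <= 2 * (1 - invsqrt_coef (S n) - invsqrt_coef (S (S n)))).
{ induction n as [| n IH].
  - rewrite sum_O; eapply Rle_trans; [apply T |]; simpl; lra.
  - rewrite sum_Sn; change plus with Rplus.
    specialize (T (S n)); lra. }
destruct (invsqrt_coef_bound (S n)); lra.
Qed.

Lemma arcsin_coef_le_2 (m : nat) : arcsin_coef m <= 2.
Proof.
destruct m as [| m]; [simpl; lra |].
apply Rle_trans with (sum_n (fun k => arcsin_coef (S k)) m); [| apply arcsin_coef_sum].
destruct m as [| m]; [rewrite sum_O; lra |].
rewrite sum_Sn; change plus with Rplus.
assert (0 <= sum_n (fun k => arcsin_coef (S k)) m); [| lra].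
clear; induction m as [| m IH]; [rewrite sum_O; apply arcsin_coef_nonneg |].
rewrite sum_Sn; apply Rplus_le_le_0_compat; [exact IH | apply arcsin_coef_nonneg].
Qed.

Definition arcsin_series : C -> C := CPSeries (fun n => RtoC (arcsin_coef n)).

Lemma arcsin_coef_summable : disk_summable (fun n => RtoC (arcsin_coef n)).
Proof.
apply (bounded_disk_summable _ 2); intros n.
rewrite Cmod_R, Rabs_right by (apply Rle_ge, arcsin_coef_nonneg); apply arcsin_coef_le_2.
Qed.

Lemma invsqrt_coef_summable : disk_summable (fun n => RtoC (invsqrt_coef n)).
Proof.
apply (bounded_disk_summable _ 1); intros n; destruct (invsqrt_coef_bound n) as [B _].
rewrite Cmod_R, Rabs_right; lra.
Qed.

Section Arcsin.

Let D : C -> C := CPSeries (fun n => RtoC (invsqrt_coef n)).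
Let dD : C -> C := CPSeries (CPS_derive (fun n => RtoC (invsqrt_coef n))).
(** The candidate for the principal square root of [1 - z^2], with [D] its inverse and the
    derivative of the arcsine series. *)
Let sigma (z : C) : C := ((1 - z * z) * D z)%C.

Let A_der (z : C) : Omega z -> Cder arcsin_series z (D z).
Proof.
intros Hz; eapply Cder_eq; [apply Cder_CPSeries; [apply arcsin_coef_summable | exact Hz] |].
apply CPSeries_ext; intros n; unfold CPS_derive; rewrite <- RtoC_mult; f_equal.
unfold arcsin_coef; field; apply not_0_INR; lia.
Qed.

Let D_der (z : C) : Omega z -> Cder D z (dD z).
Proof. apply Cder_CPSeries, invsqrt_coef_summable. Qed.

(** This is [(1 - z^2) D' = z D], which on coefficients reads [(n + 2) d_(n+2) = (n + 1) d_n], since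
    [z D'] has coefficients [n d_n]. *)
Let D_ode (z : C) : Omega z -> dD z = (z * (D z + z * dD z))%C.
Proof.
intros Hz.
assert (Sd := disk_summable_Omega _ z invsqrt_coef_summable Hz).
assert (Sd1 := disk_summable_Omega _ z (disk_summable_derive _ invsqrt_coef_summable) Hz).
assert (Sd2 := summable_S _ Sd1).
unfold dD at 1, CPSeries; rewrite CSeries_S by exact Sd1.
unfold D, dD, CPSeries.
rewrite <- (CSeries_scal z) by exact Sd1.
assert (E : CSeries (fun n => z * (CPS_derive (fun n => RtoC (invsqrt_coef n)) n * z ^ n))%C
   = CSeries (fun n => RtoC (INR n) * (RtoC (invsqrt_coef n) * z ^ n))%C).
{ symmetry; rewrite CSeries_S.
  - rewrite Cmult_0_l, Cplus_0_l; apply CSeries_ext; intros n; unfold CPS_derive.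
    rewrite Cpow_S; ring.
  - apply (ex_series_incr_1 (fun n => Cmod (RtoC (INR n) * (RtoC (invsqrt_coef n) * z ^ n)))).
    apply (ex_series_ext (fun n => Cmod (z * (CPS_derive (fun n => RtoC (invsqrt_coef n)) n * z ^ n)))).
    + intros n; f_equal; unfold CPS_derive; rewrite Cpow_S; ring.
    + apply (summable_scal z), Sd1. }
assert (Sn : summable (fun n => RtoC (INR n) * (RtoC (invsqrt_coef n) * z ^ n))%C).
{ apply (ex_series_incr_1 (fun n => Cmod (RtoC (INR n) * (RtoC (invsqrt_coef n) * z ^ n)))).
  apply (ex_series_ext (fun n => Cmod (z * (CPS_derive (fun n => RtoC (invsqrt_coef n)) n * z ^ n)))).
  + intros n; f_equal; unfold CPS_derive; rewrite Cpow_S; ring.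
  + apply (summable_scal z), Sd1. }
rewrite E, <- CSeries_plus by assumption.
rewrite <- CSeries_scal by (apply summable_plus; assumption).
unfold CPS_derive at 1; simpl invsqrt_coef at 1.
rewrite Cmult_0_r, Cmult_0_l, Cplus_0_l.
apply CSeries_ext; intros n; unfold CPS_derive; rewrite invsqrt_coef_SS, Cpow_S.
replace (RtoC (invsqrt_coef n * (INR (S n) / INR (S (S n)))))
  with (RtoC (invsqrt_coef n) * RtoC (INR (S n) / INR (S (S n))))%C by (symmetry; apply RtoC_mult).
transitivity (RtoC (INR (S (S n)) * (INR (S n) / INR (S (S n)))) *
  (RtoC (invsqrt_coef n) * (z * z ^ n)))%C; [rewrite RtoC_mult; ring |].
replace (INR (S (S n)) * (INR (S n) / INR (S (S n)))) with (INR n + 1)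
  by (rewrite <- S_INR; field; apply not_0_INR; lia).
rewrite RtoC_plus; ring.
Qed.

Let one_minus_sq_der (z : C) : Cder (fun z => 1 - z * z)%C z (- (2) * z)%C.
Proof.
apply (Cder_ext_loc (fun z => 1 + - (1) * (z * z))%C).
- apply filter_forall; intros y; ring.
- eapply Cder_eq.
  + apply Cder_plus; [apply Cder_const |]; apply Cder_scal, Cder_mult; apply Cder_id.
  + cbv beta; replace (RtoC 2) with (1 + 1)%C by (rewrite <- RtoC_plus; reflexivity); ring.
Qed.

Let sigma_der (z : C) : Omega z -> Cder sigma z (- z * D z)%C.
Proof.
intros Hz; eapply Cder_eq.
- apply (Cder_mult (fun z => 1 - z * z)%C D); [apply one_minus_sq_der | apply D_der, Hz].
- cbv beta; pose proof (D_ode z Hz) as E.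
  assert (E' : ((1 - z * z) * dD z)%C = (z * D z)%C).
  { transitivity (dD z - z * z * dD z)%C; [ring | rewrite E at 1; ring]. }
  rewrite E'; replace (RtoC 2) with (1 + 1)%C by (rewrite <- RtoC_plus; reflexivity); ring.
Qed.

Let D_0 : D 0 = 1.
Proof. unfold D; rewrite CPSeries_0; [reflexivity | apply invsqrt_coef_summable]. Qed.

Let sigma_D (z : C) : Omega z -> (sigma z * D z)%C = 1.
Proof.
intros Hz; rewrite (constant_on_Omega (fun z => sigma z * D z)%C); [| | exact Hz].
- unfold sigma; rewrite D_0; ring.
- clear z Hz; intros z Hz; eapply Cder_eq.
  + apply Cder_mult; [apply sigma_der, Hz | apply D_der, Hz].
  + unfold sigma; pose proof (D_ode z Hz) as E.
    transitivity (D z * (dD z - z * (D z + z * dD z)))%C; [ring |].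
    rewrite <- E; ring.
Qed.

Let sigma_sq (z : C) : Omega z -> (sigma z * sigma z)%C = (1 - z * z)%C.
Proof.
intros Hz; transitivity ((1 - z * z) * (sigma z * D z))%C; [unfold sigma at 2; ring |].
rewrite sigma_D by exact Hz; ring.
Qed.

(** The product of [e^(-i A)] and [i z + sigma] is constant: its derivative vanishes by [A' = D],
    [sigma' = - z D] and [sigma D = 1]. *)
Let Cexp_i_A (z : C) : Omega z -> Cexp (Ci * arcsin_series z) = (Ci * z + sigma z)%C.
Proof.
intros Hz.
assert (E : (Cexp (- Ci * arcsin_series z) * (Ci * z + sigma z))%C = 1).
{ rewrite (constant_on_Omega (fun z => Cexp (- Ci * arcsin_series z) * (Ci * z + sigma z))%C);
    [| | exact Hz].
  - unfold arcsin_series; rewrite CPSeries_0 by apply arcsin_coef_summable.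
    simpl arcsin_coef; unfold sigma; rewrite D_0.
    replace (- Ci * 0)%C with (RtoC 0) by ring; rewrite Cexp_0; ring.
  - clear z Hz; intros z Hz; eapply Cder_eq.
    + apply Cder_mult.
      * apply (Cder_Cexp_comp (fun z => - Ci * arcsin_series z)%C), Cder_scal, A_der, Hz.
      * apply Cder_plus; [apply Cder_scal, Cder_id | apply sigma_der, Hz].
    + cbv beta; transitivity (Ci * Cexp (- Ci * arcsin_series z) * (1 - sigma z * D z) -
        (Ci * Ci + 1) * (z * D z * Cexp (- Ci * arcsin_series z)))%C; [ring |].
      rewrite sigma_D by exact Hz.
      replace (Ci * Ci + 1)%C with (RtoC 0); [ring |].
      apply C_ext; unfold Re, Im; simpl; ring. }
replace (- Ci * arcsin_series z)%C with (- (Ci * arcsin_series z))%C in E by ring.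
rewrite Cexp_opp in E.
transitivity (Cexp (Ci * arcsin_series z) * (/ Cexp (Ci * arcsin_series z) * (Ci * z + sigma z)))%C.
- rewrite E; ring.
- field; apply Cexp_neq_0.
Qed.

Let Re_sigma_sq (z : C) : Omega z ->
  Re (sigma z) * Re (sigma z) = Im (sigma z) * Im (sigma z) + 1 - Re z * Re z + Im z * Im z.
Proof.
intros Hz; pose proof (f_equal Re (sigma_sq z Hz)) as E.
assert (E2 : Re (1 - z * z) = 1 - Re z * Re z + Im z * Im z) by (unfold Re, Im; simpl; ring).
rewrite re_mult, E2 in E; lra.
Qed.

Let Re_lt_1 (z : C) : Omega z -> Re z * Re z < 1.
Proof.
intros Hz; unfold Omega in Hz; pose proof (re_le_Cmod z) as B; apply Rabs_le_between in B.
assert (0 < (1 - Re z) * (1 + Re z)) by (apply Rmult_lt_0_compat; lra); lra.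
Qed.

(** If [Re sigma] vanished, [sigma^2] would be real and at most 0, whereas [1 - z^2] has positive
    real part. *)
Let Re_sigma_pos (z : C) : Omega z -> 0 < Re (sigma z).
Proof.
apply (Re_positive_on_Omega sigma (fun z => - z * D z)%C).
- exact sigma_der.
- unfold sigma; rewrite D_0; unfold Re; simpl; lra.
- intros y Hy E; pose proof (Re_sigma_sq y Hy) as H; rewrite E in H.
  pose proof (Re_lt_1 y Hy); nra.
Qed.

(** [Re (i z + sigma) = Re sigma - Im z] is positive because [(Re sigma)^2 > (Im z)^2]; it is also a
    positive multiple of this cosine. *)
Let cos_A_pos (z : C) : Omega z -> 0 < cos (Re (arcsin_series z)).
Proof.
intros Hz; pose proof (f_equal Re (Cexp_i_A z Hz)) as E.
assert (P : 0 < Re (Ci * z + sigma z)).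
{ rewrite re_plus; replace (Re (Ci * z)) with (- Im z) by (unfold Re, Im; simpl; ring).
  pose proof (Re_sigma_sq z Hz); pose proof (Re_sigma_pos z Hz); pose proof (Re_lt_1 z Hz); nra. }
rewrite <- E in P; change (0 < exp (Re (Ci * arcsin_series z)) * cos (Im (Ci * arcsin_series z))) in P.
replace (Im (Ci * arcsin_series z)) with (Re (arcsin_series z)) in P by (unfold Re, Im; simpl; ring).
pose proof (exp_pos (Re (Ci * arcsin_series z))); nra.
Qed.

Let A_0 : arcsin_series 0 = 0.
Proof. unfold arcsin_series; rewrite CPSeries_0 by apply arcsin_coef_summable; reflexivity. Qed.

(** The cosine does not vanish, so [Re A], which is 0 at the origin, cannot reach [pi/2] or
    [- pi/2]; apply [Re_positive_on_Omega] to [pi/2 + A] and [pi/2 - A]. *)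
Let Re_A_bound (z : C) : Omega z -> - (PI / 2) < Re (arcsin_series z) < PI / 2.
Proof.
intros Hz.
assert (H : forall c : R, c = 1 \/ c = -1 ->
   0 < Re (RtoC (PI / 2) + RtoC c * arcsin_series z)).
{ intros c Hc; apply (Re_positive_on_Omega (fun z => RtoC (PI / 2) + RtoC c * arcsin_series z)%C
    (fun z => RtoC c * D z)%C); [| | | exact Hz].
  - intros y Hy; eapply Cder_eq.
    + apply Cder_plus; [apply Cder_const | apply Cder_scal, A_der, Hy].
    + ring.
  - rewrite A_0, Cmult_0_r, Cplus_0_r, re_RtoC; generalize PI_RGT_0; lra.
  - intros y Hy E; rewrite re_plus, re_scal_l, re_RtoC in E.
    pose proof (cos_A_pos y Hy) as P.
    destruct Hc as [-> | ->].
    + replace (Re (arcsin_series y)) with (- (PI / 2)) in P by lra.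
      rewrite cos_neg, cos_PI2 in P; lra.
    + replace (Re (arcsin_series y)) with (PI / 2) in P by lra.
      rewrite cos_PI2 in P; lra. }
pose proof (H 1 (or_introl eq_refl)) as H1; pose proof (H (-1) (or_intror eq_refl)) as H2.
rewrite re_plus, re_scal_l, re_RtoC in H1, H2; lra.
Qed.

Lemma Carcsin_series (z : C) : Omega z -> Carcsin z = arcsin_series z.
Proof.
intros Hz; unfold Carcsin.
rewrite (Csqrt_unique (1 - z * z) (sigma z) (sigma_sq z Hz) (Re_sigma_pos z Hz)).
rewrite <- (Cexp_i_A z Hz), Clog_Cexp.
- transitivity (- (Ci * Ci) * arcsin_series z)%C; [ring |].
  replace (- (Ci * Ci))%C with (RtoC 1) by (apply C_ext; unfold Re, Im; simpl; ring); ring.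
- replace (Im (Ci * arcsin_series z)) with (Re (arcsin_series z)) by (unfold Re, Im; simpl; ring).
  apply Re_A_bound, Hz.
Qed.

End Arcsin.

(** * Extremal functions *)

(** [build m] is a table of the first [m] values. The hypothesis says that [Phi n] reads only
    entries below [n], so the table suffices to compute the next one. *)
Lemma strong_recursion (Phi : nat -> (nat -> R) -> R) :
  (forall n p q, (forall k, (k < n)%nat -> p k = q k) -> Phi n p = Phi n q) ->
  exists p : nat -> R, forall n, p n = Phi n p.
Proof.
intros H.
pose (build := fix build (n : nat) : nat -> R :=
  match n with
  | O => fun _ => 0
  | S m => fun k => if Nat.eqb k m then Phi m (build m) else build m k
  end).
assert (E : forall m k, (k < m)%nat -> build m k = build (S k) k).
{ induction m as [| m IH]; intros k Hk; [lia |].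
  destruct (Nat.eq_dec k m) as [-> | N]; [reflexivity |].
  transitivity (build m k); [| apply IH; lia].
  simpl; rewrite (proj2 (Nat.eqb_neq k m) N); reflexivity. }
exists (fun n => build (S n) n); intros n.
transitivity (Phi n (build n)); [simpl; rewrite Nat.eqb_refl; reflexivity |].
apply H; intros k Hk; apply E, Hk.
Qed.

Lemma sum_n_nonneg (u : nat -> R) (n : nat) : (forall k, 0 <= u k) -> 0 <= sum_n u n.
Proof.
intros H; induction n as [| n IH]; [rewrite sum_O; apply H |].
rewrite sum_Sn; apply Rplus_le_le_0_compat; [exact IH | apply H].
Qed.

Lemma sum_n_Rabs_le (u v : nat -> R) (n : nat) :
  (forall k, (k <= n)%nat -> Rabs (u k) <= v k) -> Rabs (sum_n u n) <= sum_n v n.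
Proof.
induction n as [| n IH]; intros H; [rewrite !sum_O; apply H; lia |].
rewrite !sum_Sn; eapply Rle_trans; [apply Rabs_triang |].
apply Rplus_le_compat; [apply IH; intros k Hk; apply H; lia | apply H; lia].
Qed.

Lemma sum_n_single_last (c : R) (n : nat) :
  sum_n (fun k => if Nat.eqb k n then c else 0) n = c.
Proof.
destruct n as [| n]; [rewrite sum_O; reflexivity |].
rewrite sum_Sn, Nat.eqb_refl.
rewrite (sum_n_ext_loc _ (fun _ => 0)).
- rewrite sum_n_const; unfold plus; simpl; ring.
- intros k Hk; rewrite (proj2 (Nat.eqb_neq k (S n))) by lia; reflexivity.
Qed.

Lemma RtoC_sum_n (u : nat -> R) (n : nat) :
  @sum_n C_AbelianMonoid (fun k => RtoC (u k)) n = RtoC (sum_n u n).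
Proof.
induction n as [| n IH]; [rewrite !sum_O; reflexivity |].
rewrite !sum_Sn, IH; symmetry; apply RtoC_plus.
Qed.

Lemma exp_ode (u v g dg : C -> C) :
  (forall z, Omega z -> Cder u z (v z)) -> (forall z, Omega z -> Cder g z (dg z)) ->
  (forall z, Omega z -> v z = (dg z * u z)%C) -> g 0 = 0 -> u 0 = 1 ->
  forall z, Omega z -> u z = Cexp (g z).
Proof.
intros Hu Hg E g0 u0 z Hz.
assert (H : (u z * Cexp (- (1) * g z))%C = 1).
{ rewrite (constant_on_Omega (fun z => u z * Cexp (- (1) * g z))%C); [| | exact Hz].
  - rewrite g0, u0, Cmult_0_r, Cexp_0; ring.
  - clear z Hz; intros z Hz; eapply Cder_eq.
    + apply Cder_mult; [apply Hu, Hz |].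
      apply (Cder_Cexp_comp (fun z => - (1) * g z)%C), Cder_scal, Hg, Hz.
    + cbv beta; rewrite (E z Hz); ring. }
replace (- (1) * g z)%C with (- g z)%C in H by ring.
rewrite Cexp_opp in H.
replace (u z) with (u z * / Cexp (g z) * Cexp (g z))%C by (field; apply Cexp_neq_0).
rewrite H; ring.
Qed.

(* Noshiro-Warschawski criterion. *)
Lemma univalent_of_Re_derivative_pos (f df : C -> C) :
  (forall z, Omega z -> Cder f z (df z)) -> (forall z, Omega z -> 0 < Re (df z)) ->
  univalent f.
Proof.
intros D P z w Hz Hw E.
destruct (Ceq_dec z w) as [| N]; [assumption | exfalso].
assert (Nd : (w - z)%C <> 0) by (apply Cminus_eq_contra; congruence).
assert (Hin : forall t, 0 <= t <= 1 -> Omega (segment z w t))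
  by (intros t Ht; apply segment_Omega; assumption).
(* Dividing by [w - z] cancels the velocity of the segment, so that the derivative is exactly
   [Re f']. *)
pose (g := fun t => Re (/ (w - z) * f (segment z w t))).
assert (Dg : forall t, 0 <= t <= 1 -> is_derive g t (Re (df (segment z w t)))).
{ intros t Ht.
  pose proof (Cder_scal (/ (w - z)) f _ _ (D _ (Hin t Ht))) as H.
  apply (Cder_curve _ (segment z w) t _ (w - z)%C) in H; [| apply segment_der].
  destruct H as [H _]; replace (Re (df (segment z w t)))
    with (Re (/ (w - z) * df (segment z w t) * (w - z))); [exact H |].
  f_equal; field; exact Nd. }
destruct (MVT_gen g 0 1 (fun t => Re (df (segment z w t)))) as [t [Ht Et]].
- intros t; rewrite Rmin_left, Rmax_right by lra; intros Ht; apply Dg; lra.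
- intros t; rewrite Rmin_left, Rmax_right by lra; intros Ht.
  eapply is_derive_continuity; apply Dg; lra.
- rewrite Rmin_left, Rmax_right in Ht by lra.
  unfold g in Et; rewrite segment_0, segment_1, E in Et.
  specialize (P _ (Hin t Ht)); lra.
Qed.

Lemma CPSeries_shift (a : nat -> C) (z : C) : disk_summable a -> Omega z ->
  CPSeries (fun n => match n with O => RtoC 0 | S k => a k end) z = (z * CPSeries a z)%C.
Proof.
intros Ha Hz; assert (S := disk_summable_Omega a z Ha Hz).
assert (S' := summable_scal z _ S).
unfold CPSeries; rewrite <- CSeries_scal by exact S.
rewrite CSeries_S.
- rewrite Cmult_0_l, Cplus_0_l; apply CSeries_ext; intros n; rewrite Cpow_S; ring.
- apply (ex_series_incr_1 (fun n => Cmod (match n with O => RtoC 0 | S k => a k end * z ^ n))).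
  revert S'; apply ex_series_ext; intros n; f_equal; rewrite Cpow_S; ring.
Qed.

Section Extremal.

Context (s : nat -> R) (omega : C -> C).
Hypothesis s_nonneg : forall n, 0 <= s n.
Hypothesis s_0 : s 0%nat = 0.
(** Used twice: it bounds [B] by [4/pi < pi/2], hence univalence, and through [4/pi < 2] it closes
    the induction that bounds [p]. *)
Hypothesis s_sum : forall n, sum_n (fun k => s (S k)) n <= 4 / PI.
Hypothesis omega_schwarz : Schwarz_function omega.
Hypothesis s_series : forall z, Omega z ->
  CPSeries (fun n => RtoC (s n)) z = (RtoC (2 / PI) * Carcsin (omega z))%C.

Let PI_gt_3 : 3 < PI.
Proof. generalize PI2_3_2; unfold PI2; lra. Qed.

Let four_div_PI : 0 < 4 / PI < PI / 2.
Proof.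
split; [apply Rdiv_lt_0_compat; lra |].
apply Rmult_lt_reg_r with PI; [lra |]; unfold Rdiv at 1; rewrite Rmult_assoc, Rinv_l; nra.
Qed.

Let four_div_PI_lt_2 : 4 / PI < 2.
Proof. apply Rmult_lt_reg_r with PI; [lra |]; unfold Rdiv; rewrite Rmult_assoc, Rinv_l; lra. Qed.

Let s_le_2 (n : nat) : s n <= 2.
Proof.
destruct n as [| n]; [lra |].
apply Rle_trans with (sum_n (fun k => s (S k)) n); [| generalize (s_sum n); lra].
destruct n as [| n]; [rewrite sum_O; lra |].
rewrite sum_Sn; change plus with Rplus.
generalize (sum_n_nonneg (fun k => s (S k)) n (fun k => s_nonneg (S k))); lra.
Qed.

(** The future [log f']. Its constant term [s 0 / INR 0] is 0 because the numerator is. *)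
Let B : C -> C := CPSeries (fun n => RtoC (s n / INR n)).
Let dB : C -> C := CPSeries (fun n => RtoC (s (S n))).

Let quotient_bound (x c : R) (n : nat) : 0 <= c -> Rabs x <= c -> Rabs (x / INR n) <= c.
Proof.
intros Hc Hx; destruct n as [| n].
- unfold Rdiv; simpl; rewrite Rinv_0, Rmult_0_r, Rabs_R0; exact Hc.
- assert (P : 1 <= INR (S n)) by (rewrite S_INR; generalize (pos_INR n); lra).
  unfold Rdiv; rewrite Rabs_mult, (Rabs_right (/ INR (S n)))
    by (apply Rle_ge; left; apply Rinv_0_lt_compat; lra).
  assert (I : / INR (S n) <= 1) by (rewrite <- Rinv_1; apply Rinv_le_contravar; lra).
  assert (0 < / INR (S n)) by (apply Rinv_0_lt_compat; lra).
  pose proof (Rabs_pos x); nra.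
Qed.

Let quotient_der (u : nat -> R) (c : R) (z : C) :
  0 <= c -> (forall n, Rabs (u n) <= c) -> Omega z ->
  Cder (CPSeries (fun n => RtoC (u n / INR n))) z (CPSeries (fun n => RtoC (u (S n))) z).
Proof.
intros Hc Hu Hz; eapply Cder_eq.
- apply Cder_CPSeries; [| exact Hz].
  apply (bounded_disk_summable _ c); intros n; rewrite Cmod_R; apply quotient_bound; auto.
- apply CPSeries_ext; intros n; unfold CPS_derive; rewrite <- RtoC_mult; f_equal.
  field; apply not_0_INR; lia.
Qed.

Let quotient_0 (u : nat -> R) (c : R) : 0 <= c -> u 0%nat = 0 -> (forall n, Rabs (u n) <= c) ->
  CPSeries (fun n => RtoC (u n / INR n)) 0 = 0.
Proof.
intros Hc H0 Hu; rewrite CPSeries_0.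
- rewrite H0; f_equal; unfold Rdiv; ring.
- apply (bounded_disk_summable _ c); intros n; rewrite Cmod_R; apply quotient_bound; auto.
Qed.

Let s_abs (n : nat) : Rabs (s n) <= 2.
Proof. rewrite Rabs_right; [apply s_le_2 | apply Rle_ge, s_nonneg]. Qed.

Let B_der (z : C) : Omega z -> Cder B z (dB z).
Proof. apply (quotient_der s 2); [lra | exact s_abs]. Qed.

Let B_0 : B 0 = 0.
Proof. apply (quotient_0 s 2); [lra | exact s_0 | exact s_abs]. Qed.

Let dB_summable : disk_summable (fun n => RtoC (s (S n))).
Proof. apply (bounded_disk_summable _ 2); intros n; rewrite Cmod_R; apply s_abs. Qed.

Let dB_eq (z : C) : Omega z -> (z * dB z)%C = (RtoC (2 / PI) * Carcsin (omega z))%C.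
Proof.
intros Hz; rewrite <- s_series by exact Hz; unfold dB.
rewrite <- CPSeries_shift by assumption.
apply CPSeries_ext; intros [| n]; [rewrite s_0; reflexivity | reflexivity].
Qed.

Let B_bound (z : C) : Omega z -> Cmod (B z) <= 4 / PI.
Proof.
intros Hz.
assert (Sm : summable (fun n => RtoC (s n / INR n) * z ^ n)%C).
{ apply disk_summable_Omega; [| exact Hz].
  apply (bounded_disk_summable _ 2); intros n; rewrite Cmod_R; apply quotient_bound;
    [lra | apply s_abs]. }
eapply Rle_trans; [apply CSeries_bound, Sm |].
assert (L : is_lim_seq (sum_n (fun n => Cmod (RtoC (s n / INR n) * z ^ n)))
   (Series (fun n => Cmod (RtoC (s n / INR n) * z ^ n)))) by (apply Series_correct, Sm).
change (Rbar_le (Series (fun n => Cmod (RtoC (s n / INR n) * z ^ n))) (4 / PI)).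
apply (is_lim_seq_le (sum_n (fun n => Cmod (RtoC (s n / INR n) * z ^ n))) (fun _ => 4 / PI));
  [| exact L | apply is_lim_seq_const].
intros n; apply Rle_trans with (sum_n s n).
- assert (T : forall k, Cmod (RtoC (s k / INR k) * z ^ k) <= s k).
  { intros k; rewrite Cmod_mult, Cmod_R, Cmod_pow.
    pose proof (quotient_bound (s k) (s k) k (s_nonneg k)) as Q.
    rewrite (Rabs_right (s k)) in Q by (apply Rle_ge, s_nonneg).
    specialize (Q (Rle_refl _)).
    assert (Pz : 0 <= Cmod z ^ k <= 1).
    { unfold Omega in Hz; pose proof (Cmod_ge_0 z); split; [apply pow_le; lra |].
      rewrite <- (pow1 k); apply pow_incr; lra. }
    pose proof (Rabs_pos (s k / INR k)); nra. }
  induction n as [| n IH]; [rewrite !sum_O; apply T |].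
  rewrite !sum_Sn; apply Rplus_le_compat; [exact IH | apply T].
- destruct n as [| n]; [rewrite sum_O; lra |].
  assert (E : sum_n s (S n) = sum_n (fun k => s (S k)) n).
  { induction n as [| n IH]; [rewrite sum_Sn, !sum_O, s_0; unfold plus; simpl; ring |].
    rewrite sum_Sn, IH, sum_Sn; reflexivity. }
  rewrite E; apply s_sum.
Qed.

Section Recursion.

(* [p] is the coefficient sequence of [z f' / f = 1 + z L'], which solves
   [p' = p (B' - L')].  The term [k = m] of that product contains [p (S m)] itself
   and has been moved to the left, whence the factor [m + 2]. *)
Context (p : nat -> R).
Hypothesis p_rec : forall n, p n = match n with
  | O => 1
  | S m => sum_n (fun k => (s (S k) - if Nat.eqb k m then 0 else p (S k)) * p (m - k)%nat) m
           / INR (S (S m))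
  end.

(** By induction each term with [k < m] is at most [s (S k) + 1], and the one with [k = m] at most
    [s (S m)]. The total is at most [4/pi + m], below the divisor [m + 2]. *)
Let p_bound (n : nat) : Rabs (p n) <= 1.
Proof.
induction n as [n IH] using lt_wf_ind; rewrite p_rec.
destruct n as [| m]; [rewrite Rabs_R1; lra |].
assert (P : 0 < INR (S (S m))) by (apply lt_0_INR; lia).
unfold Rdiv; rewrite Rabs_mult, (Rabs_right (/ _))
  by (apply Rle_ge; left; apply Rinv_0_lt_compat, P).
apply Rmult_le_reg_r with (INR (S (S m))); [exact P |].
rewrite Rmult_assoc, Rinv_l, Rmult_1_r, Rmult_1_l by lra.
apply Rle_trans with (sum_n (fun k => s (S k) + (1 - if Nat.eqb k m then 1 else 0)) m).
- apply sum_n_Rabs_le; intros k Hk; rewrite Rabs_mult.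
  assert (P1 : Rabs (p (m - k)%nat) <= 1) by (apply IH; lia).
  pose proof (s_nonneg (S k)) as Ps.
  assert (P2 : Rabs (s (S k) - (if Nat.eqb k m then 0 else p (S k)))
     <= s (S k) + (1 - if Nat.eqb k m then 1 else 0)).
  { destruct (Nat.eqb_spec k m) as [E | N].
    - rewrite Rminus_0_r, Rabs_right; lra.
    - unfold Rminus at 1; eapply Rle_trans; [apply Rabs_triang |].
      rewrite Rabs_Ropp, Rabs_right by lra.
      specialize (IH (S k) ltac:(lia)); lra. }
  pose proof (Rabs_pos (p (m - k)%nat)).
  pose proof (Rabs_pos (s (S k) - (if Nat.eqb k m then 0 else p (S k)))); nra.
- rewrite (sum_n_ext _ (fun k => plus (s (S k)) (1 - if Nat.eqb k m then 1 else 0)))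
    by reflexivity.
  rewrite sum_n_plus, sum_n_Rminus, sum_n_const, sum_n_single_last.
  change plus with Rplus; generalize (s_sum m); rewrite !S_INR; lra.
Qed.

(** Puts the removed term back: since [p 0 = 1] it is [- p (S n)], which lowers the factor [n + 2]
    to [n + 1]. *)
Let p_ode_coef (n : nat) :
  INR (S n) * p (S n) = sum_n (fun k => (s (S k) - p (S k)) * p (n - k)%nat) n.
Proof.
assert (E : INR (S (S n)) * p (S n) =
  sum_n (fun k => (s (S k) - if Nat.eqb k n then 0 else p (S k)) * p (n - k)%nat) n).
{ rewrite (p_rec (S n)); field; apply not_0_INR; lia. }
rewrite S_INR in E.
assert (E2 : sum_n (fun k => (s (S k) - p (S k)) * p (n - k)%nat) n =
  sum_n (fun k => (s (S k) - if Nat.eqb k n then 0 else p (S k)) * p (n - k)%nat) n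
  - sum_n (fun k => if Nat.eqb k n then p (S n) else 0) n).
{ rewrite <- sum_n_Rminus; apply sum_n_ext_loc; intros k Hk.
  match goal with |- ?x = ?y => change (@eq R x y) end.
  destruct (Nat.eqb_spec k n) as [-> | N]; [| ring].
  rewrite Nat.sub_diag, (p_rec 0); ring. }
rewrite E2, sum_n_single_last; lra.
Qed.

Let p_0 : p 0%nat = 1.
Proof. apply p_rec. Qed.

Let q (n : nat) : R := match n with O => 0 | S _ => p n end.

Let q_bound (n : nat) : Rabs (q n) <= 1.
Proof. destruct n as [| n]; [simpl; rewrite Rabs_R0; lra | apply p_bound]. Qed.

Let P : C -> C := CPSeries (fun n => RtoC (p n)).
Let L : C -> C := CPSeries (fun n => RtoC (q n / INR n)).
Let dL : C -> C := CPSeries (fun n => RtoC (p (S n))).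

Let L_der (z : C) : Omega z -> Cder L z (dL z).
Proof. apply (quotient_der q 1); [lra | exact q_bound]. Qed.

Let L_0 : L 0 = 0.
Proof. apply (quotient_0 q 1); [lra | reflexivity | exact q_bound]. Qed.

Let p_summable : disk_summable (fun n => RtoC (p n)).
Proof. apply (bounded_disk_summable _ 1); intros n; rewrite Cmod_R; apply p_bound. Qed.

Let dL_summable : disk_summable (fun n => RtoC (p (S n))).
Proof. apply (bounded_disk_summable _ 1); intros n; rewrite Cmod_R; apply p_bound. Qed.

Let P_eq (z : C) : Omega z -> P z = (1 + z * dL z)%C.
Proof.
intros Hz; unfold P, dL; rewrite <- CPSeries_shift by assumption.
unfold CPSeries; rewrite CSeries_S by (apply disk_summable_Omega; assumption).
rewrite p_0, Cmult_1_l; f_equal.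
symmetry; rewrite CSeries_S; [rewrite Cmult_0_l, Cplus_0_l; reflexivity |].
apply (ex_series_incr_1 (fun n => Cmod (match n with O => RtoC 0 | S k => RtoC (p (S k)) end * z ^ n))).
apply (summable_S (fun n => RtoC (p n) * z ^ n)%C), disk_summable_Omega; assumption.
Qed.

(** This turns [(z e^L)' = (1 + z L') e^L = P e^L] into [e^B]. *)
Let P_exp (z : C) : Omega z -> P z = Cexp (B z + - (1) * L z).
Proof.
apply (exp_ode P (CPSeries (CPS_derive (fun n => RtoC (p n)))) (fun z => B z + - (1) * L z)%C
  (fun z => dB z + - (1) * dL z)%C).
- intros y Hy; apply Cder_CPSeries; assumption.
- intros y Hy; apply Cder_plus; [apply B_der, Hy | apply Cder_scal, L_der, Hy].
- intros y Hy; unfold dB, dL, P.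
  assert (E : (CPSeries (fun n => RtoC (s (S n))) y + - (1) * CPSeries (fun n => RtoC (p (S n))) y)%C
     = CPSeries (fun n => RtoC (s (S n) - p (S n))) y).
  { unfold CPSeries; rewrite <- CSeries_scal, <- CSeries_plus;
      try apply summable_scal; try (apply disk_summable_Omega; assumption).
    apply CSeries_ext; intros n; rewrite RtoC_minus; ring. }
  rewrite E, CPSeries_mult; [| | assumption | assumption].
  + apply CPSeries_ext; intros n; unfold CPS_derive; rewrite <- RtoC_mult, p_ode_coef.
    rewrite <- RtoC_sum_n; apply sum_n_ext; intros k; apply RtoC_mult.
  + apply (bounded_disk_summable _ 3); intros n; rewrite Cmod_R.
    unfold Rminus; eapply Rle_trans; [apply Rabs_triang |]; rewrite Rabs_Ropp.
    generalize (s_abs (S n)) (p_bound (S n)); lra.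
- rewrite B_0, L_0; ring.
- unfold P; rewrite CPSeries_0, p_0 by assumption; reflexivity.
Qed.

Context (e : nat -> R).
(** The coefficients of [e^L], from [(e^L)' = L' e^L]. Each is an average of [m + 1] products of
    numbers of modulus at most 1, hence is itself at most 1 in modulus. *)
Hypothesis e_rec : forall n, e n = match n with
  | O => 1
  | S m => sum_n (fun k => p (S k) * e (m - k)%nat) m / INR (S m)
  end.

Let e_bound (n : nat) : Rabs (e n) <= 1.
Proof.
induction n as [n IH] using lt_wf_ind; rewrite e_rec.
destruct n as [| m]; [rewrite Rabs_R1; lra |].
assert (Pm : 0 < INR (S m)) by (apply lt_0_INR; lia).
unfold Rdiv; rewrite Rabs_mult, (Rabs_right (/ _))
  by (apply Rle_ge; left; apply Rinv_0_lt_compat, Pm).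
apply Rmult_le_reg_r with (INR (S m)); [exact Pm |].
rewrite Rmult_assoc, Rinv_l, Rmult_1_r, Rmult_1_l by lra.
rewrite <- (Rmult_1_r (INR (S m))), <- (sum_n_const m 1).
apply sum_n_Rabs_le; intros k Hk; rewrite Rabs_mult.
assert (E1 : Rabs (e (m - k)%nat) <= 1) by (apply IH; lia).
pose proof (p_bound (S k)); pose proof (Rabs_pos (p (S k))); pose proof (Rabs_pos (e (m - k)%nat)).
nra.
Qed.

Let e_summable : disk_summable (fun n => RtoC (e n)).
Proof. apply (bounded_disk_summable _ 1); intros n; rewrite Cmod_R; apply e_bound. Qed.

Let E_exp (z : C) : Omega z -> CPSeries (fun n => RtoC (e n)) z = Cexp (L z).
Proof.
apply (exp_ode _ (CPSeries (CPS_derive (fun n => RtoC (e n)))) L dL).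
- intros y Hy; apply Cder_CPSeries; assumption.
- exact L_der.
- intros y Hy; unfold dL; rewrite CPSeries_mult by assumption.
  apply CPSeries_ext; intros n; unfold CPS_derive; rewrite <- RtoC_mult.
  assert (Ee : INR (S n) * e (S n) = sum_n (fun k => p (S k) * e (n - k)%nat) n)
    by (rewrite (e_rec (S n)); field; apply not_0_INR; lia).
  rewrite Ee, <- RtoC_sum_n; apply sum_n_ext; intros k; apply RtoC_mult.
- exact L_0.
- rewrite CPSeries_0, (e_rec 0) by assumption; reflexivity.
Qed.

Let a (n : nat) : C := match n with O => RtoC 0 | S k => RtoC (e k) end.
Let f : C -> C := CPSeries a.

Let a_summable : disk_summable a.
Proof.
apply (bounded_disk_summable _ 1); intros [| n]; unfold a; [rewrite Cmod_0; lra |].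
rewrite Cmod_R; apply e_bound.
Qed.

Let f_eq (z : C) : Omega z -> f z = (z * Cexp (L z))%C.
Proof.
intros Hz; rewrite <- E_exp by exact Hz; apply CPSeries_shift; assumption.
Qed.

Let f_der (z : C) : Omega z -> Cder f z (Cexp (B z)).
Proof.
intros Hz; apply (Cder_ext_loc (fun z => z * Cexp (L z))%C).
- generalize (Omega_open z Hz); apply filter_imp; intros y Hy; symmetry; apply f_eq, Hy.
- eapply Cder_eq.
  + apply (Cder_mult (fun z => z) (fun z => Cexp (L z))); [apply Cder_id |].
    apply Cder_Cexp_comp, L_der, Hz.
  + transitivity ((1 + z * dL z) * Cexp (L z))%C; [ring |].
    rewrite <- P_eq, P_exp, <- Cexp_plus by exact Hz; f_equal; ring.
Qed.

Let f_class_S : class_S f.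
Proof.
split; [split |].
- intros z Hz; exists (Cexp (B z)); apply Cder_is_derive, f_der, Hz.
- exists a; split; [reflexivity |]; split; [unfold a; rewrite e_rec; reflexivity |].
  intros z Hz; apply CPSeries_power_series; assumption.
- apply (univalent_of_Re_derivative_pos f (fun z => Cexp (B z))); [exact f_der |].
  intros z Hz; change (0 < exp (Re (B z)) * cos (Im (B z))).
  apply Rmult_lt_0_compat; [apply exp_pos |].
  pose proof (B_bound z Hz) as Hb; pose proof (im_le_Cmod (B z)) as Hi.
  assert (H : Rabs (Im (B z)) <= 4 / PI) by lra.
  apply Rabs_le_between in H; apply cos_gt_0; lra.
Qed.

Let f_class : class_C_arcsin f.
Proof.
split; [exact f_class_S |].
exists omega; split; [exact omega_schwarz |].
intros z Hz.
assert (D1 : forall y, Omega y -> C_derive f y = Cexp (B y)).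
{ intros y Hy; apply (Cder_C_derive f (fun y => Cexp (B y))), f_der, Hy. }
assert (D2 : C_derive (C_derive f) z = (dB z * Cexp (B z))%C).
{ apply (Cder_C_derive (C_derive f) (fun z => dB z * Cexp (B z))%C).
  apply (Cder_ext_loc (fun y => Cexp (B y))).
  - generalize (Omega_open z Hz); apply filter_imp; intros y Hy; symmetry; apply D1, Hy.
  - apply Cder_Cexp_comp, B_der, Hz. }
rewrite D2, (D1 z Hz), <- dB_eq by exact Hz; field; apply Cexp_neq_0.
Qed.

Let gamma (n : nat) : C := RtoC (p n / (2 * INR n)).

Let f_logarithmic_coefficients : logarithmic_coefficients f gamma.
Proof.
exists L; split; [| split; [exact L_0 | split]].
- intros z Hz; exists (dL z); apply Cder_is_derive, L_der, Hz.
- intros z Hz N; rewrite f_eq by exact Hz; field; exact N.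
- intros z Hz.
  pose (c := fun n => RtoC (q n / INR n)).
  assert (Sc : disk_summable c).
  { apply (bounded_disk_summable _ 1); intros n; unfold c; rewrite Cmod_R; apply quotient_bound;
      [lra | apply q_bound]. }
  generalize (CPSeries_power_series c z Sc Hz).
  apply is_pseries_ext; intros [| n]; unfold c, gamma, q.
  + f_equal; unfold Rdiv; ring.
  + rewrite <- RtoC_mult; f_equal; field; apply not_0_INR; lia.
Qed.

Lemma extremal_of_sequences : exists (f : C -> C) (gamma : nat -> C),
  class_C_arcsin f /\ logarithmic_coefficients f gamma /\
  gamma 1%nat = RtoC (s 1%nat / 4) /\
  gamma 2%nat = RtoC ((s 2%nat + s 1%nat * s 1%nat / 4) / 12).
Proof.
assert (p1 : p 1%nat = s 1%nat / 2).
{ rewrite p_rec, sum_O; simpl; rewrite p_0; field. }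
assert (p2 : p 2%nat = (s 2%nat + s 1%nat * s 1%nat / 4) / 3).
{ rewrite p_rec, sum_Sn, sum_O; unfold plus; simpl; rewrite p_0, p1; field. }
exists f, gamma; split; [exact f_class | split; [exact f_logarithmic_coefficients |]].
split; unfold gamma; f_equal; [rewrite p1 | rewrite p2]; simpl; field.
Qed.

End Recursion.

Lemma extremal_function : exists (f : C -> C) (gamma : nat -> C),
  class_C_arcsin f /\ logarithmic_coefficients f gamma /\
  gamma 1%nat = RtoC (s 1%nat / 4) /\
  gamma 2%nat = RtoC ((s 2%nat + s 1%nat * s 1%nat / 4) / 12).
Proof.
destruct (strong_recursion (fun n p => match n with
  | O => 1
  | S m => sum_n (fun k => (s (S k) - if Nat.eqb k m then 0 else p (S k)) * p (m - k)%nat) m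
           / INR (S (S m))
  end)) as [p Hp].
{ intros [| m] u v H; [reflexivity |]; f_equal; apply sum_n_ext_loc; intros k Hk.
  rewrite (H (m - k)%nat) by lia; destruct (Nat.eqb_spec k m); [reflexivity |].
  rewrite (H (S k)) by lia; reflexivity. }
destruct (strong_recursion (fun n e => match n with
  | O => 1
  | S m => sum_n (fun k => p (S k) * e (m - k)%nat) m / INR (S m)
  end)) as [e He].
{ intros [| m] u v H; [reflexivity |]; f_equal; apply sum_n_ext_loc; intros k Hk.
  rewrite (H (m - k)%nat) by lia; reflexivity. }
exact (extremal_of_sequences p Hp e He).
Qed.

End Extremal.

(** * The two cases of equality *)

Lemma two_div_PI_pos : 0 < 2 / PI.
Proof. apply Rdiv_lt_0_compat; generalize PI_RGT_0; lra. Qed.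

Lemma sum_n_scal_le (c M : R) (u : nat -> R) (n : nat) :
  0 <= c -> sum_n u n <= M -> sum_n (fun k => c * u k) n <= c * M.
Proof.
intros Hc H; replace (sum_n (fun k => c * u k) n) with (c * sum_n u n).
- apply Rmult_le_compat_l; assumption.
- symmetry; apply (sum_n_mult_l (K := R_Ring)).
Qed.

Lemma CPSeries_Rscal (c : R) (u : nat -> R) (z : C) : disk_summable (fun n => RtoC (u n)) ->
  Omega z ->
  CPSeries (fun n => RtoC (c * u n)) z = (RtoC c * CPSeries (fun n => RtoC (u n)) z)%C.
Proof.
intros H Hz; unfold CPSeries.
rewrite <- CSeries_scal by (apply (disk_summable_Omega (fun n => RtoC (u n))); assumption).
apply CSeries_ext; intros n; rewrite RtoC_mult; ring.
Qed.

Lemma extremal_lower : exists (f : C -> C) (gamma : nat -> C),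
  class_C_arcsin f /\ logarithmic_coefficients f gamma /\
  Cmod (gamma 2%nat) - Cmod (gamma 1%nat) = - (1 / (2 * PI)) * (1 - 1 / (6 * PI)).
Proof.
pose proof PI_RGT_0 as P; pose proof two_div_PI_pos as P2.
destruct (extremal_function (fun n => 2 / PI * arcsin_coef n) (fun z => z))
  as [f [gamma [Hf [Hg [G1 G2]]]]].
- intros n; apply Rmult_le_pos; [lra | apply arcsin_coef_nonneg].
- simpl; ring.
- intros n; replace (4 / PI) with (2 / PI * 2) by (field; lra).
  apply sum_n_scal_le; [lra | apply arcsin_coef_sum].
- split; [| split].
  + intros z _; exists (RtoC 1); apply Cder_is_derive, Cder_id.
  + reflexivity.
  + unfold Omega; intros z Hz; lra.
- intros z Hz; rewrite Carcsin_series by exact Hz.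
  apply CPSeries_Rscal; [apply arcsin_coef_summable | exact Hz].
- exists f, gamma; split; [exact Hf | split; [exact Hg |]].
  rewrite G1, G2, !Cmod_R.
  (* This makes [gamma_1 = 1/(2 pi)] and [gamma_2 = 1/(12 pi^2)]. *)
  replace (arcsin_coef 1) with 1 by (simpl; field).
  replace (arcsin_coef 2) with 0 by (simpl; field).
  assert (A : 0 < 2 / PI * 1 / 4) by lra.
  assert (B : 0 < (2 / PI * 0 + 2 / PI * 1 * (2 / PI * 1) / 4) / 12) by nra.
  rewrite !Rabs_right by lra; field; lra.
Qed.

Lemma Series_even (u : nat -> R) : ex_series u -> (forall n, u (S (2 * n)) = 0) ->
  Series u = Series (fun n => u (2 * n)%nat).
Proof.
intros H Z; symmetry; apply is_series_unique.
apply (filterlim_ext (fun n => sum_n u (2 * n))).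
- induction x as [| n IH]; [rewrite !sum_O; reflexivity |].
  rewrite sum_Sn, <- IH.
  replace (2 * S n)%nat with (S (S (2 * n))) by lia.
  rewrite !sum_Sn, Z; unfold plus; simpl; ring.
- apply (filterlim_comp _ _ _ (fun n => 2 * n)%nat (sum_n u) _ eventually).
  + apply eventually_subseq; intros n; lia.
  + apply Series_correct, H.
Qed.

Lemma CPSeries_even (a b : nat -> C) (z : C) : disk_summable a -> Omega z ->
  (forall n, a (2 * n)%nat = b n) -> (forall n, a (S (2 * n)) = 0) ->
  CPSeries a z = CPSeries b (z * z)%C.
Proof.
intros Ha Hz E0 E1.
assert (Sa := disk_summable_Omega a z Ha Hz).
assert (Ez : forall n, (b n * (z * z) ^ n)%C = (a (2 * n)%nat * z ^ (2 * n))%C).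
{ intros n; rewrite E0, Cpow_mult_r; do 2 f_equal; simpl; ring. }
unfold CPSeries; rewrite (CSeries_ext _ _ Ez); unfold CSeries.
f_equal; apply Series_even; try (intros n; rewrite E1, Cmult_0_l; reflexivity).
- apply (summable_Re _ Sa).
- apply (summable_Im _ Sa).
Qed.

Definition even_coef (u : nat -> R) (n : nat) : R := if Nat.even n then u (Nat.div2 n) else 0.

Lemma even_coef_even (u : nat -> R) (n : nat) : even_coef u (2 * n) = u n.
Proof. unfold even_coef; rewrite Nat.even_even, Nat.div2_double; reflexivity. Qed.

Lemma even_coef_odd (u : nat -> R) (n : nat) : even_coef u (S (2 * n)) = 0.
Proof.
unfold even_coef; replace (S (2 * n)) with (2 * n + 1)%nat by lia.
rewrite Nat.even_odd; reflexivity.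
Qed.

(** Inserting zeros does not change the partial sums that end at a nonzero place; any other one is
    dominated by a longer one, as the terms are nonnegative. *)
Lemma even_coef_sum (u : nat -> R) (M : R) : (forall n, 0 <= u n) ->
  (forall n, sum_n (fun k => u (S k)) n <= M) ->
  forall n, sum_n (fun k => even_coef u (S k)) n <= M.
Proof.
intros Hu HM n.
assert (N : forall k, 0 <= even_coef u k).
{ intros k; unfold even_coef; destruct (Nat.even k); [apply Hu | lra]. }
assert (Ev : forall m, even_coef u (S (S (2 * m))) = u (S m)).
{ intros m; replace (S (S (2 * m))) with (2 * S m)%nat by lia; apply even_coef_even. }
assert (E : forall m, sum_n (fun k => even_coef u (S k)) (S (2 * m)) = sum_n (fun k => u (S k)) m).
{ induction m as [| m IH].
  - rewrite sum_Sn, !sum_O, Ev, (even_coef_odd u 0 : even_coef u 1 = 0); apply Rplus_0_l.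
  - replace (2 * S m)%nat with (S (S (2 * m))) by lia.
    rewrite (sum_Sn _ (S (S _))), (sum_Sn _ (S _)), IH, (sum_Sn (fun k => u (S k))).
    replace (S (S (2 * m))) with (2 * S m)%nat by lia.
    rewrite Ev, even_coef_odd; change plus with Rplus; rewrite Rplus_0_r; reflexivity. }
apply Rle_trans with (sum_n (fun k => even_coef u (S k)) (S (2 * n))); [| rewrite E; apply HM].
assert (Mono : forall d, sum_n (fun k => even_coef u (S k)) n
   <= sum_n (fun k => even_coef u (S k)) (n + d)).
{ induction d as [| d IH]; [rewrite Nat.add_0_r; lra |].
  rewrite Nat.add_succ_r, sum_Sn; change plus with Rplus.
  specialize (N (S (S (n + d)))); lra. }
replace (S (2 * n)) with (n + S n)%nat by lia; apply Mono.
Qed.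

Lemma extremal_upper : exists (f : C -> C) (gamma : nat -> C),
  class_C_arcsin f /\ logarithmic_coefficients f gamma /\
  Cmod (gamma 2%nat) - Cmod (gamma 1%nat) = 1 / (6 * PI).
Proof.
pose proof PI_RGT_0 as P; pose proof two_div_PI_pos as P2.
assert (Pos : forall n, 0 <= even_coef arcsin_coef n).
{ intros n; unfold even_coef; destruct (Nat.even n); [apply arcsin_coef_nonneg | lra]. }
assert (Sm : disk_summable (fun n => RtoC (even_coef arcsin_coef n))).
{ apply (bounded_disk_summable _ 2); intros n; rewrite Cmod_R, Rabs_right by (apply Rle_ge, Pos).
  unfold even_coef; destruct (Nat.even n); [apply arcsin_coef_le_2 | lra]. }
assert (sq : forall z, Omega z -> Omega (z * z)).
{ unfold Omega; intros z Hz; rewrite Cmod_mult; pose proof (Cmod_ge_0 z); nra. }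
destruct (extremal_function (fun n => 2 / PI * even_coef arcsin_coef n) (fun z => z * z)%C)
  as [f [gamma [Hf [Hg [G1 G2]]]]].
- intros n; apply Rmult_le_pos; [lra | apply Pos].
- unfold even_coef; simpl; ring.
- intros n; replace (4 / PI) with (2 / PI * 2) by (field; lra).
  apply sum_n_scal_le; [lra |].
  apply even_coef_sum; [apply arcsin_coef_nonneg | apply arcsin_coef_sum].
- split; [| split].
  + intros z _; exists (1 * z + z * 1)%C.
    apply Cder_is_derive, (Cder_mult (fun z => z) (fun z => z)); apply Cder_id.
  + ring.
  + intros z Hz; left; apply (sq z Hz).
- intros z Hz; rewrite Carcsin_series by (apply sq, Hz).
  rewrite CPSeries_Rscal by assumption; f_equal.
  apply CPSeries_even; [exact Sm | exact Hz | |]; intros n;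
    [rewrite even_coef_even | rewrite even_coef_odd]; reflexivity.
- exists f, gamma; split; [exact Hf | split; [exact Hg |]].
  rewrite G1, G2, !Cmod_R.
  (* Here [gamma_1 = 0] and [gamma_2 = (2/pi)/12]. *)
  replace (even_coef arcsin_coef 1) with 0 by reflexivity.
  replace (even_coef arcsin_coef 2) with 1 by (unfold even_coef; simpl; field).
  replace (2 / PI * 0 / 4) with 0 by (field; lra).
  replace ((2 / PI * 1 + 2 / PI * 0 * (2 / PI * 0) / 4) / 12) with (1 / (6 * PI)) by (field; lra).
  rewrite Rabs_R0, Rabs_right; [ring |].
  left; apply Rdiv_lt_0_compat; lra.
Qed.

Theorem theorem3p4 :
  (forall (f : C -> C) (gamma : nat -> C),
     class_C_arcsin f -> logarithmic_coefficients f gamma ->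
     - (1 / (2 * PI)) * (1 - 1 / (6 * PI))
       <= Cmod (gamma 2%nat) - Cmod (gamma 1%nat)
       <= 1 / (6 * PI)) /\
  (exists (f : C -> C) (gamma : nat -> C),
     class_C_arcsin f /\ logarithmic_coefficients f gamma /\
     Cmod (gamma 2%nat) - Cmod (gamma 1%nat)
       = - (1 / (2 * PI)) * (1 - 1 / (6 * PI))) /\
  (exists (f : C -> C) (gamma : nat -> C),
     class_C_arcsin f /\ logarithmic_coefficients f gamma /\
     Cmod (gamma 2%nat) - Cmod (gamma 1%nat) = 1 / (6 * PI)).
Proof.
split; [exact logarithmic_coefficients_bounds |].
split; [exact extremal_lower | exact extremal_upper].
Qed.
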